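(* Let $\mathcal A=(d_0,\dots,d_k,\psi)$ be a neural network architecture with SAD activation function $\psi\colon\mathbb R\to\mathbb R$, and let $f\colon\mathbb R^{d_0}\to\mathbb R^{d_k}$ be a polynomial map of degree at least $2$. Then there exist an integer $N\in\mathbb N$ and a conull dense open subset $\mathcal D_N\subseteq(\mathbb R^{d_0})^N$ such that the following holds. For any measurable loss function $\ell\colon\mathbb R^{d_k}\times\mathbb R^{d_k}\to[0,\infty)$ and any probability measure $\mu$ on $\mathbb R^{d_0}$ such that either (i) $\mu=\frac1n\sum_{i=1}^n\delta_{x_i}$ for some $n\ge N$ and $x_1,\dots,x_n\in\mathbb R^{d_0}$ with $(x_1,\dots,x_N)\in\mathcal D_N$, or (ii) $d\mu(x)=p(x)\,dx$ for a measurable function $p\colon\mathbb R^{d_0}\to[0,\infty)$, or such that $\mu$ is a convex combination of a measure as in (i) and a measure as in (ii), the expected loss $\mathcal L(\theta)=\mathbb E_{x\sim\mu}[\ell(\mathcal N^{\mathcal A}_\theta(x),f(x))]$ satisfies $\mathcal L(\theta)>0$ for all $\theta\in\mathbb R^{d(\mathcal A)}$. Moreover, if $d_0=1$, then $\mathcal D_N$ can be chosen to be the set of all tuples $(x_1,\dots,x_N)$ with $x_1,\dots,x_N$ pairwise distinct.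
   Context: A function $g\colon\mathbb R^n\to\mathbb R^m$ is SAD (sublinear analytic definable) if (S) $\limsup_{t\to\infty}\|g(tx)\|/t<\infty$ for every $x\in\mathbb R^n$; (A) $g$ is real analytic; (D) $g$ is definable in some o-minimal structure. Here an o-minimal structure is a collection $\mathcal S_n\subseteq\mathcal P(\mathbb R^n)$, $n\in\mathbb N$, closed under finite Boolean operations, Cartesian products and coordinate projections, containing $\{p>0\}$ and $\{p=0\}$ for all real polynomials $p$, and such that every set in $\mathcal S_1$ is a finite union of points and intervals; a function is definable if its graph lies in some $\mathcal S_n$. A loss function is a function $\ell\colon\mathbb R^n\times\mathbb R^n\to[0,\infty)$ with $\ell(x,y)=0\iff x=y$. A neural network architecture is $\mathcal A=(d_0,\dots,d_k,\psi)$ with positive integers $d_i$ and $\psi\colon\mathbb R\to\mathbb R$; $d(\mathcal A)=\sum_{i=1}^kd_i(d_{i-1}+1)$; $\theta\in\mathbb R^{d(\mathcal A)}$ is identified with $(W_1,b_1,\dots,W_k,b_k)$, $W_i\in\mathbb R^{d_i\times d_{i-1}},b_i\in\mathbb R^{d_i}$; the response is $\mathcal N^{\mathcal A}_\theta=f_k\circ\dots\circ f_1$ with $f_i(x)=\psi^{(d_i)}(W_ix+b_i)$ ($i<k$, $\psi$ applied componentwise) and $f_k(x)=W_kx+b_k$. $\delta_x$ denotes the Dirac measure at $x$. *)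

(* Defs.v *)
From HB Require Import structures.
From mathcomp Require Import all_boot all_order all_algebra.
From mathcomp Require Import all_classical all_reals all_analysis.
From mathcomp Require mpoly.
Set Implicit Arguments. Unset Strict Implicit. Unset Printing Implicit Defensive.
Import Order.TTheory GRing.Theory Num.Theory.
Import numFieldNormedType.Exports.
Local Open Scope classical_set_scope.
Local Open Scope ring_scope.

Section matrix_borel.
Context (R : realType) (m n : nat).
Let borel_mx : set (set 'M[R]_(m, n)) := <<s open >>.
Let bm0 : borel_mx set0. Proof. exact: sigma_algebra0. Qed.
Let bmC A : borel_mx A -> borel_mx (~` A). Proof. exact: sigma_algebraC. Qed.
Let bmU (F : (set 'M[R]_(m, n))^nat) : (forall i, borel_mx (F i)) -> borel_mx (\bigcup_i F i).
Proof. exact: sigma_algebra_bigcup. Qed.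
HB.instance Definition _ := @isMeasurable.Build default_measure_display 'M[R]_(m, n) borel_mx bm0 bmC bmU.
End matrix_borel.


Section defs.
Context (R : realType).

Definition poly_eval (n : nat) (p : mpoly.mpoly n R) (x : 'rV[R]_n) : R :=
  mpoly.meval (fun i => x ord0 i) p.

Record o_minimal (S : forall n : nat, set (set 'rV[R]_n)) : Prop := {
  om_setC : forall n (A : set 'rV[R]_n), S n A -> S n (~` A);
  om_setU : forall n (A B : set 'rV[R]_n), S n A -> S n B -> S n (A `|` B);
  om_setI : forall n (A B : set 'rV[R]_n), S n A -> S n B -> S n (A `&` B);
  om_prod : forall m n (A : set 'rV[R]_m) (B : set 'rV[R]_n), S m A -> S n B ->
      S (m + n)%N [set row_mx a b | a in A & b in B];
  om_proj : forall m n (A : set 'rV[R]_(m + n)), S (m + n)%N A ->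
      S m [set lsubmx x | x in A];
  om_poly_pos : forall n (p : mpoly.mpoly n R), S n [set x | 0 < poly_eval p x];
  om_poly_eq0 : forall n (p : mpoly.mpoly n R), S n [set x | poly_eval p x = 0];
  om_tame : forall A : set 'rV[R]_1, S 1%N A ->
      exists s : seq (interval R),
        [set t : R | A (\row_(i < 1) t)] = \big[setU/set0]_(I <- s) [set` I]
}.

Definition definable (g : R -> R) : Prop :=
  exists S, o_minimal S /\ S 2%N [set x : 'rV[R]_2 | x ord0 ord_max = g (x ord0 ord0)].

Definition sublinear (g : R -> R) : Prop :=
  forall x : R, (limf_esup (fun t : R => (`|g (t * x)| / t)%:E) +oo%R < +oo)%E.

Definition real_analytic (g : R -> R) : Prop :=
  forall x0 : R, exists r : R, 0 < r /\ exists a : nat -> R,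
    forall x : R, `|x - x0| < r ->
      (fun N : nat => \sum_(k < N) a k * (x - x0) ^+ k) @ \oo --> g x.

Definition SAD (g : R -> R) : Prop := sublinear g /\ real_analytic g /\ definable g.

(* Architecture (d_0, ..., d_{k+1}, psi): the layer maps are
   f_{j+1}(x) = psi(W_j x + b_j) for j < k and f_{k+1}(x) = W_k x + b_k,
   with W_j : 'M_(d (j+1), d j) and b_j : 'cV_(d (j+1)). *)
Fixpoint hidden (d : nat -> nat) (psi : R -> R)
    (W : forall j : nat, 'M[R]_(d j.+1, d j)) (b : forall j : nat, 'cV[R]_(d j.+1))
    (j : nat) : 'cV[R]_(d O) -> 'cV[R]_(d j) :=
  match j return 'cV[R]_(d O) -> 'cV[R]_(d j) with
  | O => fun x => x
  | j'.+1 => fun x => map_mx psi (W j' *m @hidden d psi W b j' x + b j')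
  end.

Definition response (k : nat) (d : nat -> nat) (psi : R -> R)
    (W : forall j : nat, 'M[R]_(d j.+1, d j)) (b : forall j : nat, 'cV[R]_(d j.+1))
    (x : 'cV[R]_(d O)) : 'cV[R]_(d k.+1) :=
  W k *m hidden psi W b k x + b k.

Definition poly_map (n m : nat) (F : 'I_m -> mpoly.mpoly n R) (x : 'cV[R]_n) : 'cV[R]_m :=
  \col_(j < m) mpoly.meval (fun i => x i ord0) (F j).

(* total degree of a multivariate polynomial: the largest total degree of a
   monomial in its support (0 for the zero polynomial) *)
Definition mpoly_deg (n : nat) (p : mpoly.mpoly n R) : nat :=
  \max_(mo <- mpoly.msupp p) mpoly.mdeg mo.

Definition poly_map_deg (n m : nat) (F : 'I_m -> mpoly.mpoly n R) : nat :=
  \max_(j < m) mpoly_deg (F j).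

Definition mbox (m n : nat) (a b : 'M[R]_(m, n)) : set 'M[R]_(m, n) :=
  [set x | forall i j, a i j <= x i j <= b i j].

Definition mbox_vol (m n : nat) (a b : 'M[R]_(m, n)) : R :=
  \prod_(i < m) \prod_(j < n) Num.max 0 (b i j - a i j).

Definition leb_outer (m n : nat) (A : set 'M[R]_(m, n)) : \bar R :=
  ereal_inf [set s | exists (I : set nat) (a b : nat -> 'M[R]_(m, n)),
    A `<=` \bigcup_(k in I) mbox (a k) (b k) /\
    s = (\sum_(k <oo | k \in I) (mbox_vol (a k) (b k))%:E)%E].

Definition conull (m n : nat) (D : set 'M[R]_(m, n)) : Prop := leb_outer (~` D) = 0%E.

Definition conull_dense_open (m n : nat) (D : set 'M[R]_(m, n)) : Prop :=
  conull D /\ dense D /\ open D.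

(* tuples (x_1, ..., x_N) of points of R^d0, stored as the rows of an N x d0 matrix *)
Definition pairwise_distinct (N d0 : nat) : set 'M[R]_(N, d0) :=
  [set X | forall i j : 'I_N, i != j -> row i X != row j X].

Definition loss_function (n : nat) (ell : 'cV[R]_n -> 'cV[R]_n -> R) : Prop :=
  (forall x y, 0 <= ell x y) /\ (forall x y, ell x y = 0 <-> x = y).

Definition measurable_loss (n : nat) (ell : 'cV[R]_n -> 'cV[R]_n -> R) : Prop :=
  loss_function ell /\ measurable_fun setT (fun z : 'cV[R]_n * 'cV[R]_n => ell z.1 z.2).

Definition empirical_as_in_i (d0 N : nat) (D : set 'M[R]_(N, d0))
    (m : set 'cV[R]_d0 -> \bar R) : Prop :=
  exists (n : nat) (x : nat -> 'cV[R]_d0), (N <= n)%N /\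
    D (\matrix_(i < N, j < d0) x i j ord0) /\
    forall A, measurable A ->
      m A = ((n%:R)^-1%:E * \sum_(i < n) (@dirac _ _ (x i) R A))%E.

Definition density_as_in_ii (d0 : nat) (m : set 'cV[R]_d0 -> \bar R) : Prop :=
  exists p : 'cV[R]_d0 -> R, measurable_fun setT p /\ (forall x, 0 <= p x) /\
    (\int[@leb_outer d0 1]_x (p x)%:E = 1)%E /\
    forall A, measurable A -> m A = (\int[@leb_outer d0 1]_(x in A) (p x)%:E)%E.

Definition admissible (d0 N : nat) (D : set 'M[R]_(N, d0))
    (mu : set 'cV[R]_d0 -> \bar R) : Prop :=
  empirical_as_in_i D mu \/ density_as_in_ii mu \/
  exists t : R, 0 <= t <= 1 /\ exists m1 m2,
    empirical_as_in_i D m1 /\ density_as_in_ii m2 /\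
    forall A, measurable A -> mu A = (t%:E * m1 A + (1 - t)%:E * m2 A)%E.

End defs.

(* Main.v *)
(* The agreement set of a network with the polynomial map F is never a neighbourhood: along
   a line, response and F are analytic, so local agreement propagates to the whole space,
   where the response grows at most linearly and F does not. All agreement sets form one
   family Z_t, definable in an o-minimal structure, indexed by the parameters t in R^q.
   If d_0 = 1, every Z_t is finite and uniform finiteness bounds their cardinalities. In
   general, if N > 2 q, then the union over t of the powers Z_t^N has empty interior (each of
   the q parameters is determined up to finitely many values by two of the N points); its
   closure is then nowhere dense and null, because definable sets are locally constant on a
   dense open set, and D is the complement. Finally Z_t is null, so a measure as in (i), (ii)
   or a mixture never gives it full mass, and the loss is positive off Z_t. *)
Require Import Defs.
From HB Require Import structures.
From mathcomp Require Import all_boot all_order all_algebra.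
From mathcomp Require Import all_classical all_reals all_analysis.
From mathcomp Require Import measurable_realfun.
From mathcomp Require Import ring lra zify.
From mathcomp Require mpoly.
Import (canonicals, coercions) mpoly.
Import Order.TTheory GRing.Theory Num.Theory.
Import numFieldNormedType.Exports.
Local Open Scope classical_set_scope.
Local Open Scope ring_scope.
Set Implicit Arguments.
Unset Strict Implicit.


(** * Definable predicates *)

(* Points of R^n are represented by environments [nat -> R] of which only the first n
   coordinates matter; binders follow the de Bruijn convention, coordinate 0 being the
   innermost variable. *)
Section environments.
Context {R : realType}.
Notation env := (nat -> R) (only parsing).

(** Tameness enters in a single form: a definable subset of the line has finite boundary. Bounds
    uniform in families, constancy on boxes and nullness are derived from it, without cell
    decomposition, dimension or Fubini. Empty interior, closure and boundary are written with
    quantifiers over reals, so that applying them to a definable family gives a definable family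
    again. The factor 2 in N > 2 q arises as follows: a component of the complement of a finite set
    is sampled by the midpoint of its endpoints, and the two endpoints may come from two different
    sample points, so eliminating one parameter spends two points. The number q is a bound on the
    coordinates read by the agreement predicate, under a coding of the parameters by natural
    numbers. Nullness refers to an outer measure given by coverings, so explicit grids of small
    total volume are built. Analyticity enters along lines, in the form of polynomial approximation
    at a geometric rate, which is stable under composition by direct estimates. *)

Definition scons (t : R) (e : env) : env := fun i => if i is i'.+1 then e i' else t.
Definition shift (n : nat) (e : env) : env := fun i => e (n + i)%N.
Definition cat (n : nat) (x e : env) : env :=
  fun i => if (i < n)%N then x i else e (i - n)%N.
Definition depends_on (n : nat) (P : env -> Prop) : Prop :=
  forall e e', (forall i, (i < n)%N -> e i = e' i) -> P e -> P e'.
Lemma cat_lt n x e i : (i < n)%N -> cat n x e i = x i.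
Proof. by rewrite /cat => ->. Qed.

Lemma shift_cat n x e : shift n (cat n x e) = e.
Proof. by apply/funext => i; rewrite /shift /cat ltnNge leq_addr addKn. Qed.

Lemma scons_shift e : scons (e 0%N) (shift 1 e) = e.
Proof. by apply/funext => -[]. Qed.

Lemma cat_scons n t x e : cat n.+1 (scons t x) e = scons t (cat n x e).
Proof. by apply/funext => -[|i]. Qed.

Lemma cat0 x e : cat 0 x e = e.
Proof. by apply/funext => i; rewrite /cat subn0. Qed.

Definition env_of (n : nat) (x : 'rV[R]_n) : env :=
  fun i => if insub i is Some o then x ord0 o else 0.

Lemma depends_onE n P e e' : depends_on n P ->
  (forall i, (i < n)%N -> e i = e' i) -> P e <-> P e'.
Proof.
move=> h he; split; apply: h => // i /he //.
Qed.

Lemma depends_on_le n m P : (n <= m)%N -> depends_on n P -> depends_on m P.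
Proof. move=> nm h e e' he; apply: h => i lt_in; apply: he; exact: leq_trans nm. Qed.

Lemma env_ofE n (x : 'rV[R]_n) (i : 'I_n) : env_of x i = x ord0 i.
Proof. by rewrite /env_of valK. Qed.

Lemma env_of_row n (e : env) i : (i < n)%N -> env_of (\row_(j < n) e j) i = e i.
Proof. by move=> lt_in; rewrite (env_ofE _ (Ordinal lt_in)) mxE. Qed.

Lemma env_of_row_mxl m n (a : 'rV[R]_m) (b : 'rV[R]_n) i : (i < m)%N ->
  env_of (row_mx a b) i = env_of a i.
Proof.
move=> lt_im; have -> : i = lshift n (Ordinal lt_im) by [].
by rewrite env_ofE row_mxEl (env_ofE a (Ordinal lt_im)).
Qed.

Lemma env_of_row_mxr m n (a : 'rV[R]_m) (b : 'rV[R]_n) i : (i < n)%N ->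
  env_of (row_mx a b) (m + i)%N = env_of b i.
Proof.
move=> lt_in; have -> : (m + i)%N = rshift m (Ordinal lt_in) by [].
by rewrite env_ofE row_mxEr (env_ofE b (Ordinal lt_in)).
Qed.

Lemma env_of_lsubmx m n (x : 'rV[R]_(m + n)) i : (i < m)%N ->
  env_of (lsubmx x) i = env_of x i.
Proof. by move=> lt_im; rewrite -{2}(hsubmxK x) env_of_row_mxl. Qed.

End environments.
Notation env R := (nat -> R) (only parsing).

Section definability.
Context {R : realType} {S : forall n : nat, set (set 'rV[R]_n)}.
Hypothesis omS : o_minimal S.
Implicit Types P Q : env R -> Prop.

Definition dfn P : Prop := exists n, depends_on n P /\ S [set x : 'rV[R]_n | P (env_of x)].

Definition dft (f : env R -> R) : Prop := dfn (fun e => e 0%N = f (shift 1 e)).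

Lemma S_setT n : S [set: 'rV[R]_n].
Proof.
suff -> : [set: 'rV[R]_n] = [set x | poly_eval (0 : mpoly.mpoly n R) x = 0] by exact: om_poly_eq0.
by apply/seteqP; split => x //= _; rewrite /poly_eval mpoly.meval0.
Qed.

Lemma S_weaken n k P : depends_on n P -> S [set x : 'rV[R]_n | P (env_of x)] ->
  S [set x : 'rV[R]_(n + k) | P (env_of x)].
Proof.
move=> dP SP; have := om_prod omS SP (S_setT k).
congr (S _); apply/seteqP; split => x /=.
- move=> [a Pa] [b _ <-]; apply: dP Pa => i lt_in.
  by rewrite env_of_row_mxl.
- move=> Px; exists (lsubmx x).
    by apply: dP Px => i lt_in; rewrite env_of_lsubmx.
  by exists (rsubmx x) => //; rewrite hsubmxK.
Qed.

Lemma S_strengthen n k P : depends_on n P -> S [set x : 'rV[R]_(n + k) | P (env_of x)] ->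
  S [set x : 'rV[R]_n | P (env_of x)].
Proof.
move=> dP SP; have := om_proj omS SP.
congr (S _); apply/seteqP; split => x /=.
- by move=> [y Py <-]; apply: dP Py => i lt_in; rewrite env_of_lsubmx.
- move=> Px; exists (row_mx x 0); last by rewrite row_mxKl.
  by apply: dP Px => i lt_in; rewrite env_of_row_mxl.
Qed.

(** Adding free coordinates is a product with a full space and dropping them is a projection, so the
    ambient dimension chosen for a predicate is immaterial. *)
Lemma S_level n m P : depends_on n P -> depends_on m P ->
  S [set x : 'rV[R]_n | P (env_of x)] -> S [set x : 'rV[R]_m | P (env_of x)].
Proof.
move=> dn dm SP; have [le_nm|/ltnW le_mn] := leqP n m.
  by rewrite -(subnKC le_nm); exact: S_weaken.
by apply: (@S_strengthen m (n - m)) => //; rewrite subnKC.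
Qed.

Lemma dfn_level n P : dfn P -> depends_on n P -> S [set x : 'rV[R]_n | P (env_of x)].
Proof. by move=> [m [dm SP]] dn; exact: S_level SP. Qed.

Lemma dfn_common P Q : dfn P -> dfn Q -> exists n,
  [/\ depends_on n P, depends_on n Q,
      S [set x : 'rV[R]_n | P (env_of x)] & S [set x : 'rV[R]_n | Q (env_of x)]].
Proof.
move=> [n [dP SP]] [m [dQ SQ]]; exists (maxn n m).
have dP' := depends_on_le (leq_maxl n m) dP.
have dQ' := depends_on_le (leq_maxr n m) dQ.
by split => //; [exact: S_level SP | exact: S_level SQ].
Qed.

Lemma dfn_ext P Q : (forall e, P e <-> Q e) -> dfn P -> dfn Q.
Proof. by move=> PQ; suff -> : P = Q by []; apply/funext => e; exact/propext. Qed.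

Lemma dfn_and P Q : dfn P -> dfn Q -> dfn (fun e => P e /\ Q e).
Proof.
move=> dP dQ; have [n [dnP dnQ SP SQ]] := dfn_common dP dQ; exists n; split.
  by move=> e e' he [Pe Qe]; split; [exact: dnP Pe | exact: dnQ Qe].
exact: om_setI.
Qed.

Lemma dfn_or P Q : dfn P -> dfn Q -> dfn (fun e => P e \/ Q e).
Proof.
move=> dP dQ; have [n [dnP dnQ SP SQ]] := dfn_common dP dQ; exists n; split.
  by move=> e e' he [Pe|Qe]; [left; exact: dnP Pe | right; exact: dnQ Qe].
exact: om_setU.
Qed.

Lemma dfn_not P : dfn P -> dfn (fun e => ~ P e).
Proof.
move=> [n [dP SP]]; exists n; split.
  by move=> e e' he nPe Pe'; apply: nPe; apply: dP Pe' => i /he.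
exact: om_setC.
Qed.

Lemma dfn_imp P Q : dfn P -> dfn Q -> dfn (fun e => P e -> Q e).
Proof.
move=> dP dQ; apply: (@dfn_ext (fun e => ~ P e \/ Q e)).
  by move=> e; split => [[nP /nP //|//]|PQ]; have [/PQ|] := pselect (P e); [right|left].
exact: dfn_or (dfn_not dP) dQ.
Qed.

Lemma dfn_iff P Q : dfn P -> dfn Q -> dfn (fun e => P e <-> Q e).
Proof. by move=> dP dQ; apply: dfn_and; exact: dfn_imp. Qed.

Lemma dfn_const (A : Prop) : dfn (fun=> A).
Proof.
exists 0%N; split => [e e' _ //|].
have [a|na] := pselect A.
  have -> : [set _ : 'rV[R]_0 | A] = setT by apply/seteqP; split.
  exact: S_setT.
have -> : [set _ : 'rV[R]_0 | A] = ~` setT by apply/seteqP; split => x //=; apply.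
exact/(om_setC omS)/S_setT.
Qed.

Lemma dfn_lt2 : dfn (fun e => e 0%N < e 1%N).
Proof.
exists 2%N; split => [e e' he|]; first by rewrite !he.
pose p := mpoly.mpolyX R (mpoly.mnm1 (1 : 'I_2)) - mpoly.mpolyX R (mpoly.mnm1 (0 : 'I_2)).
have := om_poly_pos omS p; congr (S _); apply/seteqP; split => x /=;
by rewrite /poly_eval mpoly.mevalB !mpoly.mevalXU subr_gt0 -!env_ofE.
Qed.

Lemma dfn_add3 : dfn (fun e => e 0%N = e 1%N + e 2%N).
Proof.
exists 3%N; split => [e e' he|]; first by rewrite !he.
pose X i := mpoly.mpolyX R (mpoly.mnm1 (i : 'I_3)).
have := om_poly_eq0 omS (X 0 - (X 1 + X (inord 2))); congr (S _); apply/seteqP.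
have pE x : poly_eval (X 0 - (X 1 + X (inord 2))) x = env_of x 0%N - (env_of x 1%N + env_of x 2%N).
  rewrite /poly_eval mpoly.mevalB mpoly.mevalD !mpoly.mevalXU -!env_ofE.
  by rewrite inordK.
split => x /=; rewrite pE; first by move=> /eqP; rewrite subr_eq0 => /eqP.
by move=> ->; rewrite subrr.
Qed.

Lemma dfn_mul3 : dfn (fun e => e 0%N = e 1%N * e 2%N).
Proof.
exists 3%N; split => [e e' he|]; first by rewrite !he.
pose X i := mpoly.mpolyX R (mpoly.mnm1 (i : 'I_3)).
have := om_poly_eq0 omS (X 0 - (X 1 * X (inord 2))); congr (S _); apply/seteqP.
have pE x : poly_eval (X 0 - (X 1 * X (inord 2))) x = env_of x 0%N - (env_of x 1%N * env_of x 2%N).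
  rewrite /poly_eval mpoly.mevalB mpoly.mevalM !mpoly.mevalXU -!env_ofE.
  by rewrite inordK.
split => x /=; rewrite pE; first by move=> /eqP; rewrite subr_eq0 => /eqP.
by move=> ->; rewrite subrr.
Qed.

Lemma dfn_eqc c : dfn (fun e => e 0%N = c).
Proof.
exists 1%N; split => [e e' he|]; first by rewrite !he.
pose X i := mpoly.mpolyX R (mpoly.mnm1 (i : 'I_1)).
have := om_poly_eq0 omS (X 0 - mpoly.mpolyC 1 c); congr (S _); apply/seteqP.
have pE x : poly_eval (X 0 - mpoly.mpolyC 1 c) x = env_of x 0%N - c.
  by rewrite /poly_eval mpoly.mevalB mpoly.mevalC !mpoly.mevalXU -!env_ofE.
split => x /=; rewrite pE; first by move=> /eqP; rewrite subr_eq0 => /eqP.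
by move=> ->; rewrite subrr.
Qed.

Lemma S_eq n (i j : 'I_n) : S [set x : 'rV[R]_n | x ord0 i = x ord0 j].
Proof.
pose X i := mpoly.mpolyX R (mpoly.mnm1 (i : 'I_n)).
have := om_poly_eq0 omS (X i - X j); congr (S _); apply/seteqP.
have pE x : poly_eval (X i - X j) x = x ord0 i - x ord0 j.
  by rewrite /poly_eval mpoly.mevalB !mpoly.mevalXU.
split => x /=; rewrite pE; first by move=> /eqP; rewrite subr_eq0 => /eqP.
by move=> ->; rewrite subrr.
Qed.

Lemma S_alln n k (A : nat -> set 'rV[R]_n) : (forall i, (i < k)%N -> S (A i)) ->
  S [set x : 'rV[R]_n | forall i, (i < k)%N -> A i x].
Proof.
elim: k => [|k IH] SA.
  have -> : [set x : 'rV[R]_n | forall i, (i < 0)%N -> A i x] = setT by apply/seteqP; split.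
  exact: S_setT.
have -> : [set x : 'rV[R]_n | forall i, (i < k.+1)%N -> A i x] =
    [set x | forall i, (i < k)%N -> A i x] `&` A k.
  apply/seteqP; split => x /=.
    by move=> h; split; [move=> i lt_ik; apply: h; exact: ltnW | exact: h].
  by move=> [h Ak] i; rewrite ltnS leq_eqVlt => /orP[/eqP -> //|]; exact: h.
apply: om_setI => //; last exact: SA.
by apply: IH => i lt_ik; apply: SA; exact: ltnW.
Qed.

(* The rename is the projection of the set of pairs (x, y) with y in P and y = x \o s. *)
Lemma dfn_rename (s : nat -> nat) P : dfn P -> dfn (fun e => P (e \o s)).
Proof.
move=> [n [dP SP]]; pose m := (\max_(i < n) s i).+1.
have lt_sm i : (i < n)%N -> (s i < m)%N.
  by move=> lt_in; rewrite ltnS; exact: (leq_bigmax (Ordinal lt_in)).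
exists m; split.
  by move=> e e' he; apply: dP => i /lt_sm /he.
pose A := [set y : 'rV[R]_(m + n) | forall i, (i < n)%N ->
  env_of y (m + i)%N = env_of y (s i)].
have SA : S A.
  apply: S_alln => i lt_in.
  have lt1 : (m + i < m + n)%N by rewrite ltn_add2l.
  have lt2 : (s i < m + n)%N by apply: (leq_trans (lt_sm _ lt_in)); exact: leq_addr.
  have := S_eq (Ordinal lt1) (Ordinal lt2); congr (S _).
  by apply/seteqP; split => x /=; rewrite -!env_ofE.
have := om_proj omS (om_setI omS SA (om_prod omS (S_setT m) SP)).
congr (S _); apply/seteqP; split => x /=.
- move=> [y [Ay [a _ [b Pb yE]]] <-]; apply: dP Pb => i lt_in /=.
  by rewrite env_of_lsubmx ?lt_sm// -Ay// -yE env_of_row_mxr.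
- move=> Px; exists (row_mx x (\row_(i < n) env_of x (s i))); last by rewrite row_mxKl.
  split.
    move=> i lt_in; rewrite env_of_row_mxr// env_of_row_mxl ?lt_sm//.
    by rewrite (env_of_row (env_of x \o s)).
  exists x => //; exists (\row_(i < n) env_of x (s i)) => //=.
  by apply: dP Px => i lt_in; rewrite (env_of_row (env_of x \o s)).
Qed.

Lemma dfn_ex (P : R -> env R -> Prop) :
  dfn (fun e => P (e 0%N) (shift 1 e)) -> dfn (fun e => exists t, P t e).
Proof.
move=> [n0 [dP0 SP0]]; pose Q e := P (e 0%N) (shift 1 e).
pose n := n0; have dP : depends_on n.+1 Q by exact: depends_on_le dP0.
have PE t e : P t e <-> Q (scons t e) by [].
have dQ : depends_on n (fun e => exists t, P t e).
  move=> e e' he [t /PE Qt]; exists t; apply/PE; apply: dP Qt => -[|i] //=.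
  by rewrite ltnS => /he.
exists n; split => //.
(* [om_proj] forgets the last coordinates, while the bound variable is coordinate 0: it is moved to
   place n. *)
pose r i := if i is i'.+1 then i' else n.
have dr : dfn (fun e => Q (e \o r)) by apply: dfn_rename; exists n0.
have dm : depends_on (n + 1) (fun e => Q (e \o r)).
  move=> e e' he; apply: dP => -[_|i] /=; first by apply: he; rewrite addn1.
  by rewrite ltnS => lt_in; apply: he; rewrite addn1; exact: ltnW.
have := om_proj omS (dfn_level dr dm).
congr (S _); apply/seteqP; split => x /=.
- move=> [y Qy <-]; exists (env_of y n); apply/PE; apply: dP Qy => -[//|i] /=.
    by rewrite ltnS => lt_in; rewrite env_of_lsubmx.
- move=> [t /PE Qt]; exists (row_mx x (const_mx t)); last by rewrite row_mxKl.
  apply: dP Qt => -[_|i] /=.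
    rewrite -[X in env_of _ X]addn0 env_of_row_mxr//.
    by rewrite (env_ofE _ (0 : 'I_1)) mxE.
  by rewrite ltnS => lt_in; rewrite env_of_row_mxl.
Qed.

Lemma dfn_all (P : R -> env R -> Prop) :
  dfn (fun e => P (e 0%N) (shift 1 e)) -> dfn (fun e => forall t, P t e).
Proof.
move=> dP; apply: (@dfn_ext (fun e => ~ exists t, ~ P t e)).
  by move=> e; split => [nex t|al [t]]; [apply: contrapT => nP; apply: nex; exists t | apply].
by apply: dfn_not; apply: (@dfn_ex (fun t e => ~ P t e)); exact: dfn_not.
Qed.

Lemma dfn_alln k (P : nat -> env R -> Prop) : (forall i, (i < k)%N -> dfn (P i)) ->
  dfn (fun e => forall i, (i < k)%N -> P i e).
Proof.
elim: k => [|k IH] dP; first by apply: (dfn_ext _ (dfn_const True)) => e; split.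
apply: (@dfn_ext (fun e => (forall i, (i < k)%N -> P i e) /\ P k e)).
  move=> e; split => [[h Pk] i|h].
    by rewrite ltnS leq_eqVlt => /orP[/eqP -> //|]; exact: h.
  by split; [move=> i lt_ik; apply: h; exact: ltnW | exact: h].
by apply: dfn_and; [apply: IH => i lt_ik; apply: dP; exact: ltnW | exact: dP].
Qed.

Lemma dfn_exn k (P : nat -> env R -> Prop) : (forall i, (i < k)%N -> dfn (P i)) ->
  dfn (fun e => exists2 i, (i < k)%N & P i e).
Proof.
move=> dP; apply: (@dfn_ext (fun e => ~ forall i, (i < k)%N -> ~ P i e)).
  move=> e; split => [h|[i lt_ik Pi] h]; last exact: h Pi.
  by apply: contrapT => nex; apply: h => i lt_ik Pi; apply: nex; exists i.
by apply/dfn_not/dfn_alln => i lt_ik; apply/dfn_not/dP.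
Qed.

Lemma dfn_ex_cat n P : dfn P -> dfn (fun e => exists x, P (cat n x e)).
Proof.
elim: n P => [|n IH] P dP.
  by apply: dfn_ext dP => e; split => [Pe|[x]]; [exists e|]; rewrite cat0.
apply: (@dfn_ext (fun e => exists x, (exists t, P (scons t (cat n x e))))).
  move=> e; split => [[x [t Pt]]|[x Px]]; first by exists (scons t x); rewrite cat_scons.
  by exists (shift 1 x), (x 0%N); rewrite -cat_scons scons_shift.
apply: (IH (fun e => exists t, P (scons t e))).
apply: (@dfn_ex (fun t e => P (scons t e))).
by apply: dfn_ext dP => e; rewrite scons_shift.
Qed.

(** P reads only n coordinates, so substituting f amounts to quantifying existentially over n values
    tied to f by its definable graphs. *)
Lemma dfn_subst (f : env R -> env R) P : dfn P -> (forall i, dft (fun e => f e i)) ->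
  dfn (fun e => P (f e)).
Proof.
move=> dP df; have [n [dnP _]] := dP.
pose Q e := (forall i, (i < n)%N -> e i = f (shift n e) i) /\ P e.
apply: (@dfn_ext (fun e => exists x, Q (cat n x e))).
  move=> e; split => [[x [/= xf Px]]|Pf].
    by apply: dnP Px => i lt_in; rewrite xf// shift_cat.
  exists (f e); split => [i lt_in|]; first by rewrite shift_cat cat_lt.
  by apply: dnP Pf => i lt_in; rewrite cat_lt.
apply: dfn_ex_cat; apply: dfn_and => //; apply: dfn_alln => i _.
by have := dfn_rename (fun j => if j is j'.+1 then (n + j')%N else i) (df i).
Qed.

(** * Definable terms *)

Lemma dfn_lt_proj i j : dfn (fun e => e i < e j).
Proof. by have := dfn_rename (fun l => if l is 0%N then i else j) dfn_lt2. Qed.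

Lemma dft_proj i : dft (fun e => e i).
Proof.
apply: (@dfn_ext (fun e => ~ e 0%N < e (1 + i)%N /\ ~ e (1 + i)%N < e 0%N)).
  move=> e; rewrite /shift; split => [[/negP h1 /negP h2]|->]; last by rewrite ltxx.
  by apply/eqP; rewrite eq_le !leNgt h1 h2.
by apply: dfn_and; apply: dfn_not; exact: dfn_lt_proj.
Qed.

Lemma dft_const c : dft (fun=> c).
Proof. exact: dfn_eqc. Qed.

Lemma dft_rename s f : dft f -> dft (fun e => f (e \o s)).
Proof.
by move=> df; have := dfn_rename (fun j => if j is j'.+1 then (s j').+1 else 0%N) df.
Qed.

Lemma dft_shift n f : dft f -> dft (fun e => f (shift n e)).
Proof. by move=> df; have := dft_rename (fun j => (n + j)%N) df. Qed.

Lemma dft_scons t f i : dft t -> (forall i, dft (fun e => f e i)) ->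
  dft (fun e => scons (t e) (f e) i).
Proof. by move=> dt df; case: i => [|i] /=. Qed.

Lemma dft_cat n f g i : (forall i, dft (fun e => f e i)) -> (forall i, dft (fun e => g e i)) ->
  dft (fun e => cat n (f e) (g e) i).
Proof. by move=> df dg; rewrite /cat; case: (i < n)%N. Qed.

Lemma dft_comp f F : dft F -> (forall i, dft (fun e => f e i)) -> dft (fun e => F (f e)).
Proof.
move=> dF df; apply: (@dfn_subst (fun e => scons (e 0%N) (f (shift 1 e))) _ dF).
by move=> i; apply: dft_scons => [|{}i]; [exact: dft_proj | exact: (@dft_shift 1 (fun e => f e i))].
Qed.

Lemma dft_comp1 (F : R -> R) f : dft (fun e => F (e 0%N)) -> dft f -> dft (fun e => F (f e)).
Proof. by move=> dF df; exact: (@dft_comp (fun e _ => f e) _ dF). Qed.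

Lemma dft_comp2 (F : R -> R -> R) f g : dft (fun e => F (e 0%N) (e 1%N)) ->
  dft f -> dft g -> dft (fun e => F (f e) (g e)).
Proof.
move=> dF df dg; apply: (@dft_comp (fun e i => if i is 0%N then f e else g e) _ dF).
by case.
Qed.

Lemma dft_add f g : dft f -> dft g -> dft (fun e => f e + g e).
Proof. by apply: (@dft_comp2 +%R); exact: dfn_add3. Qed.

Lemma dft_mul f g : dft f -> dft g -> dft (fun e => f e * g e).
Proof. by apply: (@dft_comp2 *%R); exact: dfn_mul3. Qed.

Lemma dft_opp f : dft f -> dft (fun e => - f e).
Proof.
move=> df; suff -> : (fun e => - f e) = (fun e => -1 * f e).
  by apply: dft_mul => //; exact: dft_const.
by apply/funext => e; rewrite mulN1r.
Qed.

Lemma dft_sum (I : Type) (s : seq I) (f : I -> env R -> R) :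
  (forall i, dft (f i)) -> dft (fun e => \sum_(i <- s) f i e).
Proof.
move=> df; elim: s => [|i s IH].
  by under eq_fun do rewrite big_nil; exact: dft_const.
by under eq_fun do rewrite big_cons; exact: dft_add.
Qed.

Lemma dft_prod (I : Type) (s : seq I) (f : I -> env R -> R) :
  (forall i, dft (f i)) -> dft (fun e => \prod_(i <- s) f i e).
Proof.
move=> df; elim: s => [|i s IH].
  by under eq_fun do rewrite big_nil; exact: dft_const.
by under eq_fun do rewrite big_cons; exact: dft_mul.
Qed.

Lemma dft_exp f n : dft f -> dft (fun e => f e ^+ n).
Proof.
move=> df; elim: n => [|n IH]; first exact: dft_const.
by under eq_fun do rewrite exprS; exact: dft_mul.
Qed.

Lemma dfn_lt f g : dft f -> dft g -> dfn (fun e => f e < g e).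
Proof.
move=> df dg; apply: (@dfn_subst (fun e i => if i is 0%N then f e else g e) _ dfn_lt2).
by case.
Qed.

Lemma dfn_le f g : dft f -> dft g -> dfn (fun e => f e <= g e).
Proof.
move=> df dg; apply: (@dfn_ext (fun e => ~ g e < f e)).
  by move=> e; rewrite leNgt; split => /negP.
by apply: dfn_not; exact: dfn_lt.
Qed.

Lemma dfn_eq f g : dft f -> dft g -> dfn (fun e => f e = g e).
Proof.
move=> df dg; apply: (@dfn_subst (fun e => scons (f e) (fun=> g e)) _ (dft_proj 0)).
by case.
Qed.

Lemma dft_norm f : dft f -> dft (fun e => `|f e|).
Proof.
apply: (@dft_comp1 (fun x => `|x|)).
apply: (@dfn_ext (fun e => 0 <= e 1%N /\ e 0%N = e 1%N \/ e 1%N < 0 /\ e 0%N = - e 1%N)).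
  move=> e; rewrite /shift addn0; split => [[[h ->]|[h ->]]|->].
  - by rewrite ger0_norm.
  - by rewrite ltr0_norm.
  by have [h|h] := leP 0 (e 1%N); [left; rewrite ger0_norm | right; rewrite ltr0_norm].
have [p0 p1] := (dft_proj 0, dft_proj 1); have c0 := dft_const 0.
by apply: dfn_or; apply: dfn_and;
  [exact: dfn_le|exact: dfn_eq|exact: dfn_lt|apply: dfn_eq => //; exact: dft_opp].
Qed.

Lemma dft_of_fun (g : R -> R) f :
  S [set x : 'rV[R]_2 | x ord0 ord_max = g (x ord0 ord0)] -> dft f -> dft (fun e => g (f e)).
Proof.
move=> Sg; apply: dft_comp1.
have dg : dfn (fun e => e 1%N = g (e 0%N)).
  exists 2%N; split => [e e' he|]; first by rewrite !he.
  move: Sg; congr (S _).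
  by apply/seteqP; split => x /=; rewrite -!env_ofE.
by have := dfn_rename (fun i => if i is 0%N then 1%N else 0%N) dg.
Qed.

End definability.

(** Reads definability off the syntax of a first-order formula. Quantifiers over naturals are
    expected to be bounded, and predicate variables known to be definable are handled by
    [dfn_subst]. *)
Ltac dfn_tac :=
  match goal with omS : o_minimal _ |- _ =>
  repeat (cbv beta; first
  [ assumption
  | match goal with
    | |- forall _, _ => intro
    | |- dfn (fun e => _ /\ _) => refine (dfn_and omS _ _)
    | |- dfn (fun e => _ \/ _) => refine (dfn_or omS _ _)
    | |- dfn (fun e => _ <-> _) => refine (dfn_iff omS _ _)
    | |- dfn (fun e => ~ _) => refine (dfn_not omS _)
    | |- dfn (fun e => exists2 i : nat, @?A e i & @?B e i) => refine (dfn_exn omS _)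
    | |- dfn (fun e => forall i : nat, @?A e i) => refine (dfn_alln omS _)
    | |- dfn (fun e => exists t : Real.sort _, @?P e t) =>
        refine (@dfn_ex _ _ omS (fun t e => P e t) _)
    | |- dfn (fun e => forall t : Real.sort _, @?P e t) =>
        refine (@dfn_all _ _ omS (fun t e => P e t) _)
    | |- dfn (fun e => _ -> _) => refine (dfn_imp omS _ _)
    | H : dfn ?P |- dfn (fun e => ?P (@?f e)) => refine (@dfn_subst _ _ omS f P H _)
    | |- dfn (fun e => is_true (_ < _)) => refine (dfn_lt omS _ _)
    | |- dfn (fun e => is_true (_ <= _)) => refine (dfn_le omS _ _)
    | |- dfn (fun e => _ = _) => refine (dfn_eq omS _ _)
    | |- dft (fun e => scons _ _ _) => refine (@dft_scons _ _ _ _ _ _ _)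
    | |- dft (fun e => cat _ _ _ _) => refine (@dft_cat _ _ _ _ _ _ _ _)
    | |- dft (fun e => _ + _) => refine (dft_add omS _ _)
    | |- dft (fun e => - _) => refine (dft_opp omS _)
    | |- dft (fun e => _ * _) => refine (dft_mul omS _ _)
    | |- dft (fun e => `|_|) => refine (dft_norm omS _)
    | |- dft _ => exact (dft_const omS _)
    | |- dft (fun e => _ _ _) => refine (dft_proj omS _)
    | |- dft (fun e => _ _) => refine (dft_proj omS _)
    end ])
  end.

(** * Finite sets and boundaries on the line *)

Section line.
Context {R : realType}.
Implicit Types (X Y F : set R).

(** The supremum of the points up to which Q holds satisfies Q by the hypothesis on the left, and
    cannot lie below b by the one on the right. This plays the role of connectedness and compactness
    of the interval. *)
Lemma real_induction (a b : R) (Q : R -> Prop) : a <= b -> Q a ->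
  (forall t, a <= t < b -> (forall u, a <= u <= t -> Q u) ->
     exists2 r, 0 < r & forall u, t < u < t + r -> Q u) ->
  (forall t, a < t <= b -> (forall u, a <= u < t -> Q u) -> Q t) ->
  forall u, a <= u <= b -> Q u.
Proof.
move=> le_ab Qa Qr Ql; pose A := [set x | a <= x <= b /\ forall u, a <= u <= x -> Q u].
have Aa : A a.
  split; first by rewrite lexx.
  by move=> u ua; rewrite (_ : u = a)//; apply/eqP; rewrite eq_le andbC.
have ubA : ubound A b by move=> x [/andP[]].
have hsA : has_sup A by split; [exists a | exists b].
have as_ : a <= sup A by exact: sup_upper_bound.
have sb : sup A <= b by apply: ge_sup => //; exists a.
have Qlt u : a <= u < sup A -> Q u.
  move=> /andP[au us]; have e0 : 0 < sup A - u by rewrite subr_gt0.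
  have [x [xab Qx]] := sup_adherent e0 hsA; rewrite opprB addrC subrK => ux.
  by apply: Qx; rewrite au ltW.
have Qs : Q (sup A).
  move: as_; rewrite le_eqVlt => /orP[/eqP <- //|as_].
  by apply: Ql => //; rewrite as_.
have Qle u : a <= u <= sup A -> Q u.
  by move=> /andP[au]; rewrite le_eqVlt => /orP[/eqP -> //|us]; apply: Qlt; rewrite au.
move: sb; rewrite le_eqVlt => /orP[/eqP sb|sb]; first by move=> u; rewrite -sb; exact: Qle.
exfalso; have [|r r0 Qu] := Qr (sup A) _ Qle; first by rewrite as_.
pose x := Num.min b (sup A + r / 2).
have sx : sup A < x by rewrite lt_min sb ltrDl divr_gt0.
suff Ax : A x by have := sup_upper_bound hsA Ax; rewrite leNgt sx.
split; first by rewrite ge_min lexx (le_trans as_ (ltW sx)).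
move=> u /andP[au ux]; have [us|us] := leP u (sup A); first by apply: Qle; rewrite au.
apply: Qu; rewrite us/= (le_lt_trans ux)// gt_min; apply/orP; right.
by rewrite ltrD2l ltr_pdivrMr// ltr_pMr// ltr1n.
Qed.

(** The topological boundary, in a first-order form, so that the boundaries of the fibers of a
    definable family form a definable family. *)
Definition bd X : set R :=
  [set t | forall r, 0 < r -> ~ forall u, `|u - t| < r -> X u <-> X t].

Lemma not_bd X t : ~ bd X t -> exists2 r, 0 < r & forall u, `|u - t| < r -> X u <-> X t.
Proof.
move=> nb; apply: contrapT => nex; apply: nb => r r0 h; apply: nex; exists r => //.
Qed.

Lemma locally_constant_eq X a b : a <= b ->
  (forall t, a <= t <= b -> exists2 r, 0 < r & forall u, `|u - t| < r -> X u <-> X t) ->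
  X a <-> X b.
Proof.
move=> ab lc; suff h u : a <= u <= b -> (X a <-> X u) by apply: h; rewrite ab lexx.
move: u; apply: real_induction => //.
- move=> t /andP[at_ tb] Qt; have [|r r0 h] := lc t; first by rewrite at_ ltW.
  exists r => // u /andP[tu ut]; have ut' : `|u - t| < r.
    by rewrite ger0_norm ?subr_ge0 1?ltW// ltrBlDl.
  by have := h u ut'; have := Qt t; rewrite at_ lexx => /(_ isT); tauto.
- move=> t /andP[at_ tb] Qt; have [|r r0 h] := lc t; first by rewrite (ltW at_).
  pose u := Num.max a (t - r / 2).
  have ut : u < t by rewrite gt_max at_ ltrBlDr ltrDl divr_gt0.
  rewrite (Qt u); last by rewrite ut le_max lexx.
  apply: h; rewrite ltr0_norm ?subr_lt0// opprB ltrBlDl -ltrBlDr lt_max; apply/orP; right.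
  by rewrite ltrD2l ltrN2 ltr_pdivrMr// ltr_pMr// ltr1n.
Qed.

Lemma bd_free_eq X a b :
  (forall u, Num.min a b <= u <= Num.max a b -> ~ bd X u) -> X a <-> X b.
Proof.
have key c e : c <= e -> (forall u, c <= u <= e -> ~ bd X u) -> X c <-> X e.
  by move=> ce h; apply: locally_constant_eq => // t /h /not_bd.
have [ab|ba] := leP a b; first exact: key.
by move=> h; have [] := key b a (ltW ba) h.
Qed.

Lemma bd_op (op : Prop -> Prop -> Prop) X Y :
  bd [set t | op (X t) (Y t)] `<=` bd X `|` bd Y.
Proof.
move=> t bt; apply: contrapT => /not_orP[/not_bd[r r0 hX] /not_bd[s s0 hY]].
apply: (bt (Num.min r s)); first by rewrite lt_min r0.
move=> u; rewrite lt_min /= => /andP[/hX/propext -> /hY/propext ->] //.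
Qed.

(** An interval is the intersection of the two half-lines given by its bounds, and a half-line has
    no boundary point besides its endpoint. *)
Lemma bd_bound_finite (l r : itv_bound R) :
  finite_set (bd [set u | (l <= BLeft u)%O]) /\ finite_set (bd [set u | (BRight u <= r)%O]).
Proof.
have cst (b : bool) : finite_set (bd [set u : R | b]).
  by apply: (@sub_finite_set _ _ set0) => // t /(_ 1 ltr01); apply.
split.
- case: l => [b x|b]; last first.
    rewrite (_ : [set u : R | _] = [set u : R | b]); first exact: cst.
    by apply/seteqP; split => u /=; case: b.
  apply: (@sub_finite_set _ _ [set x]); last exact: finite_set1.
  move=> t bt; apply: contrapT => /= /eqP tx.
  apply: (bt `|t - x|); first by rewrite normr_gt0 subr_eq0.
  move=> u /= utx.
  by case: b {bt}; rewrite !bnd_simp /=; move: tx utx; rewrite neq_lt => /orP[] tx;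
    [rewrite [`|t - x|]ltr0_norm ?subr_lt0// | rewrite [`|t - x|]gtr0_norm ?subr_gt0//
    |rewrite [`|t - x|]ltr0_norm ?subr_lt0// | rewrite [`|t - x|]gtr0_norm ?subr_gt0//];
    rewrite ltr_norml => /andP[h1 h2]; split => h; lra.
- case: r => [b x|b]; last first.
    rewrite (_ : [set u : R | _] = [set u : R | ~~ b]); first exact: cst.
    by apply/seteqP; split => u /=; case: b.
  apply: (@sub_finite_set _ _ [set x]); last exact: finite_set1.
  move=> t bt; apply: contrapT => /= /eqP tx.
  apply: (bt `|t - x|); first by rewrite normr_gt0 subr_eq0.
  move=> u /= utx.
  by case: b {bt}; rewrite !bnd_simp /=; move: tx utx; rewrite neq_lt => /orP[] tx;
    [rewrite [`|t - x|]ltr0_norm ?subr_lt0// | rewrite [`|t - x|]gtr0_norm ?subr_gt0//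
    |rewrite [`|t - x|]ltr0_norm ?subr_lt0// | rewrite [`|t - x|]gtr0_norm ?subr_gt0//];
    rewrite ltr_norml => /andP[h1 h2]; split => h; lra.
Qed.

Lemma bd_itvs_finite (s : seq (interval R)) :
  finite_set (bd (\big[setU/set0]_(I <- s) [set` I])).
Proof.
elim: s => [|[l r] s IH].
  rewrite big_nil; apply: (@sub_finite_set _ _ set0) => // t /(_ 1 ltr01); apply.
  by move=> u _.
rewrite big_cons; apply: (sub_finite_set (@bd_op or [set` Interval l r] _)).
rewrite finite_setU; split => //.
rewrite (_ : [set` _] = [set u | (l <= BLeft u)%O /\ (BRight u <= r)%O]); last first.
  by apply/seteqP; split => u /=; rewrite itv_boundlr => /andP.
apply: (sub_finite_set (@bd_op and [set u | (l <= BLeft u)%O] [set u | (BRight u <= r)%O])).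
by rewrite finite_setU; exact: bd_bound_finite.
Qed.

(** If X contains no interval, each of its points is a boundary point. *)
Lemma bd_finite_no_itv X : finite_set (bd X) ->
  (forall a b, a < b -> exists2 t, a < t < b & ~ X t) -> finite_set X.
Proof.
move=> fb nX; apply: sub_finite_set fb => t Xt r r0 h.
have [|u /andP[tu ut] nXu] := nX t (t + r); first by rewrite ltrDl.
by apply: nXu; apply/h => //; rewrite gtr0_norm ?subr_gt0// ltrBlDl.
Qed.

Lemma itv_uncountable (a b : R) : a < b -> ~ countable `]a, b[%classic.
Proof.
move=> ab /countable_lebesgue_measure0; rewrite lebesgue_measure_itv /= lte_fin ab.
by move=> /eqP; rewrite -EFinB eqe subr_eq0 => /eqP ba; move: ab; rewrite ba ltxx.
Qed.

Lemma finite_no_itv X (a b : R) : finite_set X -> a < b -> exists2 t, a < t < b & ~ X t.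
Proof.
move=> fX ab; apply: contrapT => nex.
have := itv_uncountable ab; apply; apply: finite_set_countable.
apply: sub_finite_set fX => t /=; rewrite in_itv /= => tab.
by apply: contrapT => nXt; apply: nex; exists t.
Qed.

Lemma seq_has_max (s : seq R) : s != [::] -> exists2 m, m \in s & forall x, x \in s -> x <= m.
Proof.
elim: s => // a [_ _|b s /(_ isT)[m ms mP] _].
  by exists a; [rewrite inE | move=> x; rewrite inE => /eqP ->].
exists (Num.max a m).
  by case: (leP a m) => _; [rewrite inE ms orbT | rewrite inE eqxx].
move=> x; rewrite inE => /orP[/eqP ->|/mP xm]; first by rewrite le_max lexx.
by rewrite le_max xm orbT.
Qed.

Lemma finite_has_max F (Q : R -> bool) : finite_set F ->
  (forall x, F x -> ~~ Q x) \/ exists m, [/\ F m, Q m & forall x, F x -> Q x -> x <= m].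
Proof.
move=> /finite_seqP[s ->]; pose s' := [seq x <- s | Q x].
have [s0|/seq_has_max[m]] := eqVneq s' [::].
  left => x /= xs; apply/negP => Qx.
  have : x \in s' by rewrite mem_filter Qx.
  by rewrite s0.
rewrite mem_filter => /andP[Qm ms] mP; right; exists m; split => // x xs Qx.
by apply: mP; rewrite mem_filter Qx.
Qed.

(* Every component of the complement of a finite set F contains a point of [sample F F],
   which is again finite and is defined uniformly from F: see [sample_exists]. *)
Definition sample X Y : set R :=
  [set e | e = 0 \/ exists a, exists b,
     X a /\ Y b /\ (e = (a + b) / 2 \/ e = a + 1 \/ e = a - 1)].

Lemma finite_sample X Y : finite_set X -> finite_set Y -> finite_set (sample X Y).
Proof.
move=> fX fY.
have f2 : finite_set [set (p.1 + p.2) / 2 | p in X `*` Y] by exact/finite_image/finite_setX.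
have f1 c : finite_set [set a + c | a in X] by exact/finite_image.
apply: (@sub_finite_set _ _ ([set 0] `|` ([set (p.1 + p.2) / 2 | p in X `*` Y] `|`
  ([set a + 1 | a in X] `|` [set a + -1 | a in X])))); last first.
  by rewrite !finite_setU.
move=> e [->|[a [b [Xa [Yb [->|[->|->]]]]]]]; first by left.
- by right; left; exists (a, b).
- by right; right; left; exists a.
- by right; right; right; exists a.
Qed.

Lemma sample_exists F t : finite_set F ->
  exists2 e, sample F F e & e = t \/ forall u, Num.min e t <= u <= Num.max e t -> ~ F u.
Proof.
move=> fF; have [Ft|nFt] := pselect (F t).
  by exists t; [right; exists t, t; do 2 split => //; left; field | left].
have [nb|[a [Fa at_ amax]]] := finite_has_max (fun x => x < t) fF.
  (* The least element of F above t is found as a maximum of -F below -t. *)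
  have fN : finite_set [set - x | x in F] by exact: finite_image.
  have [na|[b' [[b Fb <-] tb bmin]]] := finite_has_max (fun x => x < - t) fN.
    exists 0; first by left.
    right => u _ Fu; have := nb u Fu; rewrite -leNgt le_eqVlt => /orP[/eqP tu|tu].
      by apply: nFt; rewrite tu.
    by have /negP := na (- u) (ex_intro2 _ _ u Fu erefl); rewrite ltrN2.
  exists (b - 1).
    by right; exists b, b; do 2 split => //; right; right.
  right => u /andP[_]; rewrite ltrN2 in tb; rewrite le_max => hu Fu.
  have ub : u < b by case/orP: hu => h; lra.
  have := nb u Fu; rewrite -leNgt le_eqVlt => /orP[/eqP tu|tu]; first by apply: nFt; rewrite tu.
  have := bmin (- u) (ex_intro2 _ _ u Fu erefl); rewrite !ltrN2 => /(_ tu); lra.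
have fN : finite_set [set - x | x in F] by exact: finite_image.
have [na|[b' [[b Fb <-] tb bmin]]] := finite_has_max (fun x => x < - t) fN.
  exists (a + 1).
    by right; exists a, a; do 2 split => //; right; left.
  right => u /andP[]; rewrite ge_min => hu _ Fu.
  have ua : a < u by case/orP: hu => h; lra.
  have [ut|tu|ut] := ltgtP u t; first by have := amax u Fu ut; lra.
    by have /negP := na (- u) (ex_intro2 _ _ u Fu erefl); rewrite ltrN2.
  by apply: nFt; rewrite -ut.
exists ((a + b) / 2).
  by right; exists a, b; do 2 split => //; left.
rewrite ltrN2 in tb; right => u; rewrite ge_min le_max => /andP[h1 h2] Fu.
have au : a < u by case/orP: h1 => h; lra.
have ub : u < b by case/orP: h2 => h; lra.
have [ut|tu|ut] := ltgtP u t; first by have := amax u Fu ut; lra.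
  have := bmin (- u) (ex_intro2 _ _ u Fu erefl); rewrite !ltrN2 => /(_ tu); lra.
by apply: nFt; rewrite -ut.
Qed.

Definition atmost (K : nat) X : Prop :=
  forall s : seq R, uniq s -> {in s, forall x, X x} -> (size s <= K)%N.

Lemma finite_atmost X : finite_set X -> exists K, atmost K X.
Proof.
move=> /finite_seqP[s ->]; exists (size s) => s' us' h.
by apply: uniq_leq_size => // x /h.
Qed.

Lemma atmost_sub K X Y : X `<=` Y -> atmost K Y -> atmost K X.
Proof. by move=> XY aY s us h; apply: aY => // x /h /XY. Qed.

Lemma atmost_rel K X Y (r : R -> R -> Prop) :
  (forall x, X x -> exists2 y, Y y & r x y) ->
  (forall x x' y, X x -> X x' -> r x y -> r x' y -> x = x') ->
  atmost K Y -> atmost K X.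
Proof.
move=> rX rI aY s us sX.
pose f x := if pselect (exists2 y, Y y & r x y) is left h then sval (cid2 h) else 0.
have fP x : X x -> Y (f x) /\ r x (f x).
  by move=> /rX h; rewrite /f; case: pselect => // h'; case: cid2.
rewrite -(size_map f); apply: aY.
  rewrite map_inj_in_uniq// => x x' /sX Xx /sX Xx' ff.
  by apply: (rI _ _ (f x)) => //; [have [] := fP x Xx | rewrite ff; have [] := fP x' Xx'].
by move=> _ /mapP[x /sX Xx ->]; have [] := fP x Xx.
Qed.

End line.

(** * Uniform finiteness *)

Section uniform_finiteness.
Context {R : realType} {S : forall n : nat, set (set 'rV[R]_n)}.
Hypothesis omS : o_minimal S.
Implicit Types P Q : env R -> Prop.
Local Notation dfn := (@dfn R S).
Local Notation dft := (@dft R S).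

Definition fib P (e : env R) : set R := [set t | P (scons t e)].

(** The only appeal to [om_tame]: a finite union of intervals has finite boundary, so every
    one-variable fiber has. *)
Lemma bd_fib_finite P e : dfn P -> finite_set (bd (fib P e)).
Proof.
move=> dP; pose Q e' := P (scons (e' 0%N) e).
have dQ : dfn Q.
  by apply: (dfn_subst omS dP) => i; apply: dft_scons => [|j]; [exact: dft_proj | exact: dft_const].
have d1 : depends_on 1 Q by move=> e1 e2 h; rewrite /Q h.
have [s sE] := om_tame omS (dfn_level omS dQ d1).
rewrite (_ : fib P e = \big[setU/set0]_(I <- s) [set` I]); first exact: bd_itvs_finite.
rewrite -sE; apply/seteqP.
by split => t /=; rewrite /Q (env_ofE _ 0) mxE.
Qed.

Lemma fib_finite P e : dfn P ->
  (forall a b, a < b -> exists2 t, a < t < b & ~ P (scons t e)) -> finite_set (fib P e).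
Proof. by move=> dP; apply: bd_finite_no_itv; exact: bd_fib_finite. Qed.

(* A first-order condition which makes the cardinality of the fiber locally constant at s:
   A is the fiber at s, B s' the one at s', and each point of A is within eta of exactly
   one point of B s' and conversely. *)
Definition good_at (A : R -> Prop) (B : R -> R -> Prop) (s : R) : Prop :=
  exists eta : R, 0 < eta /\ exists delta : R, 0 < delta /\
  (forall t1 : R, forall t2 : R, A t1 -> A t2 -> t1 <> t2 -> 2 * eta <= `|t1 - t2|) /\
  forall s' : R, `|s' - s| < delta ->
  (forall t : R, A t -> exists t' : R, B s' t' /\ `|t - t'| < eta /\
     forall t'' : R, B s' t'' -> `|t - t''| < eta -> t'' = t') /\
  (forall t' : R, B s' t' -> exists t : R, A t /\ `|t' - t| < eta).

Definition good P (e : env R) : Prop :=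
  good_at (fun t => P (scons t e)) (fun s t => P (scons t (scons s (shift 1 e)))) (e 0%N).

Lemma dfn_good P : dfn P -> dfn (good P).
Proof. move=> dP; rewrite /good /good_at; dfn_tac. Qed.

Lemma depends_on_good m P : depends_on m.+2 P -> depends_on m.+1 (good P).
Proof.
move=> dP e e' ee'; rewrite /good -(ee' 0%N)//.
suff [-> ->] : (fun t => P (scons t e)) = (fun t => P (scons t e')) /\
    (fun s t => P (scons t (scons s (shift 1 e)))) =
    (fun s t => P (scons t (scons s (shift 1 e')))) by [].
split; apply/funext => t; [|apply/funext => u]; apply/propext; apply: (depends_onE dP).
  by move=> -[|i] //=; rewrite ltnS => /ee'.
by move=> -[|[|i]] //=; rewrite /shift !ltnS => ?; apply: ee'.
Qed.

Lemma good_atmost P s y : good P (scons s y) ->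
  exists2 r, 0 < r & forall s', `|s' - s| < r -> forall K,
    atmost K (fib P (scons s' y)) <-> atmost K (fib P (scons s y)).
Proof.
move=> [eta [eta0 [delta [delta0 [gap h]]]]]; exists delta => // s' ss' K.
have {h}[h1 h2] := h s' ss'; split.
  apply: (atmost_rel (r := fun t t' => `|t - t'| < eta)).
    by move=> t /h1[t' [? [? _]]]; exists t'.
  move=> t1 t2 t' P1 P2 t1' t2'; apply: contrapT => t12.
  have := gap _ _ P1 P2 t12; apply/negP; rewrite -ltNge.
  rewrite (_ : t1 - t2 = (t1 - t') - (t2 - t')); last by ring.
  by rewrite (le_lt_trans (ler_normB _ _))// mulr_natl mulr2n ltrD.
apply: (atmost_rel (r := fun t' t => P (scons t (scons s y)) /\ `|t' - t| < eta)).
  by move=> t' /h2[t [? ?]]; exists t.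
move=> t1 t2 t P1 P2 [Pt t1t] [_ t2t].
have [t3 [_ [_ u]]] := h1 _ Pt.
by rewrite (u _ P1) 1?distrC// (u _ P2) 1?distrC.
Qed.

Definition cell (n : nat) (z : int) (t : R) : Prop :=
  z%:~R <= n%:R * t /\ n%:R * t < (z + 1)%:~R.

Lemma cell_same n z t t' : (0 < n)%N -> cell n z t -> cell n z t' -> `|t - t'| < n%:R^-1.
Proof.
rewrite -(ltr0n R) => n0; rewrite /cell !intrD => -[a b] [c d].
have nE : `|t - t'| * n%:R = `|n%:R * t - n%:R * t'| by rewrite -mulrBr normrM gtr0_norm// mulrC.
rewrite -[_^-1]mul1r ltr_pdivlMr// nE.
by rewrite ltr_norml; apply/andP; split; lra.
Qed.

Lemma cell_diff n z z' t t' : (0 < n)%N -> cell n z t -> cell n z' t' -> 4 <= `|z - z'| ->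
  2 * n%:R^-1 <= `|t - t'|.
Proof.
rewrite -(ltr0n R) => n0; rewrite /cell !intrD => -[a b] [c d] zz.
have nE : `|t - t'| * n%:R = `|n%:R * t - n%:R * t'| by rewrite -mulrBr normrM gtr0_norm// mulrC.
rewrite ler_pdivrMr// nE.
have : (4 : R) <= `|z%:~R - z'%:~R|.
  by rewrite -intrB -intr_norm (_ : 4 = 4%:~R)// ler_int.
by rewrite !ler_normr => /orP[h|h]; apply/orP; [left|right]; lra.
Qed.

(* The fiber meets exactly the cells listed in zs, each of them once. Finite fibers are
   coded by some (n, zs) with far apart cells, and there are only countably many codes. *)
Definition coded P n (zs : seq int) (e : env R) : Prop :=
  (forall t : R, P (scons t e) -> exists2 i, (i < size zs)%N & cell n zs`_i t) /\
  (forall i, (i < size zs)%N -> exists t : R, P (scons t e) /\ cell n zs`_i t /\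
     forall t' : R, P (scons t' e) -> cell n zs`_i t' -> t' = t).

(** Indices 4 apart put points of distinct cells at least 2 / n apart, which is the gap 2 eta of
    [good_at] for eta = 1 / n. *)
Definition separated (zs : seq int) : Prop :=
  forall i j, (i < size zs)%N -> (j < size zs)%N -> zs`_i = zs`_j \/ 4 <= `|zs`_i - zs`_j|.

Lemma dfn_coded P n zs : dfn P -> dfn (coded P n zs).
Proof. move=> dP; rewrite /coded /cell; dfn_tac. Qed.

(** A common code matches the fibers over the interval cell by cell. The radius eta is the cell
    width 1 / n, and separation excludes a match between different cells. *)
Lemma good_of_coded P n zs y (a b : R) : (0 < n)%N -> separated zs -> a < b ->
  (forall s, a < s < b -> coded P n zs (scons s y)) -> good P (scons ((a + b) / 2) y).
Proof.
move=> n0 sep ab h; exists n%:R^-1; split; first by rewrite invr_gt0 ltr0n.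
exists ((b - a) / 2); split; first by rewrite divr_gt0 ?subr_gt0.
have [|c1 c2] := h ((a + b) / 2); first by apply/andP; split; lra.
split.
  move=> t1 t2 P1 P2 t12.
  have [i lti ci] := c1 _ P1; have [j ltj cj] := c1 _ P2.
  have [ij|] := sep _ _ lti ltj; last exact: cell_diff cj.
  have [t [_ [_ u]]] := c2 _ lti; exfalso; apply: t12.
  by rewrite (u _ P1 ci) (u _ P2)// ij.
move=> s /=; rewrite ltr_norml => /andP[sa sb].
have [|d1 d2] := h s; first by apply/andP; split; lra.
split.
  move=> t Pt; have [i lti ci] := c1 _ Pt; have [t' [Pt' [ci' u]]] := d2 _ lti.
  exists t'; split => //; split; first exact: cell_same ci'.
  move=> t'' Pt'' tt''; have [j ltj cj] := d1 _ Pt''.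
  have [ij|ij] := sep _ _ lti ltj; first by apply: u => //; rewrite ij.
  have := cell_diff n0 ci cj ij; have : 0 < (n%:R^-1 : R) by rewrite invr_gt0 ltr0n.
  by move=> ? ?; lra.
move=> t' Pt'; have [i lti ci] := d1 _ Pt'; have [t [Pt [ci' u]]] := c2 _ lti.
by exists t; split => //; exact: cell_same ci'.
Qed.

Lemma finite_gap (F : set R) : finite_set F ->
  exists2 g, 0 < g & forall x y, F x -> F y -> x <> y -> g <= `|x - y|.
Proof.
move=> fF; have f2 : finite_set [set - `|p.1 - p.2| | p in F `*` F].
  exact/finite_image/finite_setX.
have [n|[m [_ m0 mP]]] := finite_has_max (fun x => x < 0) f2.
  exists 1 => // x y Fx Fy xy; have := n (- `|x - y|) (ex_intro2 _ _ (x, y) (conj Fx Fy) erefl).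
  by rewrite oppr_lt0 normr_gt0 subr_eq0 => /negPn/eqP.
exists (- m); rewrite ?oppr_gt0// => x y Fx Fy xy; rewrite lerNl; apply: mP.
  by exists (x, y).
by rewrite oppr_lt0 normr_gt0 subr_eq0; apply/eqP.
Qed.

Lemma coded_exists P e : finite_set (fib P e) ->
  exists n zs, [/\ (0 < n)%N, separated zs & coded P n zs e].
Proof.
move=> fA; have [g g0 gP] := finite_gap fA.
have [s sE] : exists s : seq R, fib P e = [set` s] by apply/finite_seqP.
have Ps t : P (scons t e) <-> t \in s.
  by rewrite -[P _]/(fib P e t) sE.
(* Points of the fiber become at least 6 apart after scaling by n, so that their floors differ by at
   least 4. *)
have [n n_gt0 ng] : exists2 n, (0 < n)%N & 6 <= n%:R * g.
  exists (Num.bound (6 / g)).+1 => //.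
  have g6 : 0 <= 6 / g by rewrite divr_ge0// ltW.
  by rewrite -ler_pdivrMr// (le_trans (ltW (archi_boundP g6)))// ler_nat.
exists n, [seq Num.floor (n%:R * t) | t <- s].
have cf t : cell n (Num.floor (n%:R * t)) t by have /andP[] := floor_itv (n%:R * t).
have n0 : 0 < n%:R :> R by rewrite ltr0n.
have same t t' z : t \in s -> t' \in s -> cell n z t -> cell n z t' -> t = t'.
  move=> /Ps st /Ps st' c c'; apply: contrapT => /(gP _ _ st st').
  have := cell_same n_gt0 c c'; rewrite -[_^-1]mul1r ltr_pdivlMr// => h1 h2.
  have : g * n%:R <= `|t - t'| * n%:R by rewrite ler_pM2r.
  by move=> ?; lra.
split => //.
- move=> i j; rewrite size_map => lti ltj; rewrite !(nth_map 0)//.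
  set t := s`_i; set t' := s`_j.
  have [->|/eqP tt'] := eqVneq t t'; first by left.
  right; have st : t \in s by exact: mem_nth.
  have st' : t' \in s by exact: mem_nth.
  have := gP t t' (iffRL (Ps t) st) (iffRL (Ps t') st') tt' => h.
  rewrite leNgt; apply/negP => zz.
  have : `|(Num.floor (n%:R * t))%:~R - (Num.floor (n%:R * t'))%:~R| <= (3 : R).
    by rewrite -intrB -intr_norm (_ : 3 = 3%:~R)// ler_int -ltzD1.
  have [a b] := cf t; have [c d] := cf t'; rewrite !intrD in b d.
  have h3 : 6 <= `|n%:R * t - n%:R * t'|.
    rewrite -mulrBr normrM gtr0_norm//; apply: (le_trans ng).
    by rewrite ler_pM2l.
  rewrite ler_norml => /andP[h1 h2]; move: h3; rewrite ler_normr => /orP[h3|h3]; lra.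
- split.
    move=> t /Ps st; exists (index t s); first by rewrite size_map index_mem.
    by rewrite (nth_map 0) ?index_mem// nth_index.
  move=> i; rewrite size_map => lti; exists s`_i; rewrite (nth_map 0)//.
  have si : s`_i \in s by exact: mem_nth.
  split; first exact/Ps.
  split; first exact: cf.
  by move=> t' /Ps st' c; apply: same c (cf _).
Qed.

(* The interval is uncountable, so one of the countably many codes is valid on an infinite
   subset, hence by tameness on a subinterval. *)
Lemma good_dense P y a b : dfn P -> (forall s, finite_set (fib P (scons s y))) -> a < b ->
  exists2 s, a < s < b & good P (scons s y).
Proof.
move=> dP fA ab; apply: contrapT => nex.
pose Q n zs e := a < e 0%N /\ e 0%N < b /\ coded P n zs e.
have dQ n zs : dfn (Q n zs) by have := dfn_coded n zs dP; rewrite /Q; dfn_tac.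
have := itv_uncountable ab; apply.
pose D := [set c : nat * seq int | (0 < c.1)%N /\ separated c.2].
apply: (@sub_countable _ _ _ (\bigcup_(c in D) fib (Q c.1 c.2) y)).
  apply: subset_card_le => s /=; rewrite in_itv /= => /andP[as_ sb].
  have [n [zs [n0 sz cz]]] := coded_exists (fA s).
  by exists (n, zs).
apply: bigcup_countable => [|[n zs] [/= n0 sz]]; first exact: countableP.
apply: finite_set_countable; apply: fib_finite => // a' b' ab'.
apply: contrapT => nex'.
have aQ s : a' < s < b' -> Q n zs (scons s y).
  by move=> s'; apply: contrapT => nQ; apply: nex'; exists s.
apply: nex; exists ((a' + b') / 2).
  have [|/= h1 [h2 _]] := aQ ((a' + b') / 2); last by rewrite h1.
  by apply/andP; split; lra.
by apply: good_of_coded n0 sz ab' _ => s /aQ[_ []].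
Qed.

(* The parameter s next to the fiber variable is eliminated: for the remaining parameters
   y, the cardinality of the fiber at s is constant between the finitely many bad values of
   s, so the finitely many sample values of s bound it for all s. The union of the fibers
   over the samples is a finite fiber over y alone. *)
Lemma uniform_finiteness_all m P : dfn P -> depends_on m.+1 P ->
  (forall e, finite_set (fib P e)) -> exists K, forall e, atmost K (fib P e).
Proof.
elim: m P => [|m IH] P dP dm fP.
  have [K hK] := finite_atmost (fP (fun=> 0)); exists K => e.
  by apply: atmost_sub hK => t; apply: dm => -[].
have dg : dfn (good P) by exact: dfn_good.
have dng : dfn (fun e => ~ good P e) by exact: dfn_not.
pose bad y := fib (fun e => ~ good P e) y.
have fbad y : finite_set (bad y).
  apply: fib_finite => // a b ab; have [s sab gs] := good_dense (y := y) dP (fun s => fP _) ab.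
  by exists s => // ng.
pose P' e := exists s : R, sample (bad (shift 1 e)) (bad (shift 1 e)) s /\
  P (scons (e 0%N) (scons s (shift 1 e))).
have P'E t y : P' (scons t y) <-> exists s : R, sample (bad y) (bad y) s /\
  P (scons t (scons s y)) by [].
have dP' : dfn P' by rewrite /P' /sample /bad /fib /=; dfn_tac.
have [] := IH P' dP'.
- move=> e e' ee' [s].
  have -> : bad (shift 1 e) = bad (shift 1 e').
    apply/seteqP; split => t ng g; apply: ng; apply: (depends_on_good dm) g => -[|i] //=;
    by rewrite /shift !ltnS => lt_im; rewrite ee'.
  move=> [bs Ps]; exists s; split => //; apply: dm Ps => -[|[|i]] //=.
    by rewrite ee'.
  by rewrite /shift !ltnS => lt_im; apply: ee'.
- move=> y; rewrite (_ : fib P' y = \bigcup_(s in sample (bad y) (bad y)) fib P (scons s y)).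
    by apply: bigcup_finite => [|s _]; [exact: finite_sample | exact: fP].
  apply/seteqP; split => t; first by move=> /P'E[s [bs Ps]]; exists s.
  by move=> [s bs Ps]; apply/P'E; exists s.
move=> K hK; exists K => e; rewrite -(scons_shift e).
set s := e 0%N; set y := shift 1 e.
have [s' ss' h] := sample_exists s (fbad y).
have aK : atmost K (fib P (scons s' y)).
  by apply: atmost_sub (hK y) => t Pt; apply/P'E; exists s'.
case: h => [<- //|h].
pose X := [set s | atmost K (fib P (scons s y))].
suff : X s' <-> X s by move=> [+ _]; apply.
apply: bd_free_eq => u /h nb; have [r r0 hr] : exists2 r, 0 < r & forall s', `|s' - u| < r ->
    forall K, atmost K (fib P (scons s' y)) <-> atmost K (fib P (scons u y)).
  by apply: good_atmost; apply: contrapT.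
by move=> /(_ r r0); apply => v /hr hv; exact: hv.
Qed.

(** Containing no interval is a first-order condition which for definable fibers is equivalent to
    finiteness. Cutting P down to the parameters satisfying it leaves only finite fibers. *)
Theorem uniform_finiteness P : dfn P ->
  exists K, forall e, finite_set (fib P e) -> atmost K (fib P e).
Proof.
move=> dP; pose Q e := P e /\ forall a b : R, a < b -> exists t : R, (a < t /\ t < b) /\
  ~ P (scons t (shift 1 e)).
have dQ : dfn Q by rewrite /Q; dfn_tac.
have [n [dn _]] := dQ; have dn1 : depends_on n.+1 Q by exact: depends_on_le dn.
have [|K hK] := uniform_finiteness_all dQ dn1.
  move=> e; have [[t0 [_ h]]|ne] := pselect (exists t, Q (scons t e)).
    apply: (@sub_finite_set _ _ (fib P e)); first by move=> t [].
    apply: fib_finite => // a b /h[t [/andP tab nP]]; by exists t.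
  apply: (@sub_finite_set _ _ set0) => // t Qt; by case: ne; exists t.
exists K => e fe; apply: atmost_sub (hK e) => t Pt; split => // a b ab.
by have [u /andP uab nu] := finite_no_itv fe ab; exists u.
Qed.

End uniform_finiteness.

(** * Generic constancy *)

Section generic_constancy.
Context {R : realType} {S : forall n : nat, set (set 'rV[R]_n)}.
Hypothesis omS : o_minimal S.
Implicit Types P Q : env R -> Prop.
Local Notation dfn := (@dfn R S).
Local Notation dft := (@dft R S).

Definition box (n : nat) (a : env R) (r : R) (e : env R) : Prop :=
  forall i, (i < n)%N -> `|e i - a i| < r.

Lemma box_center n a r : 0 < r -> box n a r a.
Proof. by move=> r0 i _; rewrite subrr normr0. Qed.

Lemma box_le n a r r' e : r <= r' -> box n a r e -> box n a r' e.
Proof. by move=> rr' h i /h lt; exact: lt_le_trans rr'. Qed.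

Lemma box_scons n a r t e : box n.+1 a r (scons t e) <-> `|t - a 0%N| < r /\ box n (shift 1 a) r e.
Proof.
split => [h|[h0 h] [|i] lti] //=; last exact: h.
by split => [|i lti]; [exact: (h 0%N) | exact: (h i.+1)].
Qed.

Definition subbox n a r a' r' := forall e, box n a' r' e -> box n a r e.

Lemma dfn_bd_fib P : dfn P -> dfn (fun e => bd (fib P (shift 1 e)) (e 0%N)).
Proof. by move=> dP; rewrite /bd /fib /=; dfn_tac. Qed.

(** Boundaries of fibers are finite whatever the fibers are, so one K serves all e. *)
Lemma bd_fib_atmost P : dfn P -> exists K, forall e, atmost K (bd (fib P e)).
Proof.
move=> dP; have [K hK] := uniform_finiteness omS (dfn_bd_fib dP).
by exists K => e; exact: (hK e (bd_fib_finite omS e dP)).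
Qed.

Lemma atmost_grid K (X : set R) (c w : R) : 0 < w -> atmost K X ->
  exists2 j, (j <= K)%N & forall t, c + j%:R * w < t < c + j.+1%:R * w -> ~ X t.
Proof.
move=> w0 aX; apply: contrapT => nex.
have h j : exists t, (j <= K)%N -> c + j%:R * w < t < c + j.+1%:R * w /\ X t.
  have [jK|jK] := leqP j K; last by exists 0.
  apply: contrapT => nt; apply: nex; exists j => // t tj Xt; apply: nt.
  by exists t.
have [f fP] := choice h.
suff : (size [seq f j | j <- iota 0 K.+1] <= K)%N by rewrite size_map size_iota ltnn.
apply: aX; last by move=> _ /mapP[j + ->]; rewrite mem_iota ltnS => /fP[].
rewrite map_inj_in_uniq ?iota_uniq// => i j; rewrite !mem_iota !ltnS /= => /fP[fi _] /fP[fj _] fij.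
have lt i' j' : c + i'%:R * w < f i -> f i < c + j'.+1%:R * w -> (i' <= j')%N.
  move=> h1 h2; have : c + i'%:R * w < c + j'.+1%:R * w by exact: lt_trans h2.
  by rewrite ltrD2l ltr_pM2r// ltr_nat ltnS.
move/andP: fi => [fi1 fi2]; move: fj; rewrite -fij => /andP[fj1 fj2].
by apply/eqP; rewrite eqn_leq !lt.
Qed.

Definition constant_on_subbox n P := forall a r, 0 < r -> exists a' r', [/\ 0 < r',
  subbox n a r a' r' & (forall e, box n a' r' e -> P e) \/ (forall e, box n a' r' e -> ~ P e)].

Lemma constants_on_subbox n k (P : nat -> env R -> Prop) :
  (forall i, (i < k)%N -> constant_on_subbox n (P i)) ->
  forall a r, 0 < r -> exists a' r', [/\ 0 < r', subbox n a r a' r' &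
    forall i, (i < k)%N ->
      (forall e, box n a' r' e -> P i e) \/ (forall e, box n a' r' e -> ~ P i e)].
Proof.
elim: k => [|k IH] cP a r r0; first by exists a, r; split.
have [|a1 [r1 [r10 s1 h1]]] := IH _ a r r0; first by move=> i lti; apply: cP; exact: ltnW.
have [a2 [r2 [r20 s2 h2]]] := cP k (ltnSn k) a1 r1 r10.
exists a2, r2; split => //; first by move=> e /s2 /s1.
move=> i; rewrite ltnS leq_eqVlt => /orP[/eqP -> //|/h1[] h]; [left|right] => e /s2;
by [exact: h].
Qed.

(* The boundaries of the fibers have at most K points, so out of K + 1 disjoint intervals
   one has constant truth value over each parameter; by induction the choice of interval
   and value can be made constant on a smaller box of parameters. *)
Theorem generic_constancy n P : dfn P -> depends_on n P -> constant_on_subbox n P.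
Proof.
elim: n P => [|n IH] P dP dn a r r0.
  exists a, r; split => //; have [Pa|nPa] := pselect (P a); [left|right] => e _.
    exact: dn Pa.
  by move=> Pe; apply: nPa; exact: dn Pe.
have [K hK] := bd_fib_atmost dP.
(* K + 1 intervals of width w, starting at the left end c, tile the interval of radius r about
   [a 0]. *)
pose w := 2 * r / K.+1%:R; have w0 : 0 < w by rewrite divr_gt0 ?mulr_gt0 ?ltr0n.
pose c := a 0%N - r.
pose Qt j e := forall t : R, c + j%:R * w < t /\ t < c + j.+1%:R * w -> P (scons t e).
pose Qf j e := forall t : R, c + j%:R * w < t /\ t < c + j.+1%:R * w -> ~ P (scons t e).
have dQt j : dfn (Qt j) by rewrite /Qt; dfn_tac.
have dQf j : dfn (Qf j) by rewrite /Qf; dfn_tac.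
have sc e e' : (forall i, (i < n)%N -> e i = e' i) -> forall t i, (i < n.+1)%N ->
    scons t e i = scons t e' i.
  by move=> ee' t [|i] //=; rewrite ltnS => /ee'.
have nQt j : depends_on n (Qt j) by move=> e e' /sc ee' h t /h; apply: dn; exact: ee'.
have nQf j : depends_on n (Qf j).
  by move=> e e' /sc ee' h t /h nP P'; apply: nP; apply: dn P' => i /(ee' t).
(* The box is shrunk for all j at once; the index j can then be chosen from the fiber over the
   single point a2. *)
have [a1 [r1 [r10 s1 h1]]] :=
  constants_on_subbox (k := K.+1) (fun j _ => IH _ (dQt j) (nQt j)) (shift 1 a) r0.
have [a2 [r2 [r20 s2 h2]]] :=
  constants_on_subbox (k := K.+1) (fun j _ => IH _ (dQf j) (nQf j)) a1 r10.
have [j jK hj] := atmost_grid c w0 (hK a2).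
pose m := c + j%:R * w + w / 2.
have jE : c + j.+1%:R * w = c + j%:R * w + w by rewrite -natr1 mulrDl mul1r addrA.
have jw : 0 <= j%:R * w by rewrite mulr_ge0 ?ler0n// ltW.
have jw' : j.+1%:R * w <= 2 * r.
  by rewrite /w mulrA ler_pdivrMr ?ltr0n// mulrC ler_pM2l ?mulr_gt0// ler_nat.
exists (scons m a2), (Num.min (w / 2) r2).
have itv t : `|t - m| < w / 2 -> c + j%:R * w < t < c + j.+1%:R * w.
  by rewrite jE ltr_norml /m => /andP[h3 h4]; apply/andP; split; lra.
split; first by rewrite lt_min r20 divr_gt0.
  move=> e; rewrite -(scons_shift e) => /box_scons /= [h0 hs]; apply/box_scons; split.
    have : `|e 0%N - m| < w / 2 by apply: lt_le_trans h0 _; rewrite ge_min lexx.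
    move=> /itv; move: jw'; rewrite ltr_norml /c => h3 /andP[h4 h5].
    by apply/andP; split; lra.
  by apply/s1/s2; apply: box_le hs; rewrite ge_min lexx orbT.
have sub e : box n.+1 (scons m a2) (Num.min (w / 2) r2) e ->
    (c + j%:R * w < e 0%N /\ e 0%N < c + j.+1%:R * w) /\ box n a2 r2 (shift 1 e).
  rewrite -{1}(scons_shift e) => /box_scons /= [h0 hs]; split.
    by apply/andP/itv/(lt_le_trans h0); rewrite ge_min lexx.
  by apply: box_le hs; rewrite ge_min lexx orbT.
have cst t u : c + j%:R * w < t /\ t < c + j.+1%:R * w ->
    c + j%:R * w < u /\ u < c + j.+1%:R * w -> P (scons t a2) <-> P (scons u a2).
  move=> [t1 t2] [u1 u2]; apply: (@bd_free_eq _ (fib P a2)) => v; rewrite ge_min le_max.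
  move=> /andP[hv1 hv2]; apply: hj; apply/andP.
  by split; [case/orP: hv1 => h; lra | case/orP: hv2 => h; lra].
have mj : c + j%:R * w < m /\ m < c + j.+1%:R * w.
  by apply/andP/itv; rewrite subrr normr0 divr_gt0.
have [Pm|nPm] := pselect (P (scons m a2)); [left|right] => e /sub[ej eb].
  have Qa : Qt j a2 by move=> t tj; apply/(cst t m).
  case: (h1 j jK) => h; last by case: (h a2) => //; exact/s2/box_center.
  by rewrite -(scons_shift e); apply: (h _ (s2 _ eb)).
have Qa : Qf j a2 by move=> t tj Pt; apply: nPm; apply/(cst t m).
case: (h2 j jK) => h; last by case: (h a2) => //; exact/box_center.
by rewrite -(scons_shift e); apply: (h _ eb).
Qed.

(** Empty interior in R^n. For definable P this amounts to being nowhere dense, by [thin_subbox]. *)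
Definition thin n P := forall a r, 0 < r -> exists2 e, box n a r e & ~ P e.

Lemma thin_subbox n P a r : dfn P -> depends_on n P -> thin n P -> 0 < r ->
  exists a' r', [/\ 0 < r', subbox n a r a' r' & forall e, box n a' r' e -> ~ P e].
Proof.
move=> dP dn tP r0; have [a' [r' [r'0 s h]]] := generic_constancy dP dn a r0.
exists a', r'; split => //; case: h => // h.
by have [e /h] := tP a' r' r'0.
Qed.

Lemma not_thin n P : ~ thin n P -> exists a, exists2 r, 0 < r & forall e, box n a r e -> P e.
Proof.
move=> nt; apply: contrapT => nex; apply: nt => a r r0; apply: contrapT => ne.
apply: nex; exists a, r => // e be; apply: contrapT => nP; apply: ne; by exists e.
Qed.

(** A finite union of sets with empty interior may have interior in general; definable ones are
    nowhere dense, so boxes can be shrunk to avoid one member after another. *)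
Lemma thin_bigcup n (T : eqType) (F : set T) (P : T -> env R -> Prop) : finite_set F ->
  (forall i, F i -> dfn (P i)) -> (forall i, F i -> depends_on n (P i)) ->
  (forall i, F i -> thin n (P i)) -> thin n (fun e => exists2 i, F i & P i e).
Proof.
move=> /finite_seqP[s ->] dP nP tP.
suff h a r : 0 < r -> exists a' r', [/\ 0 < r', subbox n a r a' r' &
    forall e, box n a' r' e -> ~ exists2 i, i \in s & P i e].
  move=> a r /h h'; have [a' [r' [r'0 sb nex]]] := h' a.
  by exists a'; [exact/sb/box_center | exact/nex/box_center].
elim: s dP nP tP a r => [|i s IH] dP nP tP a r r0; first by exists a, r; split => // e _ [].
have [| | |a1 [r1 [r10 s1 h1]]] := IH _ _ _ a r r0.
- by move=> j js; apply: dP; rewrite /= inE js orbT.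
- by move=> j js; apply: nP; rewrite /= inE js orbT.
- by move=> j js; apply: tP; rewrite /= inE js orbT.
have is_ : [set` i :: s] i by rewrite /= inE eqxx.
have [a2 [r2 [r20 s2 h2]]] := thin_subbox a1 (dP _ is_) (nP _ is_) (tP _ is_) r10.
exists a2, r2; split => //; first by move=> e /s2 /s1.
move=> e be [j]; rewrite inE => /orP[/eqP -> /(h2 e be) //|js Pj].
by apply: (h1 e (s2 _ be)); exists j.
Qed.

End generic_constancy.

(** * Dimension count without dimension theory *)

Section unions_of_powers.
Context {R : realType} {S : forall n : nat, set (set 'rV[R]_n)}.
Hypothesis omS : o_minimal S.
Implicit Types P Q : env R -> Prop.
Local Notation dfn := (@dfn R S).
Local Notation dft := (@dft R S).

(** The l-th point of a tuple of points of R^q stored consecutively. The zeros beyond q turn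
    agreement of two blocks into equality of environments. *)
Definition block (q l : nat) (e : env R) : env R :=
  fun i => if (i < q)%N then e (l * q + i)%N else 0.

Lemma block_lt q l N i : (l < N)%N -> (i < q)%N -> (l * q + i < N * q)%N.
Proof.
move=> lN iq; apply: (@leq_trans (l.+1 * q)); last by rewrite leq_mul2r lN orbT.
by rewrite mulSn addnC ltn_add2r.
Qed.

Lemma dft_block q l f i : (forall i, dft (fun e => f e i)) -> dft (fun e => block q l (f e) i).
Proof. by move=> df; rewrite /block; case: (i < q)%N; [|exact: dft_const]. Qed.

Lemma depends_on_block q N l e e' : (l < N)%N ->
  (forall i, (i < N * q)%N -> e i = e' i) -> block q l e = block q l e'.
Proof.
move=> lN ee'; apply/funext => i; rewrite /block; case: ifP => // iq.
by apply: ee'; exact: block_lt.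
Qed.

Lemma block_flat q l (X : nat -> env R) i : (i < q)%N ->
  block q l (fun m => X (m %/ q)%N (m %% q)%N) i = X l i.
Proof.
move=> iq; rewrite /block iq divnMDl ?(leq_ltn_trans _ iq)// divn_small// addn0.
by rewrite modnMDl modn_small.
Qed.

Lemma cat_cat n (x y z : env R) : cat n (cat n x y) z = cat n x z.
Proof. by apply/funext => i; rewrite /cat; case: (i < n)%N. Qed.

Lemma depends_on_cat n q (x e e' : env R) :
  (forall i, (i < q)%N -> e i = e' i) -> forall i, (i < n + q)%N -> cat n x e i = cat n x e' i.
Proof.
by move=> ee' i lti; rewrite /cat; case: ltnP => // ni; apply: ee'; rewrite ltn_subLR.
Qed.

(* If the union of the L-th powers of the fibers over R^D contained a box, write a parameter
   as (t, y) with t real. For given y and points x_l, the set of suitable t is cut out by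
   the boundaries of the sets { t | x_l is in the fiber over (t, y) }, so a suitable t can be
   sampled from the boundaries attached to two indices i and j. By generic constancy i and j
   may be fixed on a smaller box; freezing x_i and x_j there leaves finitely many t for each
   y, hence a family over R^(D - 1) which again has thin fibers, and two indices fewer. *)
Theorem thin_union_of_powers D q P : dfn P -> depends_on (D + q) P ->
  (forall x, thin q (fun e => P (cat D x e))) ->
  forall L : seq nat, uniq L -> (2 * D < size L)%N ->
  forall (a : nat -> env R) r, 0 < r ->
  exists X : nat -> env R, (forall l, l \in L -> box q (a l) r (X l)) /\
    forall x, exists2 l, l \in L & ~ P (cat D x (X l)).
Proof.
elim: D P => [|D IH] P dP nP tP L uL sL a r r0.
  case: L uL sL => [//|l L] _ _.
  have [e be nPe] := tP (fun=> 0) (a l) r r0; rewrite cat0 in nPe.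
  exists (fun l' => if l' == l then e else a l'); split.
    move=> l' _; have [->|_] := eqVneq l' l; first exact: be.
    exact: box_center.
  by move=> x; exists l; [rewrite inE eqxx | rewrite /= eqxx cat0].
apply: contrapT => nex.
have {}nex X : (forall l, l \in L -> box q (a l) r (X l)) ->
    exists x, forall l, l \in L -> P (cat D.+1 x (X l)).
  move=> bX; apply: contrapT => nx; apply: nex; exists X; split => // x.
  apply: contrapT => nl; apply: nx; exists x => l lL; apply: contrapT => nPl.
  by apply: nl; exists l.
pose N := (\max_(l <- L) l).+1.
have LN l : l \in L -> (l < N)%N by move=> lL; rewrite ltnS; exact: leq_bigmax_seq.
pose BD e := bd (fib P (shift 1 e)) (e 0%N).
have dBD : dfn BD by exact: dfn_bd_fib.
have BDE y : bd (fib P y) = (fun t => BD (scons t y)) by [].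
pose pt l e := cat D e (block q l (shift D e)).
pose Q i j e := exists t : R,
  sample (fun u => BD (scons u (pt i e))) (fun u => BD (scons u (pt j e))) t /\
  forall k, (k < size L)%N -> P (scons t (pt (nth 0 L k)%N e)).
pose B (p : nat * nat) e := exists x, Q p.1 p.2 (cat D x e).
have BE p e : B p e <-> exists x, exists t, sample (bd (fib P (cat D x (block q p.1 e))))
    (bd (fib P (cat D x (block q p.2 e)))) t /\
    forall l, l \in L -> P (scons t (cat D x (block q l e))).
  split=> -[x [t [st h]]]; exists x, t; rewrite /pt !cat_cat !shift_cat !BDE in st h *; split => //.
    move=> l lL; have := h (index l L); rewrite index_mem nth_index// cat_cat ?shift_cat.
    exact.
  by move=> k kL; rewrite cat_cat ?shift_cat; apply: h; exact: mem_nth.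
have dB p : dfn (B p).
  apply: (dfn_ex_cat omS); rewrite /Q /sample /=.
  by dfn_tac; rewrite /pt; dfn_tac; apply: dft_block => *; rewrite /shift; dfn_tac.
have nB p : p.1 \in L -> p.2 \in L -> depends_on (N * q) (B p).
  move=> p1 p2 e e' ee' /BE[x [t [st h]]]; apply/BE; exists x, t.
  rewrite -!(depends_on_block (LN _ p1) ee') -!(depends_on_block (LN _ p2) ee').
  by split => // l lL; rewrite -(depends_on_block (LN _ lL) ee'); exact: h.
pose F := [set p : nat * nat | p.1 \in L /\ p.2 \in L].
have fF : finite_set F.
  apply: (@sub_finite_set _ _ ([set` L] `*` [set` L])); first by move=> p [].
  exact: finite_setX.
(* If every [B p] were thin, so would be their finite union, and some tuple near a would lie in none
   of them. But the parameter given by [nex] for that tuple can be moved to a sample, and the two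
   boundary points defining the sample name a pair. *)
have [[i j] [/= iL jL]] : exists2 p, F p & ~ thin (N * q) (B p).
  apply: contrapT => nF.
  have [|e be []] := thin_bigcup omS (P := B) fF (fun p _ => dB p)
      (fun p Fp => nB p Fp.1 Fp.2) _ (fun m => a (m %/ q)%N (m %% q)%N) r0.
    by move=> p Fp; apply: contrapT => nt; apply: nF; exists p.
  have [|x Px] := nex (fun l => block q l e).
    move=> l /LN lN i iq; rewrite -(block_flat l a iq) /block iq; apply: be.
    exact: block_lt.
  rewrite -(scons_shift x) in Px; set t0 := x 0%N in Px; set y := shift 1 x in Px.
  pose S_ l := fib P (cat D y (block q l e)).
  have S0 l : l \in L -> S_ l t0 by move=> /Px; rewrite cat_scons.
  have fb : finite_set (\bigcup_(l in [set` L]) bd (S_ l)).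
    by apply: bigcup_finite => // l _; exact: (bd_fib_finite omS _ dP).
  (* Moving from t0 to s crosses no boundary of any [S_ l], so s still belongs to all of them. *)
  have [s ss h] := sample_exists t0 fb.
  have Ss l : l \in L -> S_ l s.
    move=> lL; case: h => [->|h]; first exact: S0.
    apply/(@bd_free_eq _ (S_ l) s t0); last exact: S0.
    by move=> u /h nu bu; apply: nu; exists l.
  (* The value 0 belongs to [sample] of any two sets, so here any pair of indices will do. *)
  case: ss => [s0|[u [v [[i iL bu] [[j jL bv] suv]]]]].
    have lL : nth 0%N L 0 \in L by apply: mem_nth; exact: leq_ltn_trans sL.
    exists (nth 0%N L 0, nth 0%N L 0) => //; apply/BE; exists y, s.
    by split; [left | move=> l /Ss].
  exists (i, j) => //; apply/BE; exists y, s; split; last by move=> l /Ss.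
  by right; exists u, v.
move=> /not_thin[a' [r' r'0 hB]].
pose L' := rem j (rem i L).
have uL' : uniq L' by rewrite !rem_uniq.
have sL' : (2 * D < size L')%N.
  have sr (x : nat) (s : seq nat) : ((size s).-1 <= size (rem x s))%N.
    by have [xs|xs] := boolP (x \in s); [rewrite size_rem | rewrite rem_id// leq_pred].
  apply: leq_trans (sr j _); rewrite ltn_predRL; apply: leq_trans (sr i _).
  by rewrite ltn_predRL; move: sL; rewrite mulnS.
have mL' l : l \in L' -> [/\ l \in L, l != i & l != j].
  rewrite mem_rem_uniq ?rem_uniq// inE => /andP[lj].
  by rewrite mem_rem_uniq// inE => /andP[li lL].
pose c l := block q l a'.
pose P' e := exists t : R, sample (fun u => BD (scons u (cat D e (c i))))
  (fun u => BD (scons u (cat D e (c j)))) t /\ P (scons t e).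
have dP' : dfn P' by rewrite /P' /sample /=; dfn_tac.
have cE e e' l : (forall i, (i < D + q)%N -> e i = e' i) -> cat D e (c l) = cat D e' (c l).
  move=> ee'; apply/funext => k; rewrite /cat; case: ifP => // kD; apply: ee'.
  exact: ltn_addr.
have nP' : depends_on (D + q) P'.
  move=> e e' ee' [t [st Pt]]; exists t; rewrite -!(cE _ _ _ ee'); split => //.
  by apply: nP Pt => -[|k] //=; rewrite addSn ltnS => /ee'.
have tP' x : thin q (fun e => P' (cat D x e)).
  pose F' := sample (bd (fib P (cat D x (c i)))) (bd (fib P (cat D x (c j)))).
  have fF' : finite_set F' by apply: finite_sample; exact: (bd_fib_finite omS _ dP).
  rewrite (_ : (fun e => _) = (fun e => exists2 t, F' t & P (scons t (cat D x e)))).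
    apply: (thin_bigcup omS) => // t _.
    - by dfn_tac.
    - move=> e e' ee'; apply: nP => k; rewrite -!cat_scons; exact: depends_on_cat.
    - move=> b s s0; have [e be nPe] := tP (scons t x) b s s0; exists e => //.
      by rewrite -cat_scons.
  apply/funext => e; apply/propext; rewrite /P' !cat_cat.
  by split => [[t [? ?]]|[t ? ?]]; exists t.
have [X [bX hX]] := IH P' dP' nP' tP' L' uL' sL' c r' r'0.
pose e := fun m => if (m %/ q)%N \in L' then X (m %/ q)%N (m %% q)%N else a' m.
have be : box (N * q) a' r' e.
  move=> m mN; rewrite /e; case: ifP => [mL|_]; last by rewrite subrr normr0.
  have q0 : (0 < q)%N by move: mN; case: (q) => //; rewrite muln0.
  have := bX _ mL (m %% q)%N; rewrite ltn_mod => /(_ q0).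
  by rewrite /c /block ltn_mod q0 -divn_eq.
have /BE[x [t [/= st ht]]] := hB _ be.
have blk l : l \notin L' -> block q l e = c l.
  move=> lL'; apply/funext => k; rewrite /c /block; case: ifP => // kq.
  rewrite /e divnMDl ?(leq_ltn_trans _ kq)// divn_small// addn0.
  by rewrite (negbTE lL').
have iL' : i \notin L' by apply/negP => /mL'[]; rewrite eqxx.
have jL' : j \notin L' by apply/negP => /mL'[_ _]; rewrite eqxx.
have [l lL' []] := hX x; have [lL _ _] := mL' _ lL'.
exists t; rewrite !cat_cat -!blk//; split => //.
apply: nP (ht l lL) => k; rewrite -!cat_scons; apply: depends_on_cat => {}k kq.
rewrite /block kq /e divnMDl ?(leq_ltn_trans _ kq)// divn_small// addn0 lL'.
by rewrite modnMDl modn_small.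
Qed.
End unions_of_powers.

(** * Thin definable sets are null *)

Section null_sets.
Context {R : realType} {S : forall n : nat, set (set 'rV[R]_n)}.
Hypothesis omS : o_minimal S.
Implicit Types P Q : env R -> Prop.
Local Notation dfn := (@dfn R S).
Local Notation dft := (@dft R S).

Lemma dfn_ex_env n (P : env R -> env R -> Prop) : (forall e, depends_on n (P^~ e)) ->
  dfn (fun e => P e (shift n e)) -> dfn (fun e => exists x, P x e).
Proof.
move=> nP dP; apply: (@dfn_ext _ _ (fun e => exists x, P (cat n x e) (shift n (cat n x e)))).
  move=> e; split => -[x Px]; exists x; rewrite ?shift_cat in Px *; apply: nP Px => i lti;
  by rewrite cat_lt.
exact: (@dfn_ex_cat _ _ omS n (fun e => P e (shift n e)) dP).
Qed.

Definition frontier n P e : Prop := forall r : R, 0 < r ->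
  exists x, box n e r x /\ ~ (P x <-> P e).

Lemma dfn_frontier n P : depends_on n P -> dfn P -> dfn (frontier n P).
Proof.
move=> nP dP; apply: (dfn_all omS (P := fun r e => 0 < r -> exists x, box n e r x /\ ~ (P x <-> P e))).
apply: (dfn_imp omS); first by dfn_tac.
apply: (dfn_ex_env (n := n)
   (P := fun x e => box n (shift 1 e) (e 0%N) x /\ ~ (P x <-> P (shift 1 e)))).
  move=> e x x' xx' [bx nPx]; split; first by move=> i lti; rewrite -xx'//; exact: bx.
  by rewrite -(depends_onE nP xx').
by rewrite /box; dfn_tac.
Qed.

Lemma depends_on_frontier n P : depends_on n P -> depends_on n (frontier n P).
Proof.
move=> nP e e' ee' h r /h[x [bx nPx]]; exists x; split; last by rewrite -(depends_onE nP ee').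
by move=> i lti; rewrite -ee'//; exact: bx.
Qed.

Lemma not_frontier n P e : ~ frontier n P e ->
  exists2 r, 0 < r & forall x, box n e r x -> P x <-> P e.
Proof.
move=> nf; apply: contrapT => nex; apply: nf => r r0; apply: contrapT => nx; apply: nex.
by exists r => // x bx; apply: contrapT => nP; apply: nx; exists x.
Qed.

Definition cbox n (q : env R * env R) (e : env R) : Prop :=
  forall i, (i < n)%N -> q.1 i <= e i <= q.2 i.

Lemma cbox_scons n c c' q t e :
  cbox n.+1 (scons c q.1, scons c' q.2) (scons t e) <-> c <= t <= c' /\ cbox n q e.
Proof.
split => [h|[h0 h] [|i] lti] //=; last exact: h.
by split => [|i lti]; [exact: (h 0%N) | exact: (h i.+1)].
Qed.

Lemma env_bounded n (e : env R) : exists2 D, 0 < D & forall i, (i < n)%N -> `|e i| <= D.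
Proof.
elim: n => [|n [D D0 h]]; first by exists 1.
exists (Num.max D `|e n|); first by rewrite lt_max D0.
move=> i; rewrite ltnS leq_eqVlt le_max => /orP[/eqP ->|/h ->] //; by rewrite lexx orbT.
Qed.

Lemma env_min n (e : env R) : (forall i, (i < n)%N -> 0 < e i) ->
  exists2 r, 0 < r & forall i, (i < n)%N -> r <= e i.
Proof.
elim: n => [|n IH] h; first by exists 1.
have [|r r0 hr] := IH; first by move=> i /ltnW; exact: h.
exists (Num.min r (e n)); first by rewrite lt_min r0 h.
move=> i; rewrite ltnS leq_eqVlt ge_min => /orP[/eqP ->|/hr ->] //; by rewrite lexx orbT.
Qed.

(** A closed box is convex, and along a segment in it the truth value of P is locally constant. *)
Lemma constant_on_cbox n P q e e' : depends_on n P ->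
  (forall x, cbox n q x -> ~ frontier n P x) -> cbox n q e -> cbox n q e' -> P e <-> P e'.
Proof.
move=> nP nf qe qe'; pose g s i := e i + s * (e' i - e i).
have -> : e = g 0 by apply/funext => i; rewrite /g mul0r addr0.
have -> : e' = g 1 by apply/funext => i; rewrite /g mul1r addrC subrK.
apply: (@locally_constant_eq _ [set s | P (g s)]) => // s /andP[s0 s1].
have qg : cbox n q (g s).
  move=> i lti; have /andP[a b] := qe i lti; have /andP[c d] := qe' i lti.
  by rewrite /g; apply/andP; split; nra.
have [r r0 hr] := not_frontier (nf _ qg).
have [D D0 hD] := env_bounded n (fun i => e' i - e i).
exists (r / D); first by rewrite divr_gt0.
move=> u us; apply: hr => i lti; rewrite /g opprD addrACA subrr add0r -mulrBl normrM.
rewrite (@le_lt_trans _ _ (`|u - s| * D)) ?ler_wpM2l ?hD//.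
by rewrite -ltr_pdivlMr.
Qed.

Definition vol n (q : env R * env R) : R := \prod_(i < n) (q.2 i - q.1 i).
Definition meets n P (q : env R * env R) : Prop := exists2 e, cbox n q e & P e.

Lemma vol_scons n c c' q : vol n.+1 (scons c q.1, scons c' q.2) = (c' - c) * vol n q.
Proof. by rewrite /vol big_ord_recl. Qed.

Lemma vol_ge0 n q : (forall i, (i < n)%N -> q.1 i < q.2 i) -> 0 <= vol n q.
Proof. by move=> h; apply: prodr_ge0 => i _; rewrite subr_ge0 ltW// h. Qed.

Lemma grid_cover L (c w t : R) : (0 < L)%N -> c <= t <= c + L%:R * w ->
  exists2 j, (j < L)%N & c + j%:R * w <= t <= c + j.+1%:R * w.
Proof.
case: L => // L _; elim: L => [|L IH] /andP[ct tc]; first by exists 0%N; rewrite // mul0r addr0 ct.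
have [tL|/ltW Lt] := leP t (c + L.+1%:R * w).
  have [|j jL h] := IH; first by rewrite ct.
  by exists j => //; exact: ltnW.
by exists L.+1; rewrite // Lt.
Qed.

(** Adjacent closed cells share an endpoint, but those of equal parity are disjoint, so each parity
    class injects into X. Hence the factor 2. *)
Lemma count_cells_le K L (c w : R) (X : set R) (J : pred nat) : 0 < w -> atmost K X ->
  (forall j, J j -> exists2 t, X t & c + j%:R * w <= t <= c + j.+1%:R * w) ->
  (count J (iota 0 L) <= 2 * K)%N.
Proof.
move=> w0 aX hJ.
have half (b : bool) : (count (predI J (fun j => odd j == b)) (iota 0 L) <= K)%N.
  have h j : exists t, J j -> X t /\ c + j%:R * w <= t <= c + j.+1%:R * w.
    by have [/hJ[t]|] := boolP (J j); [exists t | exists 0].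
  have [f fP] := choice h.
  pose s := [seq j <- iota 0 L | J j && (odd j == b)].
  rewrite -size_filter -(size_map f s); apply: aX; last first.
    by move=> _ /mapP[j + ->]; rewrite mem_filter => /andP[/andP[/fP[]]].
  rewrite map_inj_in_uniq ?filter_uniq ?iota_uniq// => i j.
  rewrite !mem_filter => /andP[/andP[/fP[_ fi] /eqP oi] _] /andP[/andP[/fP[_ fj] /eqP oj] _] fij.
  have le i' j' : c + i'%:R * w <= f i -> f i <= c + j'.+1%:R * w -> (i' <= j'.+1)%N.
    move=> h1 h2; have : c + i'%:R * w <= c + j'.+1%:R * w by exact: le_trans h2.
    by rewrite lerD2l ler_pM2r// ler_nat.
  move/andP: fi => [fi1 fi2]; move: fj; rewrite -fij => /andP[fj1 fj2].
  have ij := le _ _ fi1 fj2; have ji := le _ _ fj1 fi2.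
  have oij : odd i = odd j by rewrite oi oj.
  case: (ltngtP i j) => // ltij; exfalso.
    have jE : j = i.+1 by apply/eqP; rewrite eqn_leq ji.
    by move: oij; rewrite jE /=; case: (odd i).
  have iE : i = j.+1 by apply/eqP; rewrite eqn_leq ij.
  by move: oij; rewrite iE /=; case: (odd j).
suff -> : count J (iota 0 L) = (count (predI J (fun j => odd j == true)) (iota 0 L) +
    count (predI J (fun j => odd j == false)) (iota 0 L))%N.
  by rewrite mul2n -addnn leq_add.
by elim: (iota 0 L) => //= j s ->; case: (J j); case: (odd j) => /=; lia.
Qed.

(* Cut the first coordinate into L cells and let E_j be the set of e whose fiber meets the
   j-th cell. The frontiers of the E_j are thin, so by induction most boxes of some grid of
   R^n avoid them; over such a box q every E_j is constant. As no open cell can fill the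
   fibers over all of q, each cell met over q contains a boundary point of one fixed
   fiber: there are at most 2 K of them, independently of L. *)
Theorem thin_grid n P : dfn P -> depends_on n P -> thin n P ->
  forall M eps, 0 < M -> 0 < eps -> exists G : seq (env R * env R),
  [/\ forall q, q \in G -> forall i, (i < n)%N -> q.1 i < q.2 i,
      forall e, (forall i, (i < n)%N -> - M <= e i <= M) -> exists2 q, q \in G & cbox n q e,
      \sum_(q <- G) vol n q = (2 * M) ^+ n &
      \sum_(q <- G) (if `[< meets n P q >] then vol n q else 0) <= eps].
Proof.
elim: n P => [|n IH] P dP nP tP M eps M0 eps0.
  exists [:: (fun=> 0, fun=> 0)]; split => //.
  - by move=> e _; exists (fun=> 0, fun=> 0); rewrite ?mem_head.
  - by rewrite big_seq1 /vol big_ord0 expr0.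
  (* In dimension 0 thinness says that P fails. *)
  - rewrite big_seq1; case: asboolP => [[e _ Pe]|_]; last exact: ltW.
    have [e' _ []] := tP e 1 ltr01; exact: nP Pe.
have [K hK] := bd_fib_atmost omS dP.
pose V := (2 * M) ^+ n.+1; have V0 : 0 < V by rewrite exprn_gt0 ?mulr_gt0.
(* This L brings the contribution of cells with boundary points, 2 K w (2 M)^n = 2 K V / L, down to
   eps / 2. *)
have [L L_pos hL] : exists2 L, (0 < L)%N & 4 * K%:R * V / eps <= L%:R.
  have h0 : 0 <= 4 * K%:R * V / eps.
    by rewrite divr_ge0 ?mulr_ge0 ?ler0n ?ltW.
  exists (Num.bound (4 * K%:R * V / eps)).+1 => //.
  by apply: (le_trans (ltW (archi_boundP h0))); rewrite ler_nat.
pose w := 2 * M / L%:R.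
have L_gt0 : 0 < L%:R :> R by rewrite ltr0n.
have w0 : 0 < w by rewrite divr_gt0 ?mulr_gt0.
have wL : L%:R * w = 2 * M by rewrite /w mulrC divfK ?gt_eqF.
pose c j : R := - M + j%:R * w.
have cS j : c j.+1 = c j + w by rewrite /c -natr1 mulrDl mul1r addrA.
have cD j : c j.+1 - c j = w by rewrite cS addrAC subrr add0r.
have cc j : c j < c j.+1 by rewrite cS ltrDl.
pose E j e := exists t : R, (c j <= t /\ t <= c j.+1) /\ P (scons t e).
pose T j e := forall t : R, c j < t /\ t < c j.+1 -> P (scons t e).
have sc e e' : (forall i, (i < n)%N -> e i = e' i) -> forall t i, (i < n.+1)%N ->
    scons t e i = scons t e' i.
  by move=> ee' t [|i] //=; rewrite ltnS => /ee'.
have dE j : dfn (E j) by rewrite /E; dfn_tac.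
have dT j : dfn (T j) by rewrite /T; dfn_tac.
have nE j : depends_on n (E j).
  by move=> e e' /sc ee' [t [tj Pt]]; exists t; split => //; apply: nP Pt; exact: ee'.
have nT j : depends_on n (T j).
  by move=> e e' /sc ee' h t /h; apply: nP; exact: ee'.
have tT j : thin n (T j).
  move=> a r r0; apply: contrapT => nex.
  have Ta e : box n a r e -> T j e.
    by move=> be; apply: contrapT => nTe; apply: nex; exists e.
  have [|e] := tP (scons (c j + w / 2) a) (Num.min (w / 2) r).
    by rewrite lt_min r0 divr_gt0.
  rewrite -(scons_shift e) => /box_scons /=; rewrite lt_min => -[/andP[h0 _] hs]; apply.
  apply: Ta; first by apply: box_le hs; rewrite ge_min lexx orbT.
  by rewrite cS; move: h0; rewrite ltr_norml => /andP[? ?]; split; lra.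
pose W e := exists2 j, (j < L)%N & frontier n (E j) e.
have dW : dfn W by apply: (dfn_exn omS) => j _; exact: dfn_frontier.
have nW : depends_on n W.
  by move=> e e' ee' [j jL fj]; exists j => //; apply: depends_on_frontier fj.
have tW : thin n W.
  move=> a r r0.
  have [a' [r' [r'0 s h]]] :=
    constants_on_subbox (k := L) (fun j _ => generic_constancy omS (dE j) (nE j)) a r0.
  exists a'; first exact/s/box_center.
  move=> [j jL /(_ r' r'0)[x [bx]]]; apply; have ba : box n a' r' a' by exact: box_center.
  by case: (h j jL) => hj; split => ?; [exact: hj|exact: hj|case: (hj x)|case: (hj a')].
have tTs : thin n (fun e => exists2 j, [set j | (j < L)%N] j & T j e).
  exact: (thin_bigcup omS (finite_II L) (fun j _ => dT j) (fun j _ => nT j) (fun j _ => tT j)).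
(* The columns over boxes meeting W have 2 M times the volume of these boxes, so eps / (4 M) allots
   them eps / 2. *)
have [|G [G1 G2 G3 G4]] := IH W dW nW tW M (eps / (4 * M)) M0; first by rewrite divr_gt0 ?mulr_gt0.
exists [seq (scons (c j) q.1, scons (c j.+1) q.2) | q <- G, j <- iota 0 L]; split.
- move=> _ /allpairsP[[q j] /= [qG _ ->]] [|i] //= lti; exact: G1.
- move=> e he; have [q qG qe] := G2 (shift 1 e) (fun i lti => he i.+1 lti).
  have [|j jL ej] := grid_cover (c := - M) (w := w) (t := e 0%N) L_pos.
    by have := he 0%N isT; rewrite wL => /andP[-> ?]; lra.
  exists (scons (c j) q.1, scons (c j.+1) q.2).
    by apply/allpairsP; exists (q, j); split => //; rewrite mem_iota.
  by rewrite -(scons_shift e); apply/cbox_scons.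
- rewrite big_allpairs_dep /=.
  under eq_bigr => q _.
    under eq_bigr => j _ do rewrite vol_scons cD.
    rewrite big_const_seq count_predT size_iota iter_addr_0 -(mulr_natl (w * vol n q)) mulrA wL.
    over.
  by rewrite -mulr_sumr G3 exprS.
rewrite big_allpairs_dep /=.
have step q : q \in G -> \sum_(j <- iota 0 L)
      (if `[< meets n.+1 P (scons (c j) q.1, scons (c j.+1) q.2) >]
       then vol n.+1 (scons (c j) q.1, scons (c j.+1) q.2) else 0) <=
    2 * M * (if `[< meets n W q >] then vol n q else 0) + (2 * K)%:R * w * vol n q.
  move=> qG; have v0 := vol_ge0 (G1 q qG).
  under eq_bigr do rewrite vol_scons cD.
  rewrite -big_mkcond big_const_seq iter_addr_0 -(mulr_natl (w * vol n q)).
  have wv0 : 0 <= w * vol n q by rewrite mulr_ge0// ltW.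
  case: asboolP => [_|nWq].
    rewrite -wL -mulrA -[leLHS]addr0 lerD ?mulr_ge0 ?ler0n//; last exact: ltW.
    by rewrite ler_wpM2r// ler_nat; apply: leq_trans (count_size _ _) _; rewrite size_iota.
  rewrite mulr0 add0r -mulrA ler_wpM2r// ler_nat.
  (* As r is at most the shortest side, the open box of radius r / 2 about the center lies in q. It
     contains a point x outside every [T j], that is, one whose fiber fills no open cell. *)
  have [r r0 hr] := env_min (fun i lti => etrans (subr_gt0 _ _) (G1 q qG i lti)).
  have [x bx nTx] := tTs (fun i => (q.1 i + q.2 i) / 2) (r / 2) (divr_gt0 r0 (ltr0n _ 2)).
  have qx : cbox n q x.
    move=> i lti; have := bx i lti; have := hr i lti; rewrite ltr_norml => h /andP[? ?].
    by apply/andP; split; lra.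
  have cstE j e : (j < L)%N -> cbox n q e -> E j e -> E j x.
    move=> jL qe; apply: (iffLR (constant_on_cbox (nE j) _ qe qx)) => y qy fy.
    by apply: nWq; exists y => //; exists j.
  rewrite (@eq_in_count _ _ (fun j => (j < L)%N &&
      `[< meets n.+1 P (scons (c j) q.1, scons (c j.+1) q.2) >])); last first.
    by move=> j; rewrite mem_iota => /andP[_ ->].
  apply: (count_cells_le (c := - M) L w0 (hK x)) => j /andP[jL /asboolP[e]].
  rewrite -(scons_shift e) => /cbox_scons[cj qe] Pe.
  have [t [/andP tj Pt]] : E j x.
    by apply: (cstE j _ jL qe); exists (e 0%N); split => //; exact/andP.
  have [u [/andP uj nPu]] : exists u, (c j < u /\ u < c j.+1) /\ ~ P (scons u x).
    apply: contrapT => nu; apply: nTx; exists j => // u uj; apply: contrapT => nPu.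
    by apply: nu; exists u.
  apply: contrapT => nb; apply: nPu; apply/(@bd_free_eq _ (fib P x) t u) => // v.
  rewrite ge_min le_max => /andP[v1 v2] bv; apply: nb; exists v => //.
  move/andP: tj => [t1 t2]; move/andP: uj => [u1 u2]; rewrite -!/(c _).
  by apply/andP; split; [case/orP: v1 => h; lra | case/orP: v2 => h; lra].
apply: (@le_trans _ _ (\sum_(q <- G)
    (2 * M * (if `[< meets n W q >] then vol n q else 0) + (2 * K)%:R * w * vol n q))).
  by rewrite big_seq [leRHS]big_seq; apply: ler_sum => q /step.
rewrite big_split /= -!mulr_sumr G3.
have h1 : 2 * M * \sum_(q <- G) (if `[< meets n W q >] then vol n q else 0) <= eps / 2.
  apply: (le_trans (ler_wpM2l _ G4)); first by rewrite mulr_ge0// ltW.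
  by rewrite le_eqVlt; apply/orP; left; apply/eqP; field; rewrite gt_eqF.
have h2 : (2 * K)%:R * w * (2 * M) ^+ n <= eps / 2.
  have -> : (2 * K)%:R * w * (2 * M) ^+ n = (2 * K%:R * V) / L%:R.
    by rewrite /w /V exprS natrM; field; rewrite gt_eqF.
  rewrite ler_pdivrMr//; move: hL; rewrite ler_pdivrMr//; lra.
by rewrite [leRHS]splitr lerD.
Qed.

End null_sets.

(** * The outer measure defined by coverings with boxes *)

Section lebesgue_null.
Context {R : realType}.
Local Open Scope ereal_scope.

(** Row-major flattening: the rows of a sample matrix become consecutive blocks in the sense of
    [block]. *)
Definition mx_env m n (x : 'M[R]_(m, n)) : env R := fun k =>
  if insub (k %/ n)%N is Some i then
    if insub (k %% n)%N is Some j then x i j else 0%R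
  else 0%R.

Definition env_mx m n (e : env R) : 'M[R]_(m, n) := \matrix_(i, j) e (i * n + j)%N.

Lemma mx_envE m n (x : 'M[R]_(m, n)) (i : 'I_m) (j : 'I_n) : mx_env x (i * n + j)%N = x i j.
Proof.
have n0 : (0 < n)%N by apply: leq_ltn_trans (ltn_ord j).
by rewrite /mx_env divnMDl// divn_small// addn0 valK modnMDl modn_small// valK.
Qed.

Lemma ltn_mx_index m n (i : 'I_m) (j : 'I_n) : (i * n + j < m * n)%N.
Proof. exact: block_lt. Qed.

Lemma mx_index_ex m n k : (k < m * n)%N -> exists i : 'I_m, exists j : 'I_n, k = (i * n + j)%N.
Proof.
move=> kmn; have n0 : (0 < n)%N by move: kmn; case: n => //; rewrite muln0.
have h1 : (k %/ n < m)%N by rewrite ltn_divLR.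
have h2 : (k %% n < n)%N by rewrite ltn_mod.
by exists (Ordinal h1), (Ordinal h2); rewrite -divn_eq.
Qed.

Lemma mbox_vol_ge0 m n (a b : 'M[R]_(m, n)) : (0 <= mbox_vol a b)%R.
Proof. by apply: prodr_ge0 => i _; apply: prodr_ge0 => j _; rewrite le_max lexx. Qed.

Lemma mbox_vol_env m n q : (forall i, (i < m * n)%N -> q.1 i < q.2 i)%R ->
  mbox_vol (env_mx m n q.1) (env_mx m n q.2) = vol (m * n) q.
Proof.
move=> hq; rewrite /vol -(big_mkord xpredT (fun k => q.2 k - q.1 k))%R big_nat_mul big_mkord.
apply: eq_bigr => i _; rewrite -[X in index_iota X]add0n big_addn mulSn addnK big_mkord.
apply: eq_bigr => j _; have lt := ltn_mx_index i j.
by rewrite !mxE (addnC (nat_of_ord j)) max_r// subr_ge0 ltW// hq.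
Qed.

Lemma leb_outer_ge0 m n (A : set 'M[R]_(m, n)) : 0 <= leb_outer A.
Proof.
apply/ereal_infP => _ [I [a [b [_ ->]]]]; apply: nneseries_ge0 => k _ _.
by rewrite lee_fin mbox_vol_ge0.
Qed.

Lemma leb_outer_le m n (A B : set 'M[R]_(m, n)) : A `<=` B -> leb_outer A <= leb_outer B.
Proof.
move=> AB; apply/ereal_infP => s [I [a [b [cB ->]]]]; apply: ge_ereal_inf.
eexists; last exact: lexx.
by exists I, a, b; split => //; exact: subset_trans cB.
Qed.

(** The cubes of radius M + 1 exhaust the space. The part of P in such a cube is covered by the
    boxes of [thin_grid] which meet P, with total volume at most eps / 2 ^ (M + 1); all these boxes
    together form one countable family, indexed by [pickle]. *)
Lemma thin_null (S : forall n : nat, set (set 'rV[R]_n)) m n (P : env R -> Prop)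
    (A : set 'M[R]_(m, n)) : o_minimal S ->
  @dfn R S P -> depends_on (m * n) P -> thin (m * n) P ->
  (forall x, A x -> P (mx_env x)) -> leb_outer A = 0.
Proof.
move=> omS dP nP tP AP; apply/eqP; rewrite eq_le leb_outer_ge0 andbT.
apply/lee_addgt0Pr => eps eps0; rewrite add0e.
have grid (M : nat) : exists H : seq (env R * env R),
  [/\ forall q, q \in H -> forall i, (i < m * n)%N -> (q.1 i < q.2 i)%R,
      forall e, (forall i, (i < m * n)%N -> (- M.+1%:R <= e i <= M.+1%:R)%R) -> P e ->
        exists2 q, q \in H & cbox (m * n) q e &
      (\sum_(q <- H) vol (m * n) q <= eps / (2 ^ M.+1)%:R)%R].
  have [||G [G1 G2 _ G4]] := thin_grid omS dP nP tP (M := M.+1%:R%R) (eps := (eps / (2 ^ M.+1)%:R)%R).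
  - by rewrite ltr0n.
  - by rewrite divr_gt0// ltr0n expn_gt0.
  exists [seq q <- G | `[< meets (m * n) P q >]]; split.
  - by move=> q; rewrite mem_filter => /andP[_]; exact: G1.
  - move=> e /G2[q qG qe] Pe; exists q => //; rewrite mem_filter qG andbT.
    by apply/asboolP; exists e.
  - by rewrite big_filter big_mkcond.
have [H HP] := choice grid.
pose J (M : nat) := `I_(size (H M)).
pose Q := [set: nat] `*`` J.
pose bx k : env R * env R := if unpickle k is Some p then
  nth (fun=> 0%R, fun=> 0%R) (H p.1) p.2 else (fun=> 0%R, fun=> 0%R).
pose I : set nat := [set pickle p | p in Q].
pose v k := (mbox_vol (env_mx m n (bx k).1) (env_mx m n (bx k).2))%:E.
apply: (@le_trans _ _ (\sum_(k <oo | k \in I) v k)).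
  apply: ge_ereal_inf; eexists; last exact: lexx.
  exists I; exists (fun k => env_mx m n (bx k).1).
  exists (fun k => env_mx m n (bx k).2); split => // x /AP Px.
  have [D D0 hD] := env_bounded (m * n) (mx_env x).
  pose M := Num.bound D; have [_ H2 _] := HP M.
  have [|q qH qx] := H2 (mx_env x) _ Px.
    move=> i /hD; rewrite -ler_norml => /le_trans; apply.
    by apply: (le_trans (ltW (archi_boundP (ltW D0)))); rewrite ler_nat.
  exists (pickle (M, index q (H M))).
    by exists (M, index q (H M)) => //; split => //=; rewrite /J /= index_mem.
  move=> i j; rewrite !mxE /bx pickleK /= nth_index//.
  by have := qx _ (ltn_mx_index i j); rewrite mx_envE.
have v0 k : 0 <= v k by rewrite lee_fin mbox_vol_ge0.
rewrite nneseries_esum//; rewrite (_ : [set x | x \in I] = I); last first.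
  by apply/seteqP; split => k /=; rewrite inE.
rewrite (@reindex_esum _ _ _ Q _ pickle); last first.
  split => [p Qp|p p' _ _ /(pcan_inj pickleK) //|k //].
  by exists p.
rewrite /Q -(esum_esum (a := fun i j => v (pickle (i, j)))); last by move=> *; exact: v0.
rewrite -(nneseries_esumT (a := fun M => \esum_(j in J M) v (pickle (M, j)))); last first.
  by move=> M; apply: esum_ge0 => *; exact: v0.
apply: (le_trans _ (epsilon_trick0 xpredT (ltW eps0))).
apply: lee_nneseries => [M _ _|M _]; first by apply: esum_ge0 => *; exact: v0.
have [H1 _ H3] := HP M; rewrite esum_fset; [|exact: finite_II|by move=> *; exact: v0].
rewrite -fsbig_ord; apply: le_trans (_ : (\sum_(q <- H M) vol (m * n) q)%:E <= _); last by rewrite lee_fin.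
rewrite (big_nth (fun=> 0%R, fun=> 0%R)) big_mkord -sumEFin.
rewrite le_eqVlt; apply/orP; left; apply/eqP; apply: eq_bigr => i _.
rewrite /v /bx pickleK /= mbox_vol_env// => l lt; apply: H1 => //; exact: mem_nth.
Qed.

End lebesgue_null.

(** * Functions approximated at a geometric rate *)

Section polynomial_norm.
Context {R : realType}.
Implicit Types (p q a : {poly R}) (r s t : R).

Definition absp p : {poly R} := map_poly (fun x => `|x|) p.
(** The l1 norm of the coefficients with weights r ^ i. It is submultiplicative and dominates p on
    [-r, r], which gives control of compositions. *)
Definition pnorm r p : R := (absp p).[r].

Lemma coef_absp p i : (absp p)`_i = `|p`_i|.
Proof. by rewrite coef_map_id0// normr0. Qed.

Lemma horner_le p q r : 0 <= r -> (forall i, p`_i <= q`_i) -> p.[r] <= q.[r].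
Proof.
move=> r0 pq; rewrite (horner_coef_wide r (leq_maxl (size p) (size q))).
rewrite (horner_coef_wide r (leq_maxr (size p) (size q))).
by apply: ler_sum => i _; rewrite ler_wpM2r// exprn_ge0.
Qed.

Lemma pnorm_ge0 r p : 0 <= r -> 0 <= pnorm r p.
Proof.
by move=> r0; rewrite -(horner0 r); apply: horner_le => // i; rewrite coef0 coef_absp.
Qed.

Lemma pnormC r c : pnorm r c%:P = `|c|.
Proof.
rewrite /pnorm (_ : absp c%:P = (`|c|)%:P) ?hornerC//.
by apply/polyP => i; rewrite coef_absp !coefC; case: ifP => // _; rewrite normr0.
Qed.

Lemma pnormD r p q : 0 <= r -> pnorm r (p + q) <= pnorm r p + pnorm r q.
Proof.
move=> r0; rewrite /pnorm -hornerD; apply: horner_le => // i.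
by rewrite coefD !coef_absp coefD ler_normD.
Qed.

Lemma pnormZ r c p : pnorm r (c *: p) = `|c| * pnorm r p.
Proof.
rewrite /pnorm -hornerZ; congr (_.[_]); apply/polyP => i.
by rewrite coefZ !coef_absp coefZ normrM.
Qed.

Lemma pnormM r p q : 0 <= r -> pnorm r (p * q) <= pnorm r p * pnorm r q.
Proof.
move=> r0; rewrite /pnorm -hornerM; apply: horner_le => // i.
rewrite coef_absp !coefM; apply: (le_trans (ler_norm_sum _ _ _)).
by apply: ler_sum => j _; rewrite normrM !coef_absp.
Qed.

Lemma pnormX r p n : 0 <= r -> pnorm r (p ^+ n) <= pnorm r p ^+ n.
Proof.
move=> r0; elim: n => [|n IH]; first by rewrite !expr0 -[1]/(1%:P) pnormC normr1.
rewrite !exprS; apply: (le_trans (pnormM _ _ r0)).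
by rewrite ler_wpM2l// pnorm_ge0.
Qed.

Lemma pnorm_sum r (I : Type) (l : seq I) (P : I -> {poly R}) : 0 <= r ->
  pnorm r (\sum_(i <- l) P i) <= \sum_(i <- l) pnorm r (P i).
Proof.
move=> r0; elim: l => [|i l IH].
  by rewrite !big_nil -[0]/(0%:P) pnormC normr0.
by rewrite !big_cons; apply: (le_trans (pnormD _ _ r0)); rewrite lerD2l.
Qed.

Lemma pnormE r p : pnorm r p = \sum_(i < size p) `|p`_i| * r ^+ i.
Proof.
have sp : (size (absp p) <= size p)%N by exact: size_poly.
by rewrite /pnorm (horner_coef_wide r sp); apply: eq_bigr => i _; rewrite coef_absp.
Qed.

Lemma pnorm_le r s p : 0 <= r -> r <= s -> pnorm r p <= pnorm s p.
Proof.
move=> r0 rs; rewrite !pnormE; apply: ler_sum => i _.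
by rewrite ler_wpM2l//; apply: lerXn2r; rewrite ?nnegrE// (le_trans r0).
Qed.

(** A Schwarz lemma: in the absence of a constant term every weight shrinks at least by the factor r
    / s. *)
Lemma pnorm_scale r s p : p.[0] = 0 -> 0 <= r -> 0 < s -> r <= s ->
  pnorm r p <= r / s * pnorm s p.
Proof.
move=> p0 r0 s0 rs; rewrite !pnormE mulr_sumr; apply: ler_sum => -[[|i] /= lti] _.
  by rewrite -horner_coef0 p0 normr0 !mul0r mulr0.
rewrite mulrCA ler_wpM2l// !exprS mulrA divfK ?gt_eqF// ler_wpM2l//.
by apply: lerXn2r; rewrite ?nnegrE// ltW.
Qed.

Lemma horner_pnorm r p t : `|t| <= r -> `|p.[t]| <= pnorm r p.
Proof.
move=> tr; rewrite horner_coef pnormE; apply: (le_trans (ler_norm_sum _ _ _)).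
apply: ler_sum => i _; rewrite normrM normrX ler_wpM2l//.
by apply: lerXn2r; rewrite ?nnegrE// (le_trans _ tr).
Qed.

Lemma pnorm_comp r s p q : 0 <= r -> pnorm r q <= s -> pnorm r (p \Po q) <= pnorm s p.
Proof.
move=> r0 qs; rewrite comp_polyE [pnorm s p]pnormE.
have h := pnorm_sum (index_enum 'I_(size p)) (fun i => p`_i *: q ^+ i) r0.
apply: (le_trans h).
apply: ler_sum => i _; rewrite pnormZ ler_wpM2l//; apply: (le_trans (pnormX _ _ r0)).
have q0 := pnorm_ge0 q r0.
by apply: lerXn2r; rewrite ?nnegrE// (le_trans q0).
Qed.

Lemma pnorm_take r p n : 0 <= r -> pnorm r (take_poly n p) <= pnorm r p.
Proof.
move=> r0; apply: horner_le => // i; rewrite !coef_absp coef_take_poly.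
by case: ifP => // _; rewrite normr0.
Qed.

Lemma take_poly_error r p n t : 0 < r -> `|t| <= r ->
  `|p.[t] - (take_poly n p).[t]| <= pnorm r p * (`|t| / r) ^+ n.
Proof.
move=> r0 tr; rewrite -{1}(poly_take_drop n p) hornerD addrAC subrr add0r.
rewrite hornerM hornerXn normrM normrX expr_div_n mulrA ler_pdivlMr ?exprn_gt0//.
rewrite -mulrA mulrC -mulrA mulrC ler_wpM2r ?exprn_ge0//.
have : pnorm r (drop_poly n p) * r ^+ n <= pnorm r p.
  rewrite /pnorm -hornerXn -hornerM; apply: horner_le => [|i]; first exact: ltW.
  rewrite coefMXn !coef_absp; case: ltnP => // ni.
  by rewrite coef_drop_poly subnK.
apply: le_trans; rewrite mulrC ler_wpM2r ?exprn_ge0 ?(ltW r0)//.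
exact: horner_pnorm.
Qed.

(** Halving the radius absorbs the factor i in the derivative of X^i, so that the constant involves
    only [pnorm r p]. *)
Lemma horner_lipschitz r p s t : 0 < r -> `|s| <= r / 2 -> `|t| <= r / 2 ->
  `|p.[s] - p.[t]| <= 2 / r * pnorm r p * `|s - t|.
Proof.
move=> r0 sr tr; have X i : `|s ^+ i - t ^+ i| <= 2 / r * r ^+ i * `|s - t|.
  elim: i => [|i IH].
    by rewrite !expr0 subrr normr0 !mulr_ge0 ?invr_ge0// ltW.
  have -> : s ^+ i.+1 - t ^+ i.+1 = s * (s ^+ i - t ^+ i) + (s - t) * t ^+ i.
    by rewrite !exprS; ring.
  apply: (le_trans (ler_normD _ _)); rewrite !normrM.
  have ti : `|t ^+ i| <= r ^+ i.
    rewrite normrX; apply: lerXn2r; rewrite ?nnegrE ?(ltW r0)//.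
    by apply: (le_trans tr); rewrite ler_pdivrMr// ler_pMr// ler1n.
  have -> : 2 / r * r ^+ i.+1 * `|s - t| =
      r / 2 * (2 / r * r ^+ i * `|s - t|) + `|s - t| * r ^+ i.
    by rewrite exprS; field; rewrite gt_eqF.
  apply: lerD; last by rewrite ler_wpM2l.
  by apply: ler_pM.
rewrite !horner_coef -sumrB pnormE mulr_sumr mulr_suml.
apply: (le_trans (ler_norm_sum _ _ _)); apply: ler_sum => i _.
rewrite -mulrBr normrM; apply: (le_trans (ler_wpM2l (normr_ge0 _) (X i))).
by rewrite le_eqVlt; apply/orP; left; apply/eqP; ring.
Qed.

(** The constant coefficient is O(t), hence zero; dividing by X lowers m by one. *)
Lemma coef_eq0_of_small p m C eps : 0 < eps ->
  (forall t, 0 < t < eps -> `|p.[t]| <= C * t ^+ m) -> forall i, (i < m)%N -> p`_i = 0.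
Proof.
elim: m p eps => // m IH p eps eps0 h.
have pE t : p.[t] = p`_0 + t * (drop_poly 1 p).[t].
  rewrite -{1}(poly_take_drop 1 p) hornerD hornerM hornerXn mulrC; congr (_ + _).
  rewrite (_ : take_poly 1 p = (p`_0)%:P) ?hornerC//.
  by apply/polyP => -[|i]; rewrite coef_take_poly coefC.
pose D := `|C| + pnorm 1 (drop_poly 1 p).
have D0 : 0 <= D by rewrite addr_ge0 ?normr_ge0 ?pnorm_ge0.
have p0 : p`_0 = 0.
  apply/eqP; rewrite -normr_eq0; apply: contraT => p0.
  have {}p0 : 0 < `|p`_0| by rewrite lt_neqAle eq_sym p0 normr_ge0.
  pose t := Num.min (Num.min (eps / 2) 1) (`|p`_0| / (2 * (D + 1))).
  have D1 : 0 < D + 1 by rewrite ltr_wpDl.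
  have t0 : 0 < t by rewrite !lt_min !divr_gt0 ?mulr_gt0 ?ltr01.
  have te : t < eps.
    apply: (@le_lt_trans _ _ (eps / 2)); first by rewrite !ge_min lexx.
    by rewrite ltr_pdivrMr// ltr_pMr// ltr1n.
  have t1 : t <= 1 by rewrite !ge_min lexx orbT.
  have tp : t <= `|p`_0| / (2 * (D + 1)) by rewrite !ge_min lexx !orbT.
  have : `|p`_0| <= D * t.
    have -> : p`_0 = p.[t] - t * (drop_poly 1 p).[t] by rewrite pE addrK.
    apply: (le_trans (ler_normB _ _)); rewrite mulrDl; apply: lerD.
      apply: (le_trans (h t _)); first by rewrite t0.
      apply: (@le_trans _ _ (`|C| * t ^+ m.+1)).
        by rewrite ler_wpM2r ?exprn_ge0 ?(ltW t0)// ler_norm.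
      by rewrite ler_wpM2l// exprS ler_piMr ?(ltW t0)// exprn_ile1// ltW.
    rewrite normrM gtr0_norm// mulrC ler_wpM2r ?(ltW t0)//; apply: horner_pnorm.
    by rewrite gtr0_norm.
  rewrite ler_pdivlMr ?mulr_gt0// in tp; nra.
move=> [|i] // lti; have := IH (drop_poly 1 p) eps eps0; rewrite -[i.+1]addn1 -coef_drop_poly.
apply => // t tlt; have /andP[t0 _] := tlt.
have := h t tlt; rewrite pE p0 add0r normrM gtr0_norm// exprS mulrCA.
by rewrite ler_pM2l.
Qed.

(** A growth bound at infinity becomes an order of vanishing at 0 for the reversed polynomial t^N
    p(1/t). *)
Lemma coef_eq0_of_growth p D C : (forall t, 1 <= t -> `|p.[t]| <= C * t ^+ D) ->
  forall i, (D < i)%N -> p`_i = 0.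
Proof.
move=> h i Di; have [ip|pi] := ltnP i (size p); last by rewrite nth_default.
pose N := (size p).-1; have Np : size p = N.+1 by rewrite prednK// (leq_ltn_trans _ ip).
pose q := \poly_(k < N.+1) p`_(N - k).
have qE t : 0 < t -> q.[t] = t ^+ N * p.[t^-1].
  move=> t0; rewrite horner_poly horner_coef Np mulr_sumr (reindex_inj rev_ord_inj) /=.
  apply: eq_bigr => k _; rewrite subSS subKn -1?ltnS// mulrCA; congr (_ * _).
  have -> : t ^+ N = t ^+ (N - k) * t ^+ k by rewrite -exprD subnK// -ltnS.
  by rewrite exprVn mulfK// expf_neq0// gt_eqF.
have := @coef_eq0_of_small q (N - D) C 1 ltr01 _ (N - i)%N.
rewrite Np ltnS in ip.
rewrite coef_poly ltnS leq_subr subKn//; apply.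
  move=> t /andP[t0 t1]; rewrite qE// normrM (gtr0_norm (exprn_gt0 _ t0)).
  apply: (le_trans (ler_wpM2l (exprn_ge0 _ (ltW t0)) (h _ _))).
    by rewrite invf_ge1// ltW.
  have -> : t ^+ N = t ^+ (N - D) * t ^+ D.
    by rewrite -exprD subnK// (leq_trans (ltnW Di)).
  by rewrite mulrCA exprVn mulfK// expf_neq0// gt_eqF.
by rewrite ltn_sub2l// (leq_trans Di).
Qed.

End polynomial_norm.

Section geometric_approximation.
Context {R : realType}.
Implicit Types (f g u h psi : R -> R) (p q a : {poly R}) (r s t : R).

(* Equivalent to analyticity of f at t0. The degree n approximants need not be compatible
   with one another, so closure under composition requires no rearrangement of series. *)
Definition geo f t0 : Prop := exists r, exists B, 0 < r /\ forall n, exists p,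
  [/\ (size p <= n.+1)%N, pnorm r p <= B &
      forall t, `|t| <= r -> `|f (t0 + t) - p.[t]| <= B * (`|t| / r) ^+ n.+1].

Lemma geo_bound_ge0 r B p : 0 < r -> pnorm r p <= B -> 0 <= B.
Proof. by move=> r0; apply: le_trans; rewrite pnorm_ge0// ltW. Qed.

Lemma geo_shrink f t0 r B r' B' : 0 < r' -> r' <= r -> B <= B' ->
  (forall n, exists p, [/\ (size p <= n.+1)%N, pnorm r p <= B &
      forall t, `|t| <= r -> `|f (t0 + t) - p.[t]| <= B * (`|t| / r) ^+ n.+1]) ->
  (forall n, exists p, [/\ (size p <= n.+1)%N, pnorm r' p <= B' &
      forall t, `|t| <= r' -> `|f (t0 + t) - p.[t]| <= B' * (`|t| / r') ^+ n.+1]).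
Proof.
move=> r'0 r'r BB' h n; have [p [sp np hp]] := h n; exists p; split => //.
  by apply: (le_trans (pnorm_le _ (ltW r'0) r'r)); exact: le_trans BB'.
have r0 : 0 < r by exact: lt_le_trans r'r.
have B0 := geo_bound_ge0 r0 np.
move=> t tr; apply: (le_trans (hp t (le_trans tr r'r))); apply: ler_pM => //.
  by rewrite exprn_ge0// divr_ge0// ltW.
apply: lerXn2r; rewrite ?nnegrE ?divr_ge0 ?(ltW r0) ?(ltW r'0)//.
by rewrite ler_wpM2l// lef_pV2.
Qed.

Lemma geo_const c t0 : geo (fun=> c) t0.
Proof.
exists 1, `|c|; split => // n; exists c%:P; rewrite pnormC; split => //.
  by rewrite size_polyC; case: (c == 0).
by move=> t _; rewrite hornerC subrr normr0 mulr_ge0// exprn_ge0// divr_ge0.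
Qed.

Lemma geo_poly p t0 : geo (fun t => p.[t]) t0.
Proof.
pose q := p \Po ('X + t0%:P); exists 1, (pnorm 1 q); split => // n.
exists (take_poly n.+1 q); split; [exact: size_take_poly | exact: pnorm_take |].
move=> t t1; have -> : p.[t0 + t] = q.[t].
  by rewrite horner_comp hornerD hornerX hornerC addrC.
exact: take_poly_error.
Qed.

Lemma geo_scale c f t0 : geo f t0 -> geo (fun t => c * f t) t0.
Proof.
move=> [r [B [r0 h]]]; exists r, (`|c| * B); split => // n.
have [p [sp np hp]] := h n; exists (c *: p); split.
- by rewrite (leq_trans (size_scale_leq _ _)).
- by rewrite pnormZ ler_wpM2l.
- by move=> t tr; rewrite hornerZ -mulrBr normrM -mulrA ler_wpM2l// hp.
Qed.

Lemma geo_add f g t0 : geo f t0 -> geo g t0 -> geo (fun t => f t + g t) t0.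
Proof.
move=> [r [B [r0 h]]] [r' [B' [r'0 h']]]; pose s := Num.min r r'.
have s0 : 0 < s by rewrite lt_min r0.
have sr : s <= r by rewrite ge_min lexx.
have sr' : s <= r' by rewrite ge_min lexx orbT.
exists s, (B + B'); split => // n.
have [p [sp np hp]] := geo_shrink s0 sr (lexx B) h n.
have [p' [sp' np' hp']] := geo_shrink s0 sr' (lexx B') h' n.
exists (p + p'); split.
- by rewrite (leq_trans (size_polyD _ _))// geq_max sp.
- by apply: (le_trans (pnormD _ _ (ltW s0))); exact: lerD.
- move=> t ts; rewrite hornerD opprD addrACA mulrDl; apply: (le_trans (ler_normD _ _)).
  by rewrite lerD ?hp ?hp'.
Qed.

Lemma geo_sum (I : Type) (l : seq I) (f : I -> R -> R) t0 : (forall i, geo (f i) t0) ->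
  geo (fun t => \sum_(i <- l) f i t) t0.
Proof.
move=> gf; elim: l => [|i l IH].
  by under eq_fun do rewrite big_nil; exact: geo_const.
by under eq_fun do rewrite big_cons; exact: geo_add.
Qed.

(* With P the approximant of psi at u t0 and q that of u minus its value at t0, the
   approximant of the composite is the truncation of P \Po q. *)
Lemma geo_comp psi u t0 : geo psi (u t0) -> geo u t0 -> geo (psi \o u) t0.
Proof.
move=> [s [A [s0 hA]]] [r [B0 [r0 hB0]]].
pose B := Num.max B0 1; have B1 : 1 <= B by rewrite le_max lexx orbT.
have Bp : 0 < B by exact: lt_le_trans B1.
have {hB0}hB := geo_shrink r0 (lexx r) (_ : B0 <= B) hB0.
have {}hB := hB (ltac:(by rewrite le_max lexx)).
(* The factor 8 leaves room for |v| <= 3 B x <= s / 2, as [horner_lipschitz] requires. *)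
pose r' := Num.min r (r * s / (8 * B)).
have r'0 : 0 < r' by rewrite lt_min r0 divr_gt0 ?mulr_gt0.
have r'r : r' <= r by rewrite ge_min lexx.
have r's : r' <= r * s / (8 * B) by rewrite ge_min lexx orbT.
have Br' : 8 * B * (r' / r) <= s.
  rewrite mulrA ler_pdivrMr//; move: r's; rewrite ler_pdivlMr ?mulr_gt0//; lra.
have A0 : 0 <= A by have [p [_ np _]] := hA 0%N; exact: geo_bound_ge0 np.
have C0 : 0 <= 2 / s * A * B by rewrite !mulr_ge0 ?invr_ge0 ?ler0n ?(ltW s0) ?(ltW Bp).
(* The three summands bound the error of P, the error of Q transported through P, and the truncation
   error. *)
exists r', (A + (2 / s * A * B) + A); split => // n.
have [P [sP nP hP]] := hA n; have [Q [sQ nQ hQ]] := hB n.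
have Q0 : Q.[0] = u t0.
  have := hQ 0; rewrite normr0 (ltW r0) => /(_ isT).
  by rewrite mul0r exprS mul0r mulr0 normr_le0 subr_eq0 addr0 => /eqP ->.
pose q := Q - (u t0)%:P.
have q0 : q.[0] = 0 by rewrite hornerD hornerN hornerC Q0 subrr.
have nq : pnorm r q <= 2 * B.
  apply: (le_trans (pnormD _ _ (ltW r0))); rewrite -polyCN pnormC normrN -Q0 mulr2n mulrDl mul1r.
  by apply: lerD => //; apply: (le_trans _ nQ); apply: horner_pnorm; rewrite normr0 ltW.
have nq' t : `|t| <= r -> `|q.[t]| <= 2 * B * (`|t| / r).
  move=> tr; apply: (le_trans (horner_pnorm q (lexx _))).
  apply: (le_trans (pnorm_scale q0 (normr_ge0 _) r0 tr)).
  by rewrite mulrC ler_wpM2r// divr_ge0// ltW.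
have nqr' : pnorm r' q <= s.
  apply: (le_trans (pnorm_scale q0 (ltW r'0) r0 r'r)).
  apply: (le_trans (ler_wpM2l _ nq)); first by rewrite divr_ge0 ?ltW.
  by apply: le_trans Br'; rewrite mulrC ler_wpM2r ?divr_ge0 ?ltW//; lra.
exists (take_poly n.+1 (P \Po q)); split; first exact: size_take_poly.
  apply: (le_trans (pnorm_take _ _ (ltW r'0))).
  apply: (le_trans (pnorm_comp _ (ltW r'0) nqr')); apply: (le_trans nP).
  by rewrite -addrA lerDl addr_ge0.
move=> t tr'; have tr := le_trans tr' r'r.
pose x := `|t| / r; pose x' := `|t| / r'.
have x0 : 0 <= x by rewrite divr_ge0// ltW.
have xx' : x <= x' by rewrite ler_wpM2l// lef_pV2.
have x'1 : x' <= 1 by rewrite ler_pdivrMr// mul1r.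
have x'0 : 0 <= x' by exact: le_trans xx'.
have xr' : x = r' / r * x' by rewrite /x /x'; field; rewrite !gt_eqF.
have Bxs : 8 * B * x <= s * x'.
  by rewrite xr' mulrA; apply: ler_wpM2r.
have x1 : x <= 1 by exact: le_trans xx' x'1.
pose v := u (t0 + t) - u t0.
have vq : `|v - q.[t]| <= B * x ^+ n.+1.
  rewrite (_ : v - q.[t] = u (t0 + t) - Q.[t]); first exact: hQ.
  by rewrite /v hornerD hornerN hornerC; ring.
have qx : `|q.[t]| <= 2 * B * x by exact: nq'.
have vx : `|v| <= 3 * B * x.
  rewrite (_ : v = (v - q.[t]) + q.[t]); last by rewrite subrK.
  apply: (le_trans (ler_normD _ _)).
  have : B * x ^+ n.+1 <= B * x.
    by rewrite ler_wpM2l ?(ltW Bp)// exprS ler_piMr// exprn_ile1.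
  by move=> ?; lra.
have Bx0 : 0 <= B * x by rewrite mulr_ge0// ltW.
have vs : `|v| <= s / 2.
  have : s * x' <= s * 1 by rewrite ler_wpM2l// ltW.
  by move=> ?; lra.
have qs : `|q.[t]| <= s / 2.
  have : s * x' <= s * 1 by rewrite ler_wpM2l// ltW.
  by move=> ?; lra.
have e1 : `|psi (u (t0 + t)) - P.[v]| <= A * x' ^+ n.+1.
  have -> : u (t0 + t) = u t0 + v by rewrite /v [RHS]addrC subrK.
  apply: (le_trans (hP v _)); first by lra.
  rewrite ler_wpM2l//; apply: lerXn2r; rewrite ?nnegrE// ?divr_ge0 ?(ltW s0)//.
  by rewrite ler_pdivrMr//; lra.
have e2 : `|P.[v] - P.[q.[t]]| <= 2 / s * A * B * x' ^+ n.+1.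
  apply: (le_trans (horner_lipschitz P s0 vs qs)).
  rewrite -[leRHS]mulrA; apply: ler_pM => //.
  - by rewrite !mulr_ge0 ?invr_ge0 ?ler0n ?pnorm_ge0 ?(ltW s0).
  - by rewrite ler_wpM2l// mulr_ge0 ?invr_ge0 ?ler0n ?(ltW s0).
  - apply: (le_trans vq); rewrite ler_wpM2l ?(ltW Bp)//.
    by apply: lerXn2r; rewrite ?nnegrE.
have e3 : `|(P \Po q).[t] - (take_poly n.+1 (P \Po q)).[t]| <= A * x' ^+ n.+1.
  apply: (le_trans (take_poly_error _ _ r'0 tr')).
  rewrite ler_wpM2r ?exprn_ge0//.
  by apply: (le_trans (pnorm_comp _ (ltW r'0) nqr')).
rewrite /= horner_comp in e3 *.
rewrite (_ : psi _ - _ = (psi (u (t0 + t)) - P.[v]) + (P.[v] - P.[q.[t]]) +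
  (P.[q.[t]] - (take_poly n.+1 (P \Po q)).[t])); last by ring.
rewrite [(A + _ + A) * _]mulrDl [(A + _) * _]mulrDl; apply: (le_trans (ler_normD _ _)); rewrite lerD//.
by apply: (le_trans (ler_normD _ _)); rewrite lerD.
Qed.

(* A polynomial of degree at most n which is O(t^(n+1)) vanishes. *)
Lemma geo_zero_right f t0 : geo f t0 ->
  (exists2 eps, 0 < eps & forall t, 0 < t < eps -> f (t0 + t) = 0) ->
  exists2 eps, 0 < eps & forall t, `|t - t0| < eps -> f t = 0.
Proof.
move=> [r [B [r0 h]]] [eps eps0 f0]; exists (r / 2); first by rewrite divr_gt0.
have B0 : 0 <= B by have [p [_ np _]] := h 0%N; exact: geo_bound_ge0 np.
move=> t tt0; pose s := t - t0.
(* Every approximant vanishes, so only the error term is left; on half the radius it decays like 2 ^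
   (-n). *)
have {h}h n : `|f t| <= B * (1 / 2) ^+ n.
  have [p [sp _ hp]] := h n.
  have p0 : p = 0.
    apply/polyP => i; rewrite coef0; have [lti|lei] := ltnP i n.+1; last first.
      by rewrite nth_default// (leq_trans sp).
    apply: (@coef_eq0_of_small _ p n.+1 (B / r ^+ n.+1) (Num.min eps r)) => //.
      by rewrite lt_min eps0.
    move=> u /andP[u0]; rewrite lt_min => /andP[ue ur].
    have := hp u; rewrite gtr0_norm// (ltW ur) f0 ?u0// sub0r normrN => /(_ isT).
    by rewrite expr_div_n mulrCA mulrC -mulrA [_^-1 * _]mulrC.
  have sr : `|s| <= r / 2 by exact: ltW.
  have st : t0 + s = t by rewrite /s addrC subrK.
  have sr' : `|s| <= r by lra.
  have := hp s sr'; rewrite st p0 horner0 subr0 => /le_trans; apply.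
  rewrite ler_wpM2l//; apply: (@le_trans _ _ ((1 / 2) ^+ n.+1)).
    apply: lerXn2r; rewrite ?nnegrE ?divr_ge0 ?(ltW r0)//.
    by rewrite ler_pdivrMr// mul1r mulrC.
  by rewrite exprS ler_piMl ?exprn_ge0// mul1r invf_le1// ler1n.
apply/eqP; rewrite -normr_eq0; apply: contraT => ft.
have {}ft : 0 < `|f t| by rewrite lt_neqAle eq_sym ft normr_ge0.
pose n := Num.bound (B / `|f t|).
have hn : B < n%:R * `|f t|.
  by rewrite -ltr_pdivrMr//; apply: archi_boundP; rewrite divr_ge0.
have n2 : n%:R <= 2 ^+ n :> R by rewrite -natrX ler_nat ltnW// ltn_expl.
have := h n; rewrite expr_div_n expr1n mul1r ler_pdivlMr ?exprn_gt0// => h2.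
have : `|f t| * n%:R <= `|f t| * 2 ^+ n by rewrite ler_pM2l.
by rewrite mulrC => h3; have := lt_le_trans hn (le_trans h3 h2); rewrite ltxx.
Qed.

Lemma geo_reflect f t0 : geo f (- t0) -> geo (fun t => f (- t)) t0.
Proof.
move=> gf; apply: (@geo_comp f (fun t => - t)) => //.
rewrite (_ : (fun t => - t) = (fun t => (- 'X).[t])); first exact: geo_poly.
by apply/funext => t; rewrite hornerN hornerX.
Qed.

Definition zero_near f t := exists2 eps, 0 < eps & forall s, `|s - t| < eps -> f s = 0.

(** Vanishing propagates by real induction: to the right it is open by definition, and at a limit
    from the left [geo_zero_right] applies to the reflected function. *)
Lemma geo_zero_ge f (a b : R) : (forall t, geo f t) -> a <= b -> zero_near f a -> zero_near f b.
Proof.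
move=> gf ab za; suff h t : a <= t <= b -> zero_near f t by apply: h; rewrite ab lexx.
move: t; apply: real_induction => //.
- move=> t /andP[at_ _] /(_ t); rewrite at_ lexx => /(_ isT)[e e0 h].
  exists e => // u /andP[tu ut]; exists (t + e - u); first by rewrite subr_gt0.
  move=> s su; apply: h; move: su; rewrite !ltr_norml => /andP[? ?].
  by apply/andP; split; lra.
- move=> t /andP[at_ _] h; have zf s : a <= s < t -> f s = 0.
    by move=> /h[e e0]; apply; rewrite subrr normr0.
  have [||e e0 he] := @geo_zero_right (fun s => f (- s)) (- t).
  + by apply: geo_reflect; rewrite opprK.
  + exists (t - a); first by rewrite subr_gt0.
    by move=> s /andP[s0 st]; rewrite opprD opprK; apply: zf; apply/andP; split; lra.
  exists e => // s st; rewrite -[s]opprK; apply: he.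
  by rewrite -opprD normrN.
Qed.

Theorem geo_identity f (a b : R) : (forall t, geo f t) -> zero_near f a -> f b = 0.
Proof.
move=> gf za; suff [e e0] : zero_near f b by apply; rewrite subrr normr0.
have [ab|/ltW ba] := leP a b; first exact: geo_zero_ge za.
have zr g t : zero_near g t -> zero_near (fun s => g (- s)) (- t).
  move=> [e e0 h]; exists e => // s st; apply: h.
  by rewrite -normrN opprD opprK.
have zb : zero_near (fun u : R => f (- u)) (- b).
  apply: (@geo_zero_ge _ (- a)); [|by rewrite lerN2|exact: zr].
  by move=> t; exact: geo_reflect.
have := zr _ _ zb; rewrite opprK; congr (zero_near _ _).
by apply/funext => s; rewrite opprK.
Qed.

Lemma geo_bounded f t0 : geo f t0 ->
  exists2 r, 0 < r & exists B, forall t, `|t - t0| < r -> `|f t| <= B.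
Proof.
move=> [r [B [r0 h]]]; exists r => //; exists (B + B) => t tr.
have [p [_ np hp]] := h 0%N; have := hp (t - t0) (ltW tr).
have B0 := geo_bound_ge0 r0 np.
have st : t0 + (t - t0) = t by rewrite addrC subrK.
rewrite expr1 st => h1; rewrite -(subrK p.[t - t0] (f t)).
apply: (le_trans (ler_normD _ _)); apply: lerD; last first.
  by apply: le_trans np; apply: horner_pnorm; exact: ltW.
by apply: (le_trans h1); rewrite ler_piMr// ler_pdivrMr// mul1r ltW.
Qed.

Lemma geo_bounded_itv f (a b : R) : (forall t, geo f t) -> a <= b ->
  exists B, forall t, a <= t <= b -> `|f t| <= B.
Proof.
move=> gf ab; suff h t : a <= t <= b -> exists B, forall s, a <= s <= t -> `|f s| <= B.
  by apply: h; rewrite ab lexx.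
move: t; apply: real_induction => //.
- by exists `|f a| => s /andP[h1 h2]; rewrite (_ : s = a)//; apply/eqP; rewrite eq_le h1 h2.
- move=> t /andP[at_ _] /(_ t); rewrite at_ lexx => /(_ isT)[B hB].
  have [r r0 [B' hB']] := geo_bounded (gf t); exists r => // u /andP[tu ut].
  exists (Num.max B B') => s /andP[as_ su]; rewrite le_max.
  have [st|ts] := leP s t; first by rewrite hB// as_.
  by rewrite (hB' s) ?orbT// ltr_norml; apply/andP; split; lra.
- move=> t /andP[at_ _] h; have [r r0 [B' hB']] := geo_bounded (gf t).
  pose v := Num.max a (t - r / 2); have vt : v < t.
    by rewrite gt_max at_ ltrBlDr ltrDl divr_gt0.
  have [|B hB] := h v; first by rewrite vt le_max lexx.
  exists (Num.max B B') => s /andP[as_ su]; rewrite le_max.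
  have [sv|vs] := leP s v; first by rewrite hB// as_.
  rewrite (hB' s) ?orbT// ltr_norml; apply/andP; split; last by lra.
  have : t - r / 2 <= v by rewrite le_max lexx orbT.
  by move=> ?; lra.
Qed.

End geometric_approximation.

(** * Activation functions: analyticity and linear growth *)

Section activation.
Context {R : realType}.
Implicit Types (psi : R -> R).

Lemma geometric_sum_le2 (x : R) m : 0 <= x <= 1 / 2 -> \sum_(i < m) x ^+ i <= 2.
Proof.
move=> /andP[x0 x2]; elim: m => [|m IH]; first by rewrite big_ord0.
rewrite big_ord_recl expr0; under eq_bigr do rewrite exprS.
rewrite -mulr_sumr; have s0 : 0 <= \sum_(i < m) x ^+ i.
  by apply: sumr_ge0 => i _; rewrite exprn_ge0.
by nra.
Qed.

Lemma limit_dist_le (u : nat -> R) (l c K : R) n0 : u @ \oo --> l ->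
  (forall n, (n0 <= n)%N -> `|u n - c| <= K) -> `|l - c| <= K.
Proof.
move=> ul h; apply/ler_addgt0Pr => e e0.
move/cvgrPdist_lt/(_ e e0): ul => [N _ hN].
have := hN (maxn N n0) (leq_maxl _ _) => /= h1.
rewrite -(subrK (u (maxn N n0)) l) -addrA addrC; apply: (le_trans (ler_normD _ _)).
by rewrite lerD ?h ?leq_maxr// ltW.
Qed.

(** Convergence at distance r / 2 bounds the terms of the power series there; on radius r / 4 its
    tails are then dominated by a geometric series of ratio 1 / 2. *)
Lemma real_analytic_geo psi t0 : real_analytic psi -> geo psi t0.
Proof.
move=> /(_ t0)[r [r0 [a ha]]]; pose r1 := r / 2; have r10 : 0 < r1 by rewrite divr_gt0.
have [M M0 hM] : exists2 M, 0 <= M & forall k, `|a k| * r1 ^+ k <= M.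
  have := ha (t0 + r1); rewrite addrAC subrr add0r gtr0_norm//.
  rewrite ltr_pdivrMr// ltr_pMr// ltr1n => /(_ isT) cv.
  have /cvg_seq_bounded[M0 [_ hM0]] : cvgn (fun N => \sum_(k < N) a k * r1 ^+ k).
    by apply/cvg_ex; exists (psi (t0 + r1)).
  pose M := M0 + 1; have hM n : `|\sum_(k < n) a k * r1 ^+ k| <= M.
    by apply: (hM0 M) => //; rewrite ltrDl.
  exists (M + M) => [|k].
    by rewrite addr_ge0// (le_trans _ (hM 0%N)).
  rewrite -[r1 ^+ k]ger0_norm ?exprn_ge0 ?(ltW r10)// -normrM.
  have -> : a k * r1 ^+ k = \sum_(i < k.+1) a i * r1 ^+ i - \sum_(i < k) a i * r1 ^+ i.
    by rewrite big_ord_recr /= addrAC subrr add0r.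
  by apply: (le_trans (ler_normB _ _)); rewrite lerD// hM.
pose r2 := r1 / 2; have r20 : 0 < r2 by rewrite divr_gt0.
exists r2, (2 * M); split => // n; exists (\poly_(k < n.+1) a k).
split; first exact: size_poly.
  have -> : pnorm r2 (\poly_(k < n.+1) a k) = \sum_(k < n.+1) `|a k| * r2 ^+ k.
    rewrite /pnorm (_ : absp _ = \poly_(k < n.+1) `|a k|) ?horner_poly//.
    by apply/polyP => i; rewrite coef_absp !coef_poly; case: ifP => // _; rewrite normr0.
  apply: (@le_trans _ _ (\sum_(k < n.+1) M * (1 / 2) ^+ k)).
    have -> : r2 = r1 * (1 / 2) by rewrite mul1r.
    by apply: ler_sum => k _; rewrite exprMn mulrA ler_wpM2r// exprn_ge0// divr_ge0.
  rewrite -mulr_sumr mulrC ler_wpM2r//; apply: geometric_sum_le2.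
  by rewrite lexx divr_ge0.
move=> t tr2; pose x := `|t| / r1.
have x0 : 0 <= x by rewrite divr_ge0// ltW.
have x2 : x <= 1 / 2 by rewrite ler_pdivrMr// mul1r mulrC.
have tr : `|t| < r by move: tr2; rewrite /r2 /r1; lra.
have := ha (t0 + t); rewrite addrAC subrr add0r => /(_ tr) cv.
apply: (@le_trans _ _ (2 * M * x ^+ n.+1)); last first.
  rewrite ler_wpM2l ?mulr_ge0//; have xr2 : 0 <= `|t| / r2 by rewrite divr_ge0 ?(ltW r20).
  apply: lerXn2r; rewrite ?nnegrE//.
  by rewrite /x ler_wpM2l// lef_pV2// ler_pdivrMr// ler_pMr// ler1n.
apply: (limit_dist_le (n0 := n.+1) cv) => N nN.
rewrite horner_poly -(subnK nN) addnC big_split_ord /= addrAC subrr add0r.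
apply: (le_trans (ler_norm_sum _ _ _)).
apply: (@le_trans _ _ (\sum_(i < N - n.+1) M * x ^+ n.+1 * x ^+ i)).
  apply: ler_sum => i _; rewrite -mulrA -exprD normrM normrX /x expr_div_n mulrA.
  by rewrite ler_pdivlMr ?exprn_gt0// mulrAC ler_wpM2r// exprn_ge0.
rewrite -mulr_sumr mulrC -mulrA ler_wpM2r ?mulr_ge0 ?exprn_ge0//.
by apply: geometric_sum_le2; rewrite x0.
Qed.

Definition linear_growth psi := exists2 C, 0 <= C & forall t, `|psi t| <= C * (1 + `|t|).

Lemma sublinear_ray psi x : sublinear psi -> exists T M, forall t, T < t -> `|psi (t * x)| <= M * t.
Proof.
move=> /(_ x)/ereal_inf_lt[_ [V [T [_ VT]] <-] supV].
have [M hM] : exists M : R, forall t, V t -> `|psi (t * x)| / t <= M.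
  move: supV; case supE : (ereal_sup _) => [M||] // _.
    exists M => t Vt; rewrite -lee_fin -supE; apply: ereal_sup_ubound.
    by exists t.
  (* A supremum equal to -oo leaves no point in V. *)
  exists 0 => t Vt.
  have : ((`|psi (t * x)| / t)%:E <= -oo)%E by rewrite -supE; apply: ereal_sup_ubound; exists t.
  by rewrite leeNy_eq.
exists (Num.max T 0), M => t; rewrite gt_max => /andP[/VT/hM h t0].
by rewrite -ler_pdivrMr.
Qed.

(** The rays through 1 and -1 control psi outside [-T, T], and local boundedness controls it
    inside. *)
Lemma sublinear_growth psi : (forall t, geo psi t) -> sublinear psi -> linear_growth psi.
Proof.
move=> gpsi sl; have [T1 [M1 h1]] := sublinear_ray 1 sl.
have [T2 [M2 h2]] := sublinear_ray (-1) sl.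
pose T := Num.max 0 (Num.max T1 T2).
have T0 : 0 <= T by rewrite le_max lexx.
have [|B hB] := @geo_bounded_itv _ psi (- T) T gpsi; first lra.
pose C := Num.max (Num.max 0 B) (Num.max M1 M2).
have C0 : 0 <= C by rewrite !le_max lexx.
exists C => // t.
have CM1 : M1 <= C by rewrite !le_max lexx !orbT.
have CM2 : M2 <= C by rewrite !le_max lexx !orbT.
have CB : B <= C by rewrite !le_max lexx !orbT.
have [tT|Tt] := leP `|t| T.
  apply: (le_trans (hB t _)); first by rewrite -ler_norml.
  by apply: (le_trans CB); rewrite ler_peMr// lerDl.
have : Num.max T1 T2 < `|t| by apply: le_lt_trans Tt; rewrite le_max lexx orbT.
rewrite gt_max => /andP[t1 t2].
have [t0|t0] := leP 0 t.
  have := h1 _ t1; rewrite mulr1 (ger0_norm t0) => /le_trans; apply.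
  by rewrite mulrDr mulr1 ler_wpDl// ler_wpM2r.
have := h2 _ t2; rewrite mulrN1 (ltr0_norm t0) opprK => /le_trans; apply.
by rewrite mulrDr mulr1 ler_wpDl// ler_wpM2r// oppr_ge0 ltW.
Qed.

End activation.

(** * Neural networks against polynomial maps *)

Section networks.
Context {R : realType}.
Implicit Types (psi : R -> R).

Lemma layerE m n (W : 'M[R]_(m, n)) (b : 'cV[R]_m) (x : 'cV[R]_n) i :
  (W *m x + b) i ord0 = \sum_j W i j * x j ord0 + b i ord0.
Proof. by rewrite !mxE. Qed.

Section parameters.
Variables (d : nat -> nat) (psi : R -> R) (W : forall j : nat, 'M[R]_(d j.+1, d j))
  (b : forall j : nat, 'cV[R]_(d j.+1)).

Lemma hidden_geo (l : R -> 'cV[R]_(d 0)) : (forall t, geo psi t) ->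
  (forall i t, geo (fun s => l s i ord0) t) ->
  forall j i t, geo (fun s => hidden psi W b j (l s) i ord0) t.
Proof.
move=> gpsi gl; elim=> [//|j IH] i t /=.
under eq_fun do rewrite mxE layerE.
apply: (@geo_comp _ psi (fun s => \sum_c W j i c * hidden psi W b j (l s) c ord0 + b j i ord0)) => //.
by apply: geo_add; [apply: geo_sum => c; exact: geo_scale | exact: geo_const].
Qed.

Lemma response_geo k (l : R -> 'cV[R]_(d 0)) : (forall t, geo psi t) ->
  (forall i t, geo (fun s => l s i ord0) t) ->
  forall i t, geo (fun s => response k psi W b (l s) i ord0) t.
Proof.
move=> gpsi gl i t; under eq_fun do rewrite layerE.
apply: geo_add; [apply: geo_sum => c; apply: geo_scale | exact: geo_const].
exact: hidden_geo.
Qed.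

(** The summand 1 allows the biases to be absorbed into a multiple of the gauge at every layer. *)
Definition gauge n (x : 'cV[R]_n) : R := 1 + \sum_i `|x i ord0|.

Lemma gauge_ge1 n (x : 'cV[R]_n) : 1 <= gauge x.
Proof. by rewrite lerDl sumr_ge0. Qed.

Lemma layer_growth (T : Type) (rho : T -> R) m n (A : 'M[R]_(m, n)) (c : 'cV[R]_m)
    (f : T -> 'cV[R]_n) : (forall x, 1 <= rho x) ->
  (forall i, exists2 C, 0 <= C & forall x, `|f x i ord0| <= C * rho x) ->
  forall i, exists2 C, 0 <= C & forall x, `|(A *m f x + c) i ord0| <= C * rho x.
Proof.
move=> r1 hf i; have [C hC] := choice (fun j => let: ex_intro2 C c0 h := hf j in
  ex_intro (fun C => 0 <= C /\ forall x, `|f x j ord0| <= C * rho x) C (conj c0 h)).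
exists (\sum_j `|A i j| * C j + `|c i ord0|).
  by rewrite addr_ge0// sumr_ge0// => j _; rewrite mulr_ge0//; have [] := hC j.
move=> x; rewrite layerE mulrDl; apply: (le_trans (ler_normD _ _)); apply: lerD.
  rewrite mulr_suml; apply: (le_trans (ler_norm_sum _ _ _)); apply: ler_sum => j _.
  by rewrite normrM -mulrA ler_wpM2l//; have [_] := hC j.
by rewrite ler_peMr.
Qed.

Lemma hidden_growth j i : linear_growth psi ->
  exists2 C, 0 <= C & forall x, `|hidden psi W b j x i ord0| <= C * gauge x.
Proof.
move=> [C C0 hC]; elim: j i => [|j IH] i /=.
  exists 1 => // x; rewrite mul1r /gauge (bigD1 i)//= addrCA lerDl addr_ge0//.
  exact: sumr_ge0.
have [D D0 hD] := layer_growth (W j) (b j) (@gauge_ge1 _) IH i.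
exists (C * (1 + D)) => [|x]; first by rewrite mulr_ge0// addr_ge0.
rewrite mxE; apply: (le_trans (hC _)); rewrite -mulrA ler_wpM2l// mulrDl mul1r.
by rewrite lerD// gauge_ge1.
Qed.

Lemma response_growth k i : linear_growth psi ->
  exists2 C, 0 <= C & forall x, `|response k psi W b x i ord0| <= C * gauge x.
Proof.
move=> gpsi; apply: (layer_growth (W k) (b k) (@gauge_ge1 _)) => j.
exact: hidden_growth.
Qed.

End parameters.

Lemma dft_hidden (S : forall n, set (set 'rV[R]_n)) (d : nat -> nat) psi
    (W : env R -> forall j : nat, 'M[R]_(d j.+1, d j)) (b : env R -> forall j, 'cV[R]_(d j.+1))
    (x : env R -> 'cV[R]_(d 0)) : o_minimal S ->
  S 2%N [set z : 'rV[R]_2 | z ord0 ord_max = psi (z ord0 ord0)] ->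
  (forall j i c, @dft R S (fun e => W e j i c)) ->
  (forall j i, @dft R S (fun e => b e j i ord0)) ->
  (forall i, @dft R S (fun e => x e i ord0)) ->
  forall j i, @dft R S (fun e => hidden psi (W e) (b e) j (x e) i ord0).
Proof.
move=> omS Spsi dW db dx; elim=> [//|j IH] i /=.
under eq_fun do rewrite mxE layerE.
apply: (dft_of_fun omS Spsi); apply: (dft_add omS) => //.
by apply: (dft_sum omS) => c; exact: (dft_mul omS).
Qed.

Lemma dft_response (S : forall n, set (set 'rV[R]_n)) (d : nat -> nat) psi k
    (W : env R -> forall j : nat, 'M[R]_(d j.+1, d j)) (b : env R -> forall j, 'cV[R]_(d j.+1))
    (x : env R -> 'cV[R]_(d 0)) : o_minimal S ->
  S 2%N [set z : 'rV[R]_2 | z ord0 ord_max = psi (z ord0 ord0)] ->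
  (forall j i c, @dft R S (fun e => W e j i c)) ->
  (forall j i, @dft R S (fun e => b e j i ord0)) ->
  (forall i, @dft R S (fun e => x e i ord0)) ->
  forall i, @dft R S (fun e => response k psi (W e) (b e) (x e) i ord0).
Proof.
move=> omS Spsi dW db dx i; under eq_fun do rewrite layerE.
apply: (dft_add omS) => //; apply: (dft_sum omS) => c; apply: (dft_mul omS) => //.
exact: dft_hidden.
Qed.

Lemma dft_meval (S : forall n, set (set 'rV[R]_n)) n (p : mpoly.mpoly n R) (x : env R -> 'I_n -> R) :
  o_minimal S -> (forall i, @dft R S (fun e => x e i)) ->
  @dft R S (fun e => mpoly.meval (x e) p).
Proof.
move=> omS dx; under eq_fun do rewrite mpoly.mevalE.
apply: (dft_sum omS) => m; apply: (dft_mul omS); first exact: dft_const.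
by apply: (dft_prod omS) => i; exact: dft_exp.
Qed.

Lemma meval_line n (p : mpoly.mpoly n R) (x v : 'I_n -> R) :
  exists P : {poly R}, forall t, mpoly.meval (fun i => x i + t * v i) p = P.[t].
Proof.
exists (\sum_(m <- mpoly.msupp p) mpoly.mcoeff m p *:
  \prod_i ((x i)%:P + v i *: 'X) ^+ mpoly.fun_of_multinom m i) => t.
rewrite mpoly.mevalE horner_sum; apply: eq_bigr => m _; rewrite hornerZ horner_prod.
congr (_ * _); apply: eq_bigr => i _.
by rewrite horner_exp hornerD hornerC hornerZ hornerX mulrC.
Qed.

Lemma digits_lt n B (f : 'I_n -> nat) : (forall i, f i < B)%N ->
  (\sum_i f i * B ^ i < B ^ n)%N.
Proof.
elim: n f => [|n IH] f fB; first by rewrite big_ord0 expn0.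
rewrite big_ord_recl expn0 muln1; under eq_bigr do rewrite /= /bump /= add1n expnS mulnCA.
rewrite -big_distrr /=; have := IH (fun i => f (lift ord0 i)) (fun i => fB _).
have := fB ord0; rewrite expnS; set s := (\sum_i _)%N; move: (B ^ n)%N => b h1 h2.
apply: (@leq_trans (B + B * s)); first by rewrite ltn_add2r.
by rewrite -mulnS leq_mul2l h2 orbT.
Qed.

Lemma digits_inj n B (f g : 'I_n -> nat) : (forall i, f i < B)%N -> (forall i, g i < B)%N ->
  (\sum_i f i * B ^ i = \sum_i g i * B ^ i)%N -> f =1 g.
Proof.
elim: n f g => [|n IH] f g fB gB; first by move=> _ [].
rewrite !big_ord_recl expn0 !muln1.
have E (h : 'I_n.+1 -> nat) : (\sum_(i < n) h (lift ord0 i) * B ^ lift ord0 i =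
    B * \sum_(i < n) h (lift ord0 i) * B ^ i)%N.
  by rewrite big_distrr /=; apply: eq_bigr => i _; rewrite /= /bump /= add1n expnS mulnCA.
rewrite !E => fg; have B0 : (0 < B)%N by exact: leq_ltn_trans (fB ord0).
have f0 : f ord0 = g ord0.
  by have := congr1 (modn^~ B) fg; rewrite ![(_ + B * _)%N]addnC ![(B * _)%N]mulnC !modnMDl !modn_small.
have fs : (\sum_(i < n) f (lift ord0 i) * B ^ i = \sum_(i < n) g (lift ord0 i) * B ^ i)%N.
  by move: fg; rewrite f0 => /addnI/eqP; rewrite eqn_mul2l gtn_eqF// => /eqP.
move=> i; case: (unliftP ord0 i) => [j ->|-> //].
exact: (IH (fun i => f (lift ord0 i)) (fun i => g (lift ord0 i))).
Qed.

(* Substitute x_i = s ^ (2 B ^ n + B ^ i) with B larger than every exponent: distinct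
   monomials go to distinct powers of s (read the exponent in base B), and a monomial of
   degree at least 2 goes to a power beyond every s ^ (2 B ^ n + B ^ i). *)
Lemma mpoly_linear_growth n (p : mpoly.mpoly n R) C :
  (forall x : 'I_n -> R, `|mpoly.meval x p| <= C * (1 + \sum_i `|x i|)) ->
  forall m, m \in mpoly.msupp p -> (mpoly.mdeg m <= 1)%N.
Proof.
move=> hp m mp; rewrite leqNgt; apply/negP => m2.
pose B := (\max_(m <- mpoly.msupp p) mpoly.mdeg m).+1.
have mB m' i : m' \in mpoly.msupp p -> (mpoly.fun_of_multinom m' i < B)%N.
  move=> m'p; rewrite ltnS; apply: (@leq_trans (mpoly.mdeg m')).
    by rewrite mpoly.mdegE (bigD1 i)//= leq_addr.
  exact: (@leq_bigmax_seq _ _ xpredT (fun m => mpoly.mdeg m) m' m'p isT).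
pose e (i : 'I_n) := (2 * B ^ n + B ^ i)%N.
pose w (m : mpoly.multinom n) := (\sum_i mpoly.fun_of_multinom m i * e i)%N.
have wE m' : w m' = (2 * mpoly.mdeg m' * B ^ n + \sum_i mpoly.fun_of_multinom m' i * B ^ i)%N.
  rewrite /w mpoly.mdegE mulnAC mulnC big_distrl -big_split /=.
  by apply: eq_bigr => i _; rewrite /e mulnDr.
have B0 : (0 < B ^ n)%N by rewrite expn_gt0.
have w_inj m' : m' \in mpoly.msupp p -> w m' = w m -> m' = m.
  move=> m'p ww; apply/mpoly.mnmP; apply: (@digits_inj n B) => [i|i|]; [exact: mB|exact: mB|].
  have := congr1 (modn^~ (B ^ n)%N) ww; rewrite !wE !modnMDl !modn_small//; apply: digits_lt => i;
  exact: mB.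
pose q := \sum_(m' <- mpoly.msupp p) mpoly.mcoeff m' p *: 'X^(w m').
have qE s : q.[s] = mpoly.meval (fun i => s ^+ e i) p.
  rewrite mpoly.mevalE horner_sum; apply: eq_bigr => m' _; rewrite hornerZ hornerXn.
  congr (_ * _); rewrite /w -prodrXr; apply: eq_bigr => i _.
  by rewrite mulnC exprM.
have qw : q`_(w m) = mpoly.mcoeff m p.
  rewrite coef_sum (bigD1_seq m) ?mpoly.msupp_uniq//= coefZ coefXn eqxx mulr1.
  rewrite big_seq_cond big1 ?addr0// => m' /andP[m'p m'm]; rewrite coefZ coefXn.
  by case: eqP => [/esym/(w_inj m' m'p)/eqP|]; rewrite ?(negbTE m'm)// mulr0.
(* Every [e i] is at most 3 B ^ n, whereas a monomial of degree at least 2 has weight at least 4 B ^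
   n. *)
have := @coef_eq0_of_growth _ q (3 * B ^ n) (`|C| * (1 + n%:R)) _ (w m).
rewrite qw => q0; have : mpoly.mcoeff m p == 0.
  apply/eqP/q0; last first.
    rewrite wE; apply: (@leq_trans (4 * B ^ n)); first by rewrite ltn_mul2r B0.
    by apply: leq_trans (leq_addr _ _); rewrite leq_mul2r (leq_mul2l 2 2) m2 !orbT.
  move=> s s1; have s0 : 0 <= s by exact: le_trans s1.
  rewrite qE; apply: (le_trans (hp _)); apply: (@le_trans _ _ (`|C| * (1 + \sum_i `|s ^+ e i|))).
    by rewrite ler_wpM2r ?ler_norm// addr_ge0// sumr_ge0.
  rewrite -mulrA ler_wpM2l// mulrDl mul1r lerD ?exprn_ege1//.
  apply: (@le_trans _ _ (\sum_(i < n) s ^+ (3 * B ^ n))); last first.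
    by rewrite sumr_const card_ord mulr_natl.
  apply: ler_sum => i _; rewrite ger0_norm ?exprn_ge0// ler_weXn2l//.
  by rewrite /e mulSn addnC leq_add2r leq_pexp2l// ltnW.
by rewrite mpoly.mcoeff_eq0 mp.
Qed.

Theorem response_neq_poly_map k (d : nat -> nat) psi (W : forall j : nat, 'M[R]_(d j.+1, d j))
    (b : forall j, 'cV[R]_(d j.+1)) (F : 'I_(d k.+1) -> mpoly.mpoly (d 0) R)
    (a : 'cV[R]_(d 0)) r :
  (forall t, geo psi t) -> linear_growth psi -> (2 <= poly_map_deg F)%N -> 0 < r ->
  exists2 x : 'cV[R]_(d 0), (forall i, `|x i ord0 - a i ord0| < r) & response k psi W b x <> poly_map F x.
Proof.
move=> gpsi lpsi degF r0; apply: contrapT => nex.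
have eqF (x : 'cV[R]_(d 0)) : (forall i, `|x i ord0 - a i ord0| < r) -> response k psi W b x = poly_map F x.
  by move=> xa; apply: contrapT => ne; apply: nex; exists x.
have all (x : 'cV[R]_(d 0)) : response k psi W b x = poly_map F x.
  apply/colP => j; apply/eqP; rewrite -subr_eq0; apply/eqP.
  (* The line from a (at s = 0) to x (at s = 1): for small s it stays in the box of agreement, and
     the identity theorem carries equality to s = 1. *)
  pose v := x - a; pose l s := a + s *: v.
  have l1 : l 1 = x by rewrite /l scale1r addrC subrK.
  have lE s : (fun i => l s i ord0) = (fun i => a i ord0 + s * v i ord0).
    by apply/funext => i; rewrite /l !mxE.
  have [P hP] := meval_line (F j) (fun i => a i ord0) (fun i => v i ord0).
  pose f s := response k psi W b (l s) j ord0 + -1 * P.[s].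
  have FE s : poly_map F (l s) j ord0 = P.[s] by rewrite mxE -hP lE.
  have gf t : geo f t.
    apply: geo_add; last by apply: geo_scale; exact: geo_poly.
    apply: response_geo => // i u; rewrite (_ : (fun s => _) = (fun s => ((a i ord0)%:P + v i ord0 *: 'X).[s])).
      exact: geo_poly.
    by apply/funext => s; rewrite /l !mxE hornerD hornerC hornerZ hornerX mulrC.
  suff : f 1 = 0 by rewrite /f -FE l1 mulN1r.
  apply: (@geo_identity _ f 0 1 gf).
  have [D D0 hD] := env_bounded (d 0) (mx_env v).
  exists (r / D); first by rewrite divr_gt0.
  move=> s; rewrite subr0 => sr; rewrite /f -FE eqF ?mulN1r ?subrr// => i.
  rewrite /l !mxE addrAC subrr add0r normrM.
  have : `|v i ord0| <= D.
    have := hD _ (ltn_ord i); have := mx_envE v i ord0; rewrite muln1 addn0 => ->.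
    by [].
  by rewrite !mxE => vD; apply: (@le_lt_trans _ _ (`|s| * D)); [exact: ler_wpM2l | rewrite -ltr_pdivlMr].
have [j Fj] : exists j, (2 <= mpoly_deg (F j))%N.
  apply: contrapT => nj; move: degF; rewrite leqNgt ltnS; apply/negP/negPn.
  by apply/bigmax_leqP => j _; rewrite leqNgt; apply/negP => ?; apply: nj; exists j.
have [C C0 hC] := response_growth W b j lpsi.
suff : (mpoly_deg (F j) <= 1)%N by rewrite leqNgt Fj.
apply/bigmax_leqP_seq => m mp _; apply: (mpoly_linear_growth (C := C)) mp => x.
have := hC (\col_i x i); rewrite all mxE /gauge.
rewrite (_ : mpoly.meval _ _ = mpoly.meval x (F j)); last by apply: mpoly.meval_eq => i; rewrite mxE.
by under eq_bigr do rewrite mxE.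
Qed.

End networks.

(** * Expected losses *)

Section loss.
Context {R : realType}.
Local Open Scope ereal_scope.
Import HBNNSimple.

(** As [leb_outer] is a bare set function, the integral is unfolded to a supremum over simple
    functions. Those below p restricted to A have their nonzero level sets inside A, where
    monotonicity gives outer measure zero. *)
Lemma integral_outer_null m n (A : set 'M[R]_(m, n)) (p : 'M[R]_(m, n) -> R) :
  leb_outer A = 0 -> (forall x, 0 <= p x)%R -> \int[@leb_outer R m n]_(x in A) (p x)%:E = 0.
Proof.
move=> A0 p0.
have sub0 B : B `<=` A -> leb_outer B = 0.
  by move=> BA; apply/eqP; rewrite eq_le leb_outer_ge0 andbT -A0; exact: leb_outer_le.
pose g := (fun x => (p x)%:E) \_ A.
have g0 x : 0 <= g x by rewrite /g patchE; case: ifP => // _; rewrite lee_fin.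
rewrite /integral -/g.
have nn0 (f : 'M[R]_(m, n) -> \bar R) : (forall x, f x <= g x) -> (forall x, 0 <= f x) ->
    ereal_sup [set sintegral (@leb_outer R m n) h
       | h in [set h : {nnsfun 'M[R]_(m, n) >-> R} | forall x, (h x)%:E <= f x]] = 0.
  move=> fg f0.
  have int0 (h : {nnsfun 'M[R]_(m, n) >-> R}) : (forall x, (h x)%:E <= f x) ->
      sintegral (@leb_outer R m n) h = 0.
    move=> hf; rewrite /sintegral fsbig1// => x _.
    have [->|x0] := eqVneq x 0%R; first by rewrite mul0e.
    rewrite sub0 ?mule0// => y /= hy; apply: contrapT => nAy.
    have := le_trans (hf y) (fg y); rewrite /g patchE memNset// hy lee_fin => xle.
    have : (0 <= h y)%R by exact: fun_ge0.
    by rewrite hy => xge; move: x0; rewrite eq_le xle xge.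
  apply/eqP; rewrite eq_le; apply/andP; split.
    by apply: ge_ereal_sup => _ [h hf <-]; rewrite int0.
  have n0 x : (@nnsfun0 _ 'M[R]_(m, n) R x)%:E <= f x by [].
  by apply: ereal_sup_ubound; exists nnsfun0 => //; exact: int0.
rewrite (nn0 g^\+); [|by move=> x; rewrite (ge0_funeposE (D := setT) (fun y _ => g0 y)) ?inE|by move=> x; exact: funepos_ge0].
rewrite (nn0 g^\-); [by rewrite sube0| |by move=> x; exact: funeneg_ge0].
by move=> x; rewrite (ge0_funenegE (D := setT) (fun y _ => g0 y)) ?inE //=; exact: g0.
Qed.

Lemma open_measurable_mx m n (A : set 'M[R]_(m, n)) : open A -> measurable A.
Proof. by move=> oA; exact: sub_sigma_algebra. Qed.

Lemma continuous_measurable_mx m n m' n' (f : 'M[R]_(m, n) -> 'M[R]_(m', n')) :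
  continuous f -> measurable_fun setT f.
Proof.
move=> cf; apply: (@measurability _ _ _ _ setT f [set B | open B]) => //.
move=> _ [B oB <-]; rewrite setTI; apply: open_measurable_mx.
by have /continuousP := cf; apply.
Qed.

Lemma continuous_mx_entries (T : topologicalType) m n (f : T -> 'M[R]_(m, n)) :
  (forall i j, continuous (fun x => f x i j)) -> continuous f.
Proof.
move=> cf x A [P fP PA]; apply: (@filterS _ _ _ [set y | forall i j, P i j (f y i j)]).
  by move=> y /PA.
apply: filter_forall => i; apply: filter_forall => j.
exact: (cf i j x _ (fP i j)).
Qed.

Section positivity.
Context {n m : nat} (f g : 'cV[R]_n -> 'cV[R]_m) (ell : 'cV[R]_m -> 'cV[R]_m -> R).
Hypotheses (cf : continuous f) (cg : continuous g) (mell : measurable_loss ell).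

Let h x : R := ell (f x) (g x).

Lemma measurable_loss_comp : measurable_fun setT h.
Proof.
have [_ mz] := mell.
have mfg : measurable_fun setT (fun x => (f x, g x)).
  by apply/measurable_fun_pairP; split => /=; exact: continuous_measurable_mx.
exact: (measurableT_comp mz mfg).
Qed.

Let Z := [set x | f x = g x].

(** Z is the zero set of the loss of (f, g), so it inherits measurability from [ell]. *)
Lemma measurable_agreement : measurable Z.
Proof.
have [[_ h0] _] := mell; rewrite (_ : Z = h @^-1` [set 0%R]).
  by rewrite -[_ @^-1` _]setTI; exact: measurable_loss_comp.
by apply/seteqP; split => x /= /h0.
Qed.

Lemma loss_gt0 (mu : probability 'cV[R]_n R) : mu Z < 1 -> 0 < \int[mu]_x (h x)%:E.
Proof.
move=> Z1; have [[l0 h0] _] := mell; have mh := measurable_loss_comp.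
rewrite lt_neqAle integral_ge0 ?andbT; last by move=> x _; rewrite lee_fin; exact: l0.
apply: contraPN Z1 => /eqP/esym int0; apply/negP; rewrite -leNgt.
have /measurable_EFinP mEh := mh.
have : \int[mu]_x `|(h x)%:E| = 0.
  by rewrite -int0; apply: eq_integral => x _; rewrite gee0_abs// lee_fin; exact: l0.
move=> /(ae_eq_integral_abs mu measurableT mEh) [N [mN N0 ZN]].
have : mu (~` Z) = 0.
  apply/eqP; rewrite eq_le measure_ge0 andbT -N0; apply: le_measure; rewrite ?inE//.
    by apply: measurableC; exact: measurable_agreement.
  move=> x /= nZ; apply: ZN => /= /(_ I)[] hx; apply: nZ; exact/h0.
rewrite (probability_setC _ measurable_agreement) => /eqP.
have := fin_num_measure mu _ measurable_agreement; case: (mu _) => // r _.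
by rewrite -EFinB eqe subr_eq0 => /eqP <-.
Qed.

End positivity.

End loss.

Section admissible_measures.
Context {R : realType}.
Local Open Scope ereal_scope.

(** The summand of the point missing Z vanishes, leaving at most n - 1 out of n. *)
Lemma empirical_lt1 d0 N (D : set 'M[R]_(N, d0)) (Z : set 'cV[R]_d0) (m : set 'cV[R]_d0 -> \bar R) :
  measurable Z ->
  (forall x : nat -> 'cV[R]_d0, D (\matrix_(i < N, j < d0) x i j ord0)%R ->
     exists2 i, (i < N)%N & ~ Z (x i)) ->
  empirical_as_in_i D m -> exists2 r, m Z = r%:E & (0 <= r < 1)%R.
Proof.
move=> mZ hD [n [x [Nn [Dx mE]]]]; have [i iN nZi] := hD x Dx.
have i_n : (i < n)%N := leq_trans iN Nn.
have n0 : (0 < n%:R :> R)%R by rewrite ltr0n; exact: leq_ltn_trans i_n.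
exists (n%:R^-1 * \sum_(i < n) (x i \in Z)%:R)%R.
  by rewrite mE// EFinM -sumEFin; congr (_ * _); apply: eq_bigr => j _; rewrite diracE.
have s0 : (0 <= \sum_(j < n) (x j \in Z)%:R :> R)%R by apply: sumr_ge0.
rewrite mulr_ge0 ?invr_ge0 ?(ltW n0)//= mulrC ltr_pdivrMr// mul1r.
rewrite (bigD1 (Ordinal i_n))//= memNset// add0r.
apply: (@le_lt_trans _ _ (\sum_(j < n | j != Ordinal i_n) 1)%R).
  by apply: ler_sum => j _; rewrite lern1 leq_b1.
have <- : (\sum_(j < n) 1 = n%:R :> R)%R by rewrite sumr_const card_ord.
by rewrite [in ltRHS](bigD1 (Ordinal i_n))//= ltrDr.
Qed.

Lemma density_null d0 (Z : set 'cV[R]_d0) (m : set 'cV[R]_d0 -> \bar R) :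
  measurable Z -> leb_outer Z = 0 -> density_as_in_ii m -> m Z = 0.
Proof. by move=> mZ Z0 [p [_ [p0 [_ ->//]]]]; exact: integral_outer_null. Qed.

Lemma admissible_lt1 d0 N (D : set 'M[R]_(N, d0)) (Z : set 'cV[R]_d0)
    (mu : set 'cV[R]_d0 -> \bar R) :
  measurable Z -> leb_outer Z = 0 ->
  (forall x : nat -> 'cV[R]_d0, D (\matrix_(i < N, j < d0) x i j ord0)%R ->
     exists2 i, (i < N)%N & ~ Z (x i)) ->
  admissible D mu -> mu Z < 1.
Proof.
move=> mZ Z0 hD [e|[e|[t [/andP[t0 t1] [m1 [m2 [e1 [e2 muE]]]]]]]].
- by have [r -> /andP[_ r1]] := empirical_lt1 mZ hD e; rewrite lte_fin.
- by rewrite (density_null mZ Z0 e).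
- have [r rE /andP[r0 r1]] := empirical_lt1 mZ hD e1.
  rewrite muE// rE (density_null mZ Z0 e2) mule0 adde0 -EFinM lte_fin.
  by apply: le_lt_trans r1; rewrite ler_piMl.
Qed.

End admissible_measures.

(** * Continuity of networks and of polynomial maps *)

Section continuity.
Context {R : realType}.

(** The approximant of degree 0 is enough: it is the constant psi t, with error at most B |s - t| /
    r. *)
Lemma geo_continuous (psi : R -> R) : (forall t, geo psi t) -> continuous psi.
Proof.
move=> gpsi t; have [r [B [r0 h]]] := gpsi t; have [p [sp np hp]] := h 0%N.
have B0 := geo_bound_ge0 r0 np.
have pt : psi t = p.[0].
  have := hp 0; rewrite normr0 (ltW r0) mul0r expr1 mulr0 addr0 => /(_ isT).
  by rewrite normr_le0 subr_eq0 => /eqP.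
have pc s : p.[s] = p.[0].
  by rewrite (size1_polyC sp) !hornerC.
apply/cvgrPdist_lt => e e0; near=> s.
have s1 : `|s - t| <= r.
  by rewrite distrC; near: s; apply: cvgr_dist_le.
have st : t + (s - t) = s by rewrite addrC subrK.
have := hp _ s1; rewrite st pc -pt expr1 distrC => /le_lt_trans; apply.
rewrite mulrA ltr_pdivrMr//.
have : `|s - t| < e * r / (B + 1).
  rewrite distrC; near: s; apply: cvgr_dist_lt => //.
  by rewrite divr_gt0 ?mulr_gt0 ?ltr_wpDl.
rewrite ltr_pdivlMr ?ltr_wpDl// => h1.
apply: le_lt_trans h1; rewrite mulrC ler_wpM2l// lerDl//.
Unshelve. all: by end_near. Qed.

Lemma continuous_sum (T : topologicalType) (I : Type) (s : seq I) (f : I -> T -> R) :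
  (forall i, continuous (f i)) -> continuous (fun x => \sum_(i <- s) f i x).
Proof.
move=> cf; elim: s => [|i s IH] x.
  by under eq_fun do rewrite big_nil; exact: cvg_cst.
under eq_fun do rewrite big_cons.
by apply: cvgD; [exact: cf | exact: IH].
Qed.

Lemma continuous_prod (T : topologicalType) (I : Type) (s : seq I) (f : I -> T -> R) :
  (forall i, continuous (f i)) -> continuous (fun x => \prod_(i <- s) f i x).
Proof.
move=> cf; elim: s => [|i s IH] x.
  by under eq_fun do rewrite big_nil; exact: cvg_cst.
under eq_fun do rewrite big_cons.
by apply: cvgM; [exact: cf | exact: IH].
Qed.

Lemma continuous_expr (T : topologicalType) (f : T -> R) n :
  continuous f -> continuous (fun x => f x ^+ n).
Proof.
move=> cf; rewrite (_ : (fun x => _) = (fun x => \prod_(i < n) f x)).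
  exact: continuous_prod.
by apply/funext => x; rewrite prodr_const card_ord.
Qed.

Lemma continuous_layer (T : topologicalType) m n (A : 'M[R]_(m, n)) (c : 'cV[R]_m)
    (f : T -> 'cV[R]_n) : (forall i, continuous (fun x => f x i ord0)) ->
  forall i, continuous (fun x => (A *m f x + c) i ord0).
Proof.
move=> cf i; rewrite (_ : (fun x => _) = (fun x => \sum_j A i j * f x j ord0 + c i ord0)).
  move=> x; apply: cvgD; last exact: cvg_cst.
  by apply: continuous_sum => j y; apply: cvgM; [exact: cvg_cst | exact: cf].
by apply/funext => x; rewrite layerE.
Qed.

Lemma continuous_response k (d : nat -> nat) (psi : R -> R) (W : forall j : nat, 'M[R]_(d j.+1, d j))
  (b : forall j, 'cV[R]_(d j.+1)) : continuous psi -> continuous (response k psi W b).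
Proof.
move=> cpsi; suff ch j i : continuous (fun x => hidden psi W b j x i ord0).
  by apply: continuous_mx_entries => i j; rewrite (ord1 j); exact: continuous_layer.
elim: j i => [|j IH] i /=; first exact: coord_continuous.
rewrite (_ : (fun x => _) = psi \o (fun x => (W j *m hidden psi W b j x + b j) i ord0)).
  have cl : continuous (fun x => (W j *m hidden psi W b j x + b j) i ord0).
    exact: continuous_layer.
  by move=> x; exact: (continuous_comp (cl x) (cpsi _)).
by apply/funext => x; rewrite mxE.
Qed.

Lemma continuous_poly_map n m (F : 'I_m -> mpoly.mpoly n R) : continuous (poly_map F).
Proof.
apply: continuous_mx_entries => i j.
rewrite (_ : (fun x => _) = (fun x : 'cV[R]_n => \sum_(mo <- mpoly.msupp (F i))
    mpoly.mcoeff mo (F i) * \prod_l x l ord0 ^+ mpoly.fun_of_multinom mo l)).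
  have cp (mo : mpoly.multinom n) :
      continuous (fun x : 'cV[R]_n => \prod_l x l ord0 ^+ mpoly.fun_of_multinom mo l).
    apply: continuous_prod => l; apply: (@continuous_expr _ (fun x : 'cV[R]_n => x l ord0)).
    exact: coord_continuous.
  apply: continuous_sum => mo x; exact: (cvgM (cvg_cst _) (cp mo x)).
by apply/funext => x; rewrite mxE mpoly.mevalE.
Qed.

End continuity.

(** * Sample points *)

Section closures.
Context {R : realType} {S : forall n : nat, set (set 'rV[R]_n)}.
Hypothesis omS : o_minimal S.
Implicit Types P Q : env R -> Prop.
Local Notation dfn := (@dfn R S).

(** The closure of P in R^n, again in first-order form; its complement supplies the open set of
    samples. *)
Definition adherent n P e : Prop := forall r : R, 0 < r -> exists x, box n e r x /\ P x.

Lemma dfn_adherent n P : depends_on n P -> dfn P -> dfn (adherent n P).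
Proof.
move=> nP dP; apply: (dfn_all omS (P := fun r e => 0 < r -> exists x, box n e r x /\ P x)).
apply: (dfn_imp omS); first by dfn_tac.
apply: (dfn_ex_env omS (n := n) (P := fun x e => box n (shift 1 e) (e 0%N) x /\ P x)).
  move=> e x x' xx' [bx Px]; split; first by move=> i lti; rewrite -xx'//; exact: bx.
  exact: nP Px.
by rewrite /box; dfn_tac.
Qed.

Lemma depends_on_adherent n P : depends_on n (adherent n P).
Proof.
move=> e e' ee' h r /h[x [bx Px]]; exists x; split => //.
by move=> i lti; rewrite -ee'//; exact: bx.
Qed.

Lemma adherent_sub n P e : P e -> adherent n P e.
Proof. by move=> Pe r r0; exists e; split => //; exact: box_center. Qed.

(** Taking closures may create interior in general; here every box has a subbox free of P, and the
    center of the latter is not adherent to P. *)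
Lemma thin_adherent n P : depends_on n P -> dfn P -> thin n P -> thin n (adherent n P).
Proof.
move=> nP dP tP a r r0; have [a' [r' [r'0 s h]]] := thin_subbox omS a dP nP tP r0.
by exists a'; [exact/s/box_center | move=> /(_ r' r'0)[x [/h]]].
Qed.

Lemma not_adherent_open n P e : ~ adherent n P e ->
  exists2 r, 0 < r & forall x, box n e r x -> ~ adherent n P x.
Proof.
move=> nae; have [r r0 h] : exists2 r, 0 < r & forall x, box n e r x -> ~ P x.
  apply: contrapT => nex; apply: nae => r r0; apply: contrapT => nx; apply: nex.
  by exists r => // x bx Px; apply: nx; exists x.
exists (r / 2); first by rewrite divr_gt0.
move=> x bx /(_ (r / 2)); rewrite divr_gt0// => /(_ isT)[y [by_ Py]].
apply: (h y) => // i lti; have := bx i lti; have := by_ i lti.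
rewrite !ltr_norml => /andP[? ?] /andP[? ?]; apply/andP; split; lra.
Qed.

Lemma conull_dense_open_thin m n Q : dfn Q -> depends_on (m * n) Q -> thin (m * n) Q ->
  (forall e, ~ Q e -> exists2 r, 0 < r & forall x, box (m * n) e r x -> ~ Q x) ->
  conull_dense_open [set X : 'M[R]_(m, n) | ~ Q (mx_env X)].
Proof.
move=> dQ nQ tQ oQ; split; [|split].
- apply: (thin_null omS dQ nQ tQ) => X /= nnQ; exact: contrapT.
- move=> O [X OX] oO; have /nbhs_ballP[r /= r0 rO] : nbhs X O by exact: open_nbhs_nbhs.
  have [e be nQe] := tQ (mx_env X) r r0; pose Y : 'M[R]_(m, n) := env_mx m n e.
  exists Y; split.
    apply: rO; split => // i j; rewrite /ball /= !mxE distrC -mx_envE; apply: be.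
    exact: ltn_mx_index.
  move=> QY; apply: nQe; apply: nQ QY => k /mx_index_ex[i [j ->]].
  by rewrite mx_envE mxE.
- rewrite openE => X /= /oQ[r r0 h]; apply/nbhs_ballP; exists r => //= Y [_ XY].
  apply: h => k /mx_index_ex[i [j ->]]; rewrite !mx_envE distrC; exact: XY.
Qed.

End closures.

Lemma no_common_near {R : realType} (u v w c : R) :
  c <= `|u - v| -> `|w - u| < c / 2 -> `|w - v| < c / 2 -> False.
Proof. by rewrite !ltr_norml ler_normr => /orP[?|?] /andP[? ?] /andP[? ?]; lra. Qed.

(** * The agreement family of an architecture *)

Section main.
Context {R : realType}.
Variables (k : nat) (d : nat -> nat) (psi : R -> R) (F : 'I_(d k.+1) -> mpoly.mpoly (d O) R).
Local Notation n0 := (d 0%N).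

(* A parameter vector is an environment: the weight W_j(i, c) sits at the code of
   (j, i, Some c) and the bias b_j(i) at the code of (j, i, None). *)
Definition weights (e : env R) (j : nat) : 'M[R]_(d j.+1, d j) :=
  \matrix_(i, c) e (pickle (j, nat_of_ord i, Some (nat_of_ord c))).
Definition biases (e : env R) (j : nat) : 'cV[R]_(d j.+1) :=
  \col_i e (pickle (j, nat_of_ord i, None : option nat)).
Definition point n (e : env R) : 'cV[R]_n := \col_i e i.

Definition agree (e : env R) : Prop := forall i,
  response k psi (weights (shift n0 e)) (biases (shift n0 e)) (point n0 e) i ord0 =
  poly_map F (point n0 e) i ord0.

(** W and b are families over all j, so a whole environment is used to store them; definability of
    [agree] bounds the coordinates that matter. *)
Lemma parameters_surjective (W : forall j : nat, 'M[R]_(d j.+1, d j))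
    (b : forall j : nat, 'cV[R]_(d j.+1)) :
  exists e, forall j, weights e j = W j /\ biases e j = b j.
Proof.
pose e i := if unpickle i is Some (j, a, oc) then
  if insub a is Some a' then
    if oc is Some c then (if insub c is Some c' then W j a' c' else 0) else b j a' ord0
  else 0 else 0.
exists e => j; split.
  by apply/matrixP => a c; rewrite mxE /e pickleK !valK.
by apply/colP => a; rewrite mxE /e pickleK valK.
Qed.

Lemma response_ext (W W' : forall j : nat, 'M[R]_(d j.+1, d j))
    (b b' : forall j : nat, 'cV[R]_(d j.+1)) x :
  (forall j, W j = W' j /\ b j = b' j) -> response k psi W b x = response k psi W' b' x.
Proof.
move=> h; have hE j : hidden psi W b j x = hidden psi W' b' j x.
  by elim: j => //= j ->; have [-> ->] := h j.
by rewrite /response hE; have [-> ->] := h k.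
Qed.

Lemma mx_env_cv n (x : 'cV[R]_n) (i : 'I_n) : mx_env x i = x i ord0.
Proof. by rewrite -mx_envE muln1 addn0. Qed.

Lemma point_mx_env n (x : 'cV[R]_n) : point n (mx_env x) = x.
Proof. by apply/colP => i; rewrite mxE mx_env_cv. Qed.

Lemma point_ext n e e' : (forall i, (i < n)%N -> e i = e' i) -> point n e = point n e'.
Proof. by move=> ee'; apply/colP => i; rewrite !mxE ee'. Qed.

Lemma point_cat n e e' : point n (cat n e e') = point n e.
Proof. by apply: point_ext => i lti; rewrite cat_lt. Qed.

Lemma agree_cat x e : agree (cat n0 x e) <->
  response k psi (weights e) (biases e) (point n0 x) = poly_map F (point n0 x).
Proof.
rewrite /agree point_cat shift_cat; split => [h|-> //].
by apply/colP => i; rewrite h.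
Qed.

Lemma dfn_agree (S : forall n : nat, set (set 'rV[R]_n)) : o_minimal S ->
  S 2%N [set z : 'rV[R]_2 | z ord0 ord_max = psi (z ord0 ord0)] -> @dfn R S agree.
Proof.
move=> omS Spsi.
have dp i : @dft R S (fun e => point n0 e i ord0).
  by under eq_fun do rewrite mxE; exact: dft_proj.
have dPi i : @dfn R S (fun e =>
    response k psi (weights (shift n0 e)) (biases (shift n0 e)) (point n0 e) i ord0 =
    poly_map F (point n0 e) i ord0).
  apply: (dfn_eq omS).
    apply: dft_response => // [j a c|j a]; under eq_fun do rewrite mxE;
    exact: dft_proj.
  by under eq_fun do rewrite mxE; exact: dft_meval.
apply: (@dfn_ext _ _ (fun e => forall i, (i < d k.+1)%N ->
  if insub i is Some i' then response k psi (weights (shift n0 e)) (biases (shift n0 e))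
    (point n0 e) i' ord0 = poly_map F (point n0 e) i' ord0 else True)).
  move=> e; split => [h i|h i lti]; first by have := h i (ltn_ord i); rewrite valK.
  by rewrite insubT; exact: h.
apply: (dfn_alln omS) => i lti; case: insubP => [i' _ _|_]; [exact: dPi | exact: dfn_const].
Qed.

Hypotheses (gpsi : forall t, geo psi t) (lpsi : linear_growth psi) (degF : (2 <= poly_map_deg F)%N).

Lemma thin_agree e : thin n0 (fun x => agree (cat n0 x e)).
Proof.
move=> a r r0.
have [x xa ne] := response_neq_poly_map (weights e) (biases e) (point n0 a) gpsi lpsi degF r0.
exists (mx_env x); last by move=> /agree_cat; rewrite point_mx_env.
move=> i lti; have := xa (Ordinal lti); rewrite mxE.
by rewrite -[i]/(nat_of_ord (Ordinal lti)) mx_env_cv.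
Qed.

Lemma agreement_null (S : forall n : nat, set (set 'rV[R]_n)) W b : o_minimal S ->
  S 2%N [set z : 'rV[R]_2 | z ord0 ord_max = psi (z ord0 ord0)] ->
  leb_outer [set x | response k psi W b x = poly_map F x] = 0%E.
Proof.
move=> omS Spsi; have [e We] := parameters_surjective W b.
have dA := dfn_agree omS Spsi.
apply: (@thin_null _ S _ _ (fun x => agree (cat n0 x e)) _ omS).
- by dfn_tac.
- rewrite muln1 => x x' xx' /agree_cat h; apply/agree_cat.
  by rewrite -(point_ext xx').
- by rewrite muln1; exact: thin_agree.
- move=> x /= h; apply/agree_cat; rewrite point_mx_env -h.
  exact: response_ext.
Qed.

(** Isolates what the choice of D has to achieve: no parameter agrees with F at all of the first N
    sample points. *)
Lemma loss_positive (S : forall n : nat, set (set 'rV[R]_n)) N (D : set 'M[R]_(N, n0)) :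
  o_minimal S -> S 2%N [set z : 'rV[R]_2 | z ord0 ord_max = psi (z ord0 ord0)] ->
  (forall (x : nat -> 'cV[R]_n0) e, D (\matrix_(i < N, j < n0) x i j ord0) ->
    exists2 i, (i < N)%N & ~ agree (cat n0 (mx_env (x i)) e)) ->
  forall (ell : 'cV[R]_(d k.+1) -> 'cV[R]_(d k.+1) -> R) (mu : probability 'cV[R]_(d O) R),
  measurable_loss ell -> admissible D mu ->
  forall (W : forall j : nat, 'M[R]_(d j.+1, d j)) (b : forall j : nat, 'cV[R]_(d j.+1)),
  (0 < \int[mu]_x (ell (response k psi W b x) (poly_map F x))%:E)%E.
Proof.
move=> omS Spsi hD ell mu mell adm W b.
have cr : continuous (response k psi W b) by apply: continuous_response; exact: geo_continuous.
have cF : continuous (poly_map F) by exact: continuous_poly_map.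
apply: (loss_gt0 cr cF mell); apply: (admissible_lt1 _ _ _ adm).
- exact: (measurable_agreement cr cF mell).
- exact: (agreement_null W b omS Spsi).
- move=> x Dx; have [e We] := parameters_surjective W b; have [i iN nA] := hD x e Dx.
  exists i => // h; apply: nA; apply/agree_cat; rewrite point_mx_env -h.
  exact: response_ext.
Qed.

Lemma generic_samples (S : forall n : nat, set (set 'rV[R]_n)) : o_minimal S ->
  S 2%N [set z : 'rV[R]_2 | z ord0 ord_max = psi (z ord0 ord0)] ->
  exists N, exists D : set 'M[R]_(N, n0), conull_dense_open D /\
  forall (x : nat -> 'cV[R]_n0) e, D (\matrix_(i < N, j < n0) x i j ord0) ->
    exists2 i, (i < N)%N & ~ agree (cat n0 (mx_env (x i)) e).
Proof.
move=> omS Spsi; have dA := dfn_agree omS Spsi; have [q [nA _]] := dA.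
(* [thin_union_of_powers] expects the parameters in front of the point, the reverse of the order in
   [agree]. The bound q on the coordinates read by [agree] serves as the number of parameters. *)
pose P e := agree (cat n0 (shift q e) e).
have nA' : depends_on (n0 + q) agree by apply: depends_on_le nA; exact: leq_addl.
have PE e x : P (cat q e x) <-> agree (cat n0 x e).
  rewrite /P shift_cat; apply: (depends_onE nA'); apply: depends_on_cat => i lti.
  exact: cat_lt.
have dP : @dfn R S P by rewrite /P; dfn_tac; rewrite /shift; dfn_tac.
have nP : depends_on (q + n0) P.
  move=> e e' ee'; apply: nA' => i lti; rewrite /cat /shift; case: ltnP => ni; apply: ee'.
    by rewrite ltn_add2l.
  by apply: (@leq_trans q); [rewrite ltn_subLR | exact: leq_addr].
have tP e : thin n0 (fun x => P (cat q e x)).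
  by move=> a r r0; have [x bx nAx] := thin_agree e a r0; exists x => // /PE.
pose N := (2 * q).+1.
pose B e := exists t, forall l, (l < N)%N -> P (cat q t (block n0 l e)).
have dB : @dfn R S B.
  pose Q e := forall l, (l < N)%N -> P (cat q e (block n0 l (shift q e))).
  have dQ : @dfn R S Q.
    by rewrite /Q; dfn_tac; apply: (dft_block omS) => *; rewrite /shift; dfn_tac.
  apply: dfn_ext (@dfn_ex_cat _ _ omS q Q dQ) => e; rewrite /Q.
  by split=> -[t h]; exists t => l lN; have := h l lN; rewrite cat_cat shift_cat.
have nB : depends_on (N * n0) B.
  by move=> e e' ee' [t h]; exists t => l lN; rewrite -(depends_on_block lN ee'); exact: h.
have tB : thin (N * n0) B.
  move=> a r r0.
  have [||X [bX nX]] := thin_union_of_powers omS dP nP tP (L := iota 0 N) _ _ (fun l => block n0 l a) r0.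
  - exact: iota_uniq.
  - by rewrite size_iota.
  exists (fun m => X (m %/ n0)%N (m %% n0)%N).
    move=> m mN; have n00 : (0 < n0)%N by move: mN; case: (n0) => //; rewrite muln0.
    have := bX (m %/ n0)%N _ (m %% n0)%N; rewrite mem_iota ltn_divLR// ltn_mod => /(_ mN n00).
    by rewrite /block ltn_mod n00 -divn_eq.
  move=> [t h]; have [l] := nX t; rewrite mem_iota => lN; apply.
  apply: nP (h l lN); apply: depends_on_cat => i lti; exact: block_flat.
(* B itself need not be closed: its closure is removed so that D is open. *)
exists N, [set M | ~ adherent (N * n0) B (mx_env M)]; split.
  apply: (conull_dense_open_thin omS).
  - exact: dfn_adherent.
  - exact: depends_on_adherent.
  - exact: (thin_adherent omS nB dB tB).
  - by move=> e; exact: not_adherent_open.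
move=> x e /= nB'; apply: contrapT => nex; apply: nB'; apply: adherent_sub.
exists e => l lN; apply/PE; apply: contrapT => nAl; apply: nex; exists l => // Al; apply: nAl.
apply: nA' Al; move=> i lti; rewrite /cat; case: ltnP => // i0.
by rewrite /block i0 -[l]/(nat_of_ord (Ordinal lN)) -[i]/(nat_of_ord (Ordinal i0)) mx_envE mxE mx_env_cv.
Qed.

Lemma distinct_samples (S : forall n : nat, set (set 'rV[R]_n)) : o_minimal S ->
  S 2%N [set z : 'rV[R]_2 | z ord0 ord_max = psi (z ord0 ord0)] -> n0 = 1%N ->
  exists N, conull_dense_open (@pairwise_distinct R N n0) /\
  forall (x : nat -> 'cV[R]_n0) e, pairwise_distinct (\matrix_(i < N, j < n0) x i j ord0) ->
    exists2 i, (i < N)%N & ~ agree (cat n0 (mx_env (x i)) e).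
Proof.
move=> omS Spsi d1; have dA := dfn_agree omS Spsi.
have [K hK] := uniform_finiteness omS dA.
have catE (x e : env R) : cat n0 x e = scons (x 0%N) e.
  by rewrite d1; apply/funext => -[|i] //; rewrite /cat /= subn1.
have fK e : atmost K (fib agree e).
  apply: hK; apply: (fib_finite omS) => // a b ab.
  have r0 : 0 < (b - a) / 2 by rewrite divr_gt0 ?subr_gt0.
  have [x bx nA] := thin_agree e (fun=> (a + b) / 2) r0.
  exists (x 0%N); last by rewrite -catE.
  have := bx 0%N; rewrite d1 => /(_ isT); rewrite ltr_norml => /andP[? ?].
  by apply/andP; split; lra.
exists K.+1; split; last first.
  move=> x e Dx; apply: contrapT => nex.
  have : (size [seq mx_env (x i) 0%N | i <- iota 0 K.+1] <= K)%N.
    apply: (fK e).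
      rewrite map_inj_in_uniq ?iota_uniq// => i j; rewrite !mem_iota !add0n => /andP[_ iK] /andP[_ jK] xij.
      apply/eqP; apply: contraT => ij.
      have := Dx (Ordinal iK) (Ordinal jK) ij; apply: contraNT => _; apply/eqP/rowP => c.
      rewrite !mxE -!mx_env_cv; have -> : nat_of_ord c = 0%N by have := ltn_ord c; rewrite {2}d1 ltnS leqn0 => /eqP.
      by [].
    move=> _ /mapP[i + ->]; rewrite mem_iota add0n => /andP[_ iK].
    apply: contrapT => nAi; apply: nex; exists i => // Ai; apply: nAi.
    by rewrite /fib /= -catE.
  by rewrite size_map size_iota ltnn.
set N := K.+1.
pose E (p : nat * nat) (e : env R) := e (p.1 * n0)%N = e (p.2 * n0)%N.
pose I := [set p : nat * nat | [/\ (p.1 < N)%N, (p.2 < N)%N & p.1 != p.2]].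
have fI : finite_set I.
  by apply: (@sub_finite_set _ _ (`I_N `*` `I_N)); [move=> p [] | apply: finite_setX; exact: finite_II].
(* The complement of the distinct tuples is a finite union of hyperplanes, each definable and
   thin. *)
pose Q e := exists2 p, I p & E p e.
have lt i : (i < N)%N -> (i * n0 < N * n0)%N by rewrite d1 !muln1.
have -> : @pairwise_distinct R N n0 = [set X | ~ Q (mx_env X)].
  apply/seteqP; split => X /=.
    move=> DX [[i j] [/= iN jN ij]]; rewrite /E /= => Xij.
    have /negP := DX (Ordinal iN) (Ordinal jN) ij; apply; apply/eqP/rowP => c.
    have c0 : nat_of_ord c = 0%N by have := ltn_ord c; rewrite {2}d1 ltnS leqn0 => /eqP.
    by rewrite !mxE -!mx_envE c0 !addn0.
  move=> nQ i j ij; apply/negP => /eqP rij; apply: nQ; exists (nat_of_ord i, nat_of_ord j).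
    by split; [exact: ltn_ord | exact: ltn_ord | exact: ij].
  have n00 : (0 < n0)%N by rewrite d1.
  have Xij : X i (Ordinal n00) = X j (Ordinal n00).
    by have := congr1 (fun r : 'rV[R]_n0 => r ord0 (Ordinal n00)) rij; rewrite /= !mxE.
  have := mx_envE X j (Ordinal n00); have := mx_envE X i (Ordinal n00).
  by rewrite /E /= !addn0 Xij => -> ->.
have dE p : @dfn R S (E p) by rewrite /E; dfn_tac.
have nE p : I p -> depends_on (N * n0) (E p).
  by move=> [p1 p2 _] e e' ee'; rewrite /E !ee'//; exact: lt.
apply: (conull_dense_open_thin omS).
- apply: (@dfn_ext _ _ (fun e => exists2 i, (i < N)%N & exists2 j, (j < N)%N & i != j /\ E (i, j) e)).
    move=> e; split=> [[i iN [j jN [ij Eij]]]|[[i j] [/= iN jN ij] Eij]]; first by exists (i, j).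
    by exists i => //; exists j.
  by dfn_tac; [exact: (dfn_const omS) | exact: dE].
- by move=> e e' ee' [p Ip Ep]; exists p => //; exact: nE Ep.
- apply: (thin_bigcup omS) => // p Ip a r r0.
  have [aE|] := pselect (E p a); last by exists a => //; exact: box_center.
  (* Shifting one coordinate leaves the hyperplane, since the other coordinate in its equation has a
     different index. *)
  exists (fun m => if m == (p.1 * n0)%N then a m + r / 2 else a m).
    move=> m _; case: ifP => _; last by rewrite subrr normr0.
    by rewrite addrAC subrr add0r ger0_norm ?divr_ge0 ?(ltW r0)// ltr_pdivrMr// ltr_pMr// ltr1n.
  case: Ip => _ _ pp; rewrite /E eqxx d1 !muln1 eq_sym (negbTE pp).
  move: aE; rewrite /E d1 !muln1 => -> /eqP; rewrite -subr_eq0 addrAC subrr add0r.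
  by rewrite mulf_eq0 invr_eq0 pnatr_eq0 orbF gt_eqF.
(* The coordinates of e are pairwise at least g apart, so moving each by less than g / 2 cannot make
   two of them equal. *)
- move=> e nQ; have [g g0 hg] := finite_gap (finite_image (fun i => e (i * n0)%N) (finite_II N)).
  exists (g / 2); first by rewrite divr_gt0.
  move=> x bx [[i j] [/= iN jN ij]]; rewrite /E /= => xij.
  have eij : e (i * n0)%N <> e (j * n0)%N by move=> eij; apply: nQ; exists (i, j).
  apply: (@no_common_near _ (e (i * n0)%N) (e (j * n0)%N) (x (i * n0)%N) g).
  - by apply: hg => //; [exists i | exists j].
  - exact: bx (lt _ iN).
  - by rewrite xij; exact: bx (lt _ jN).
Qed.

End main.

Theorem theorem3p4 (R : realType) (k : nat) (d : nat -> nat) (psi : R -> R)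
    (F : 'I_(d k.+1) -> mpoly.mpoly (d O) R) :
  (forall i : nat, (i <= k.+1)%N -> (0 < d i)%N) ->
  SAD psi ->
  (2 <= poly_map_deg F)%N ->
  exists (N : nat) (D : set 'M[R]_(N, d O)),
    conull_dense_open D /\
    (forall (ell : 'cV[R]_(d k.+1) -> 'cV[R]_(d k.+1) -> R)
            (mu : probability 'cV[R]_(d O) R),
       measurable_loss ell -> admissible D mu ->
       forall (W : forall j : nat, 'M[R]_(d j.+1, d j))
              (b : forall j : nat, 'cV[R]_(d j.+1)),
         (0 < \int[mu]_x (ell (response k psi W b x) (poly_map F x))%:E)%E) /\
    (d O = 1%N ->
       conull_dense_open (@pairwise_distinct R N (d O)) /\
       (forall (ell : 'cV[R]_(d k.+1) -> 'cV[R]_(d k.+1) -> R)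
               (mu : probability 'cV[R]_(d O) R),
          measurable_loss ell -> admissible (@pairwise_distinct R N (d O)) mu ->
          forall (W : forall j : nat, 'M[R]_(d j.+1, d j))
                 (b : forall j : nat, 'cV[R]_(d j.+1)),
            (0 < \int[mu]_x (ell (response k psi W b x) (poly_map F x))%:E)%E)).
Proof.
move=> _ [sl [ra [S [omS Spsi]]]] degF.
have gpsi t : geo psi t by exact: real_analytic_geo.
have lpsi : linear_growth psi by exact: sublinear_growth.
(* For d 0 = 1 the distinct tuples themselves serve as D, so that both claims share one N; otherwise
   the last claim is vacuous. *)
have [d1|d1] := pselect (d 0 = 1%N).
  have [N [cD hD]] := distinct_samples gpsi lpsi degF omS Spsi d1.
  have pos := loss_positive gpsi lpsi degF omS Spsi hD.
  by exists N, (@pairwise_distinct R N (d 0)).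
have [N [D [cD hD]]] := generic_samples gpsi lpsi degF omS Spsi.
have pos := loss_positive gpsi lpsi degF omS Spsi hD.
by exists N, D.
Qed.
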